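(* Let $G\le F\ne1$ be groups with $G\in\mathcal{C}$ and $F$ finitely generated and left orderable. Then there exists a left-relatively convex subgroup $B$ of $F$ with $B\ne F$ and $B\cap G\lhd G$, such that $G/(B\cap G)$ has a torsion free abelian normal subgroup $A/(B\cap G)$ which is its own centralizer in $G/(B\cap G)$, and $G/A$ is torsion free abelian.
   Context: A subgroup of a group $F$ is left-relatively convex if it is convex with respect to some left order on $F$ (a total order with $x\le y\Rightarrow fx\le fy$). Let $\mathcal{P}$ be the group of piecewise linear orientation preserving self-homeomorphisms of $[0,1]$ and $\mathrm{NS}$ the class of groups with no nonabelian free subsemigroup. $\mathcal{C}$ is the smallest class of groups containing all $\mathrm{NS}$-groups and $\mathcal{P}$, and closed under subgroups, homomorphic images, group extensions and directed unions. *)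

(* Defs.v *)
From HB Require Import structures.
From mathcomp Require Import all_boot.
From Stdlib Require Import Reals.

Set Implicit Arguments.
Unset Strict Implicit.
Unset Printing Implicit Defensive.

Local Open Scope group_scope.

Definition is_hom (G H : groupType) (f : G -> H) : Prop :=
  forall x y : G, f (x * y) = f x * f y.

Definition is_surj (A B : Type) (f : A -> B) : Prop :=
  forall y : B, exists x : A, f x = y.

Definition is_subgroup (G : groupType) (S : G -> Prop) : Prop :=
  S 1 /\ (forall x y, S x -> S y -> S (x * y)) /\ (forall x, S x -> S x^-1).

Definition is_normal (G : groupType) (S : G -> Prop) : Prop :=
  is_subgroup S /\ (forall x g : G, S x -> S (x ^ g)).

Inductive gen_by (G : groupType) (S : G -> Prop) : G -> Prop :=
| gen_base x : S x -> gen_by S x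
| gen_one : gen_by S 1
| gen_mul x y : gen_by S x -> gen_by S y -> gen_by S (x * y)
| gen_inv x : gen_by S x -> gen_by S x^-1.

Definition finitely_generated (G : groupType) : Prop :=
  exists s : seq G, forall x : G, gen_by (fun y => y \in s) x.

Definition left_order (G : groupType) (le : G -> G -> Prop) : Prop :=
  (forall x, le x x) /\
  (forall x y, le x y -> le y x -> x = y) /\
  (forall x y z, le x y -> le y z -> le x z) /\
  (forall x y, le x y \/ le y x) /\
  (forall f x y, le x y -> le (f * x) (f * y)).

Definition left_orderable (G : groupType) : Prop :=
  exists le : G -> G -> Prop, left_order le.

Definition convex_wrt (G : groupType) (le : G -> G -> Prop) (B : G -> Prop) :=
  forall b1 b2 x, B b1 -> B b2 -> le b1 x -> le x b2 -> B x.

Definition left_relatively_convex (F : groupType) (B : F -> Prop) : Prop :=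
  is_subgroup B /\ exists le : F -> F -> Prop, left_order le /\ convex_wrt le B.

Fixpoint word_eval (G : groupType) (a b : G) (w : seq bool) : G :=
  match w with
  | [::] => 1
  | c :: w' => (if c then a else b) * word_eval a b w'
  end.

Definition free_semigroup_pair (G : groupType) (a b : G) : Prop :=
  forall w1 w2 : seq bool, w1 <> [::] -> w2 <> [::] ->
    word_eval a b w1 = word_eval a b w2 -> w1 = w2.

Definition NS (G : groupType) : Prop :=
  ~ exists a b : G, free_semigroup_pair a b.

(* Orientation preserving piecewise linear self-homeomorphisms of [0,1];
   encoded as functions R -> R that are the identity outside [0,1]. *)
Definition is_PL_homeo (f : R -> R) : Prop :=
  (f 0 = 0)%R /\ (f 1 = 1)%R /\
  (forall x y : R, (0 <= x)%R -> (x < y)%R -> (y <= 1)%R -> (f x < f y)%R) /\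
  (forall y : R, (0 <= y <= 1)%R -> exists x : R, (0 <= x <= 1)%R /\ f x = y) /\
  (forall x : R, (x < 0)%R \/ (1 < x)%R -> f x = x) /\
  (exists (n : nat) (t a b : nat -> R),
      t 0%N = 0%R /\ t n = 1%R /\
      (forall i, (i < n)%N -> (t i < t i.+1)%R) /\
      (forall i x, (i < n)%N -> (t i <= x <= t i.+1)%R -> f x = (a i * x + b i)%R)).

Definition iso_to_P (G : groupType) : Prop :=
  exists phi : G -> (R -> R),
    injective phi /\
    (forall x y : G, phi (x * y) = (phi x \o phi y)) /\
    (forall g : G, is_PL_homeo (phi g)) /\
    (forall f : R -> R, is_PL_homeo f -> exists g : G, phi g = f).

Inductive inC : groupType -> Prop :=
| inC_NS (G : groupType) : NS G -> inC G
| inC_P (G : groupType) : iso_to_P G -> inC G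
| inC_sub (G H : groupType) (f : H -> G) :
    is_hom f -> injective f -> inC G -> inC H
| inC_quo (G H : groupType) (f : G -> H) :
    is_hom f -> is_surj f -> inC G -> inC H
| inC_ext (G K Q : groupType) (i : K -> G) (p : G -> Q) :
    is_hom i -> injective i -> is_hom p -> is_surj p ->
    (forall g : G, p g = 1 <-> exists k : K, i k = g) ->
    inC K -> inC Q -> inC G
| inC_union (G : groupType) (I : Type) (H : I -> groupType)
    (f : forall i : I, H i -> G) :
    (forall i, is_hom (f i)) -> (forall i, injective (f i)) ->
    (forall i j, exists k, (forall h : H i, exists h' : H k, f k h' = f i h) /\
                           (forall h : H j, exists h' : H k, f k h' = f j h)) ->
    (forall g : G, exists i (h : H i), f i h = g) ->
    (forall i, inC (H i)) -> inC G.

(* Main.v *)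
(* A subgroup of the finitely generated group F fixing a point of a complete chain on which F acts
   without global fixed points lies in a proper relatively convex subgroup, and proper relatively
   convex subgroups are stable under ultraproducts since F is finitely generated. The theorem is
   proved by induction on C for all subquotients of F; directed unions are ultraproducts.

   The core is a dichotomy for L normal in G <= F. Suppose that N <= L is normal in G, that N fixes
   a point, and that elements of L having fixed points in the chain Fix(N) have common fixed points
   there. Then L fixes a point, or L modulo these elements is an Archimedean ordered group, hence
   by Hoelder a subgroup of the reals on which G acts by positive scalars. If this subgroup is
   dense, it forces G to act affinely, which is the conclusion for G; if it is cyclic, it is
   central in G and can be divided out just as a group with a fixed point can. This settles
   extensions, because an affine group is metabelian.

   Groups without free subsemigroups have common fixed points by a ping-pong argument. For piecewise
   linear groups, the elements with trivial germs at all fixed points are filtered by layers,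
   each acting on one component of the complement of the fixed points; any finite subset of a layer
   has three commuting conjugates modulo the next layer, and then its commutators have a common
   fixed point. *)
From Stdlib Require Import Reals Lra Lia ZArith Classical.
Require Import Defs.
From HB Require Import structures.
From mathcomp Require Import all_boot.
From mathcomp Require boolp classical_sets filter.

Set Implicit Arguments.
Unset Strict Implicit.
Unset Printing Implicit Defensive.

Delimit Scope R_scope with R.
Local Open Scope group_scope.

(** * Ultraproducts of left-invariant preorders *)

(** Fixed points in a chain are produced as suprema or infima of bounded invariant sets. A chain is
    chosen for the sake of one fixed point of N, but [~ fixd L] excludes fixed points of L in every
    chain, so all orbits of L in the chosen one are unbounded. The points fixed by N are closed
    under suprema and infima and are permuted by [G]; working with this set inside a chain of [F]
    avoids a chain for the quotient, on which [F] would not act. A cyclic L that fixes no point is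
    replaced by the kernel of its translation number, which does fix one. The price is that
    relations known modulo L must be improved to relations modulo that kernel. For commutator
    relations this works because a commutator of maps commuting with a translation moves points by
    less than two units, which central translations violate after passing to powers; for the absence
    of free semigroups a longer pair of words serves. Hence hypotheses on quotients enter the
    induction as commutator relations or as relations between words. *)

Definition ultra (I : Type) (U : (I -> Prop) -> Prop) : Prop :=
  (forall P Q, U P -> U Q -> U (fun i => P i /\ Q i)) /\
  (forall P Q : I -> Prop, (forall i, P i -> Q i) -> U P -> U Q) /\
  ~ U (fun _ => False) /\
  (forall P, U P \/ U (fun i => ~ P i)).

(** In every use [D k] consists of the indices at least as large as [k] in a directed order, so the
    ultrafilter contains all tails; [k0] keeps the filter base from being empty. *)
Lemma ultra_exists (I K : Type) (D : K -> I -> Prop) (k0 : K) :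
  (forall k, exists i, D k i) ->
  (forall k k', exists k'', forall i, D k'' i -> D k i /\ D k' i) ->
  exists U, ultra U /\ forall k, U (D k).
Proof.
move=> Dne Ddir.
pose Fl : classical_sets.set (classical_sets.set I) := fun A => exists k, forall i, D k i -> A i.
have FlP : filter.ProperFilter Fl.
  split.
    by case=> k kF; have [i /kF] := Dne k.
  split.
  - by exists k0.
  - move=> A B [k kA] [k' kB]; have [k'' kk] := Ddir k k'.
    by exists k'' => i /kk [/kA ? /kB ?]; split.
  - by move=> A B AB [k kA]; exists k => i /kA /AB.
have [U [UU FU]] := filter.ultraFilterLemma FlP.
have UF : filter.Filter U := @filter.filter_filter _ _ (@filter.ultra_proper _ _ UU).
exists U; split; last by move=> k; apply: FU; exists k.
split; first by move=> P Q; apply: filter.filterI.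
split; first by move=> P Q PQ; apply: filter.filterS.
split; first exact: (@filter.filter_not_empty _ _ (@filter.ultra_proper _ _ UU)).
by move=> P; apply: filter.in_ultra_setVsetC.
Qed.

Section Preorders.

Variable F : groupType.

(* Left-relatively convex subgroups are handled as the kernels of total left-invariant
   preorders: unlike left orders with a given convex subgroup, these pass to ultraproducts. *)
Definition lpre (le : F -> F -> Prop) : Prop :=
  (forall x y, le x y \/ le y x) /\
  (forall x y z, le x y -> le y z -> le x z) /\
  (forall f x y, le x y -> le (f * x) (f * y)).

Definition ker (le : F -> F -> Prop) (x : F) : Prop := le x 1 /\ le 1 x.

(* [N] lies in a proper left-relatively convex subgroup; equivalently, [N] fixes a point of some
   [chain] below. *)
Definition fixd (N : F -> Prop) : Prop :=
  exists le, lpre le /\ (exists x, ~ ker le x) /\ forall x, N x -> ker le x.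

Lemma fixdS (N N' : F -> Prop) : (forall x, N' x -> N x) -> fixd N -> fixd N'.
Proof. by move=> NN [le [ple [nt kN]]]; exists le; split=> //; split=> // x /NN /kN. Qed.

Lemma ker_subgroup le : lpre le -> is_subgroup (ker le).
Proof.
move=> [tot [tr inv]]; have rfl x : le x x by case: (tot x x).
split; first by split.
split=> [x y [x1 x2] [y1 y2]|x [x1 x2]].
  split; first by apply: tr x1; rewrite -{2}[x]mulg1; apply: inv.
  by apply: tr x2 _; rewrite -{1}[x]mulg1; apply: inv.
split; first by have := inv x^-1 _ _ x2; rewrite mulg1 mulVg.
by have := inv x^-1 _ _ x1; rewrite mulg1 mulVg.
Qed.

(** Powers of an element on one side of 1 move further to that side, so a power equivalent to 1
    squeezes the element. This is the source of the torsion freeness of A modulo B. *)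
Lemma ker_rootclosed le x n : lpre le -> (0 < n)%N -> ker le (x ^+ n) -> ker le x.
Proof.
move=> [tot [tr inv]]; case: n => // n _.
have rfl y : le y y by case: (tot y y).
have up (y : F) : le 1 y -> forall m, le 1 (y ^+ m).
  move=> y1; elim=> [|m IH]; first by rewrite expg0.
  by rewrite expgS; apply: tr y1 _; have := inv y _ _ IH; rewrite mulg1.
have dn (y : F) : le y 1 -> forall m, le (y ^+ m) 1.
  move=> y1; elim=> [|m IH]; first by rewrite expg0.
  by rewrite expgS; apply: tr y1; have := inv y _ _ IH; rewrite mulg1.
move=> [xn1 xn2]; case: (tot x 1) => hx; split=> //.
  by apply: tr xn2 _; rewrite expgS; have := inv x _ _ (dn _ hx n); rewrite mulg1.
by apply: tr xn1; rewrite expgS; have := inv x _ _ (up _ hx n); rewrite mulg1.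
Qed.

(** Lexicographic refinement: a given left order breaks the ties of [le], that is, it orders each
    coset of the kernel. *)
Lemma ker_relatively_convex le :
  left_orderable F -> lpre le -> left_relatively_convex (ker le).
Proof.
move=> [lo [lor [loa [lotr [lot loi]]]]] ple; split; first exact: ker_subgroup.
have [tot [tr inv]] := ple.
have rfl x : le x x by case: (tot x x).
have invV f x y : le (f * x) (f * y) -> le x y.
  by move=> /(inv f^-1); rewrite !mulKg.
exists (fun x y => le x y /\ (le y x -> lo x y)); split.
  split=> //; split=> [x y [h1 h2] [h3 h4]|]; first by apply: loa; [exact: h2|exact: h4].
  split=> [x y z [xy hxy] [yz hyz]|].
    split=> [|zx]; first exact: tr yz.
    by apply: (lotr _ y); [apply: hxy; apply: tr zx|apply: hyz; apply: tr xy].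
  split=> [x y|f x y [xy hxy]].
    case: (classic (le x y)) => xy; case: (classic (le y x)) => yx.
    - by case: (lot x y); [left|right]; split.
    - by left; split.
    - by right; split.
    - by case: (tot x y).
  by split=> [|/invV /hxy /(loi f)]; first exact: inv.
move=> b1 b2 x [b11 b12] [b21 b22] [h1 _] [h2 _].
by split; [apply: tr b21|apply: tr h1].
Qed.

(* By [nofix] every point stabiliser is a proper relatively convex subgroup. *)
Record chain := Chain {
  pt :> Type;
  cle : pt -> pt -> Prop;
  act : F -> pt -> pt;
  cle_total : forall c d, cle c d \/ cle d c;
  cle_trans : forall c d e, cle c d -> cle d e -> cle c e;
  cle_anti : forall c d, cle c d -> cle d c -> c = d;
  act1 : forall c, act 1 c = c;
  actM : forall x y c, act (x * y) c = act x (act y c);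
  act_mono : forall x c d, cle c d -> cle (act x c) (act x d);
  cle_lub : forall P : pt -> Prop, (exists c, P c) ->
    (exists u, forall c, P c -> cle c u) ->
    exists s, (forall c, P c -> cle c s) /\
              (forall u, (forall c, P c -> cle c u) -> cle s u);
  nofix : forall c, exists x, act x c <> c }.

Definition fixes (C : chain) (N : F -> Prop) (c : C) := forall n, N n -> act n c = c.

Section Cuts.

Variable le : F -> F -> Prop.
Hypothesis ple : lpre le.

(** Excluding the empty and the full down-set is what yields [nofix]: these are the two ends, fixed
    by all of [F]. *)
Definition is_cut (J : F -> Prop) : Prop :=
  (forall x y, le x y -> J y -> J x) /\ (exists x, J x) /\ (exists x, ~ J x).

Definition cut := {J : F -> Prop | is_cut J}.

Lemma cut_eq (J K : cut) : (forall x, sval J x <-> sval K x) -> J = K.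
Proof.
case: J K => [J jP] [K kP] /= JK.
have E : J = K by apply: boolp.funext => x; apply: boolp.propext.
by subst K; congr exist; apply: boolp.Prop_irrelevance.
Qed.

Lemma is_cut_act x (J : cut) : is_cut (fun y => sval J (x^-1 * y)).
Proof.
have [tot [tr inv]] := ple; case: J => J [dn [[a Ja] [b nJb]]] /=.
split; first by move=> y z yz; apply: dn; apply: inv.
by split; [exists (x * a)|exists (x * b)]; rewrite mulKg.
Qed.

Definition cut_act x (J : cut) : cut := exist is_cut _ (is_cut_act x J).

Definition cut_le (J K : cut) : Prop := forall x, sval J x -> sval K x.

Lemma cut_chain :
  exists (C : chain) (f : cut -> C), forall x J, f (cut_act x J) = act x (f J).
Proof.
have [tot [tr inv]] := ple.
unshelve eexists (@Chain cut cut_le cut_act _ _ _ _ _ _ _ _); last by exists (fun J => J).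
- move=> [J [dJ [J1 J2]]] [K [dK [K1 K2]]]; rewrite /cut_le /=.
  case: (classic (forall x, J x -> K x)) => [|nJK]; first by left.
  have [x nx] := not_all_ex_not _ _ nJK.
  have [Jx nKx] := imply_to_and _ _ nx.
  right=> y Ky; case: (tot x y) => [xy|yx]; last exact: dJ Jx.
  by case: nKx; apply: dK Ky.
- by move=> J K L JK KL x /JK /KL.
- by move=> J K JK KJ; apply: cut_eq => x; split; [apply: JK|apply: KJ].
- by move=> J; apply: cut_eq => x /=; rewrite invg1 mul1g.
- by move=> x y J; apply: cut_eq => z /=; rewrite invgM mulgA.
- by move=> x J K JK z; apply: JK.
- move=> P [J PJ] [u Pu].
  have cS : is_cut (fun x => exists2 K, P K & sval K x).
    split; first by move=> x y xy [K PK Ky]; exists K => //; apply: (proj1 (svalP K)) Ky.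
    split; first by have [x Jx] := proj1 (proj2 (svalP J)); exists x, J.
    have [x nux] := proj2 (proj2 (svalP u)).
    by exists x => -[K PK Kx]; apply: nux; apply: Pu PK _ Kx.
  exists (exist is_cut _ cS); split; first by move=> K PK x Kx; exists K.
  by move=> v Pv x [K PK Kx]; apply: Pv PK _ Kx.
- move=> J; have [dn [[a Ja] [b nJb]]] := svalP J.
  exists (b * a^-1) => E; apply: nJb; rewrite -E /=.
  by rewrite invgM invgK mulgVK.
Qed.

End Cuts.

Lemma fixd_chain N : fixd N -> exists (C : chain) (c : C), fixes N c.
Proof.
move=> [le [ple [[w nw] kN]]]; have [tot [tr inv]] := ple.
have rfl x : le x x by case: (tot x x).
have cc : is_cut le (fun y => le y 1).
  split; first by move=> x y xy y1; apply: tr y1.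
  split; first by exists 1.
  (* The complement contains [w] or [w^-1], since otherwise [w] would lie in the kernel. *)
  case: (classic (le w 1)) => w1; last by exists w.
  exists w^-1 => /(inv w); rewrite mulgV mulg1 => w2.
  by apply: nw; split.
have [C [f fE]] := cut_chain ple.
exists C, (f (exist _ _ cc)) => n /kN [n1 n2].
rewrite -fE; congr f; apply: cut_eq => x /=; split=> h.
  by apply: tr n1; have := inv n _ _ h; rewrite mulVKg mulg1.
by rewrite -(mulVg n); apply: inv; apply: tr n2.
Qed.

End Preorders.

Section Limits.

Variable F : groupType.
Hypothesis fgF : finitely_generated F.

Lemma ultra_inhabited (I : Type) (U : (I -> Prop) -> Prop) P :
  ultra U -> U P -> exists i, P i.
Proof.
move=> [_ [Umono [nU0 _]]] UP; apply: NNPP => nP; apply: nU0.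
by apply: Umono UP => i Pi; apply: nP; exists i.
Qed.

Lemma lim_lpre (I : Type) (U : (I -> Prop) -> Prop) (le : I -> F -> F -> Prop) :
  ultra U -> (forall i, lpre (le i)) -> lpre (fun x y => U (fun i => le i x y)).
Proof.
move=> [Uand [Umono [nU0 Uor]]] ple; split.
  move=> x y; case: (Uor (fun i => le i x y)) => h; first by left.
  by right; apply: Umono h => i nle; case: (proj1 (ple i) x y).
split=> [x y z xy yz|f x y xy].
  by apply: Umono (Uand _ _ xy yz) => i [] ; apply: (proj1 (proj2 (ple i))).
by apply: Umono xy => i; apply: (proj2 (proj2 (ple i))).
Qed.

Lemma ker_lim (I : Type) (U : (I -> Prop) -> Prop) (le : I -> F -> F -> Prop) x :
  ultra U -> ker (fun x y => U (fun i => le i x y)) x <-> U (fun i => ker (le i) x).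
Proof.
move=> [Uand [Umono [nU0 Uor]]]; split=> [[h1 h2]|h]; first exact: Uand.
by split; apply: Umono h => i [].
Qed.

(* Properness of the kernel survives the limit because it is witnessed on a fixed finite set of generators. *)
Lemma lim_nontrivial (I : Type) (U : (I -> Prop) -> Prop) (le : I -> F -> F -> Prop) :
  ultra U -> (forall i, lpre (le i)) -> (forall i, exists x, ~ ker (le i) x) ->
  exists x, ~ ker (fun x y => U (fun i => le i x y)) x.
Proof.
move=> uU ple nt; have [Uand [Umono [nU0 Uor]]] := uU.
apply: NNPP => h.
have all x : U (fun i => ker (le i) x).
  by apply/ker_lim => //; apply: NNPP => nx; apply: h; exists x.
have [s gs] := fgF.
have : U (fun i => forall x, x \in s -> ker (le i) x).
  elim: s {gs} => [|y s IH]; first by apply: Umono (all 1) => i _ x.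
  apply: Umono (Uand _ _ (all y) IH) => i [ky ks] x.
  by rewrite inE => /orP[/eqP->|/ks].
case/(ultra_inhabited uU) => i ks.
have [x] := nt i; apply; have [k1 [kM kV]] := ker_subgroup (ple i).
by elim: (gs x) => {x} [x|//|x y _ kx _ ky|x _ kx]; [apply: ks|apply: kM|apply: kV].
Qed.

(** Compactness, by the ultraproduct along the finite subsets of [L]: each condition on the limit
    kernel concerns one element, which belongs to all large finite subsets. *)
Lemma fixd_compact (N L : F -> Prop) :
  (forall s : seq F, (forall x, x \in s -> L x) -> fixd (fun x => N x \/ x \in s)) ->
  fixd (fun x => N x \/ L x).
Proof.
move=> H; pose I := {s : seq F | forall x, x \in s -> L x}.
have [le ple] := boolp.choice (fun i : I => H (sval i) (svalP i)).
have nilL x : x \in ([::] : seq F) -> L x by [].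
have [s|s t|U [uU UD]] := @ultra_exists I I (fun s t => forall x, x \in sval s -> x \in sval t)
  (exist _ _ nilL).
- by exists s.
- have st x : x \in sval s ++ sval t -> L x.
    by rewrite mem_cat => /orP[]; [apply: (svalP s)|apply: (svalP t)].
  exists (exist _ _ st) => i /= h.
  by split=> x xs; apply: h; rewrite mem_cat xs ?orbT.
exists (fun x y => U (fun i => le i x y)); split.
  by apply: lim_lpre => // i; case: (ple i).
split; first by apply: lim_nontrivial => // i; case: (ple i) => // _ [].
move=> x h; apply/ker_lim => //.
case: h => [Nx|Lx].
  have [_ [Umono _]] := uU.
  by apply: Umono (UD (exist _ _ nilL)) => i _; apply: (proj2 (proj2 (ple i))); left.
have xL y : y \in [:: x] -> L y by rewrite inE => /eqP->.
have [_ [Umono _]] := uU.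
apply: Umono (UD (exist _ _ xL)) => i /= h.
by apply: (proj2 (proj2 (ple i))); right; apply: h; rewrite inE.
Qed.

End Limits.

(** * Actions on complete chains *)

Section ChainTheory.

Variables (F : groupType) (C : chain F).
Implicit Types (c d e : C) (x y : F) (P : C -> Prop).

Definition clt c d := ~ cle d c.

Lemma cle_refl c : cle c c. Proof. by case: (cle_total c c). Qed.

Lemma cltW c d : clt c d -> cle c d. Proof. by case: (cle_total c d) => // ? []. Qed.

Lemma clt_cle_trans d c e : clt c d -> cle d e -> clt c e.
Proof. by move=> cd de ec; apply: cd; apply: cle_trans ec. Qed.

Lemma cle_clt_trans d c e : cle c d -> clt d e -> clt c e.
Proof. by move=> cd de ec; apply: de; apply: cle_trans cd. Qed.

Lemma clt_neq c d : clt c d -> c <> d.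
Proof. by move=> cd E; apply: cd; rewrite E; apply: cle_refl. Qed.

Lemma neq_clt c d : c <> d -> clt c d \/ clt d c.
Proof.
move=> cd; case: (classic (cle c d)) => h; last by right.
by left=> h'; apply: cd; apply: cle_anti.
Qed.

Lemma cle_clt c d : cle c d -> c <> d -> clt c d.
Proof. by move=> cd n dc; apply: n; apply: cle_anti. Qed.

Lemma actK x c : act x^-1 (act x c) = c.
Proof. by rewrite -actM mulVg act1. Qed.

Lemma actVK x c : act x (act x^-1 c) = c.
Proof. by rewrite -actM mulgV act1. Qed.

Lemma act_cle x c d : cle (act x c) (act x d) <-> cle c d.
Proof.
by split=> [/(act_mono x^-1)|]; [rewrite !actK|apply: act_mono].
Qed.

Lemma act_clt x c d : clt (act x c) (act x d) <-> clt c d.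
Proof. by rewrite /clt act_cle. Qed.

Lemma act_fixV x c : act x c = c -> act x^-1 c = c.
Proof. by move=> E; rewrite -{1}E actK. Qed.

Lemma act_fixX x n c : act x c = c -> act (x ^+ n) c = c.
Proof.
by move=> E; elim: n => [|n IH]; rewrite ?expg0 ?act1 // expgS actM IH.
Qed.

Definition supc P s := (forall c, P c -> cle c s) /\ (forall u, (forall c, P c -> cle c u) -> cle s u).
Definition infc P s := (forall c, P c -> cle s c) /\ (forall u, (forall c, P c -> cle u c) -> cle u s).

Lemma cle_glb P : (exists c, P c) -> (exists u, forall c, P c -> cle u c) -> exists s, infc P s.
Proof.
move=> [c Pc] [u Pu].
have [|s [s1 s2]] := @cle_lub _ _ (fun v => forall d, P d -> cle v d) (ex_intro _ u Pu).
  by exists c => v; apply.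
by exists s; split=> [d Pd|v Pv]; [apply: s2 => v; apply|apply: s1].
Qed.

Lemma supc_fix P s x : supc P s ->
  (forall c, P c -> P (act x c)) -> (forall c, P c -> P (act x^-1 c)) -> act x s = s.
Proof.
move=> [s1 s2] Px Px'; apply: cle_anti.
  by rewrite -(act_cle x^-1) actK; apply: s2 => c Pc; rewrite -(act_cle x) actVK; apply/s1/Px.
by apply: s2 => c Pc; rewrite -(act_cle x^-1) actK; apply/s1/Px'.
Qed.

Lemma infc_fix P s x : infc P s ->
  (forall c, P c -> P (act x c)) -> (forall c, P c -> P (act x^-1 c)) -> act x s = s.
Proof.
move=> [s1 s2] Px Px'; apply: cle_anti.
  by apply: s2 => c Pc; rewrite -(act_cle x^-1) actK; apply/s1/Px'.
by rewrite -(act_cle x^-1) actK; apply: s2 => c Pc; rewrite -(act_cle x) actVK; apply/s1/Px.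
Qed.

Lemma supc_fixes N P s : is_subgroup N -> supc P s -> (forall c, P c -> fixes N c) -> fixes N s.
Proof.
move=> [_ [_ NV]] sP PN n Nn.
by apply: (supc_fix sP) => c Pc; rewrite (PN c Pc) //; apply: NV.
Qed.

Lemma infc_fixes N P s : is_subgroup N -> infc P s -> (forall c, P c -> fixes N c) -> fixes N s.
Proof.
move=> [_ [_ NV]] sP PN n Nn.
by apply: (infc_fix sP) => c Pc; rewrite (PN c Pc) //; apply: NV.
Qed.

Lemma infc_approx P s u : infc P s -> clt s u -> exists c, P c /\ clt c u.
Proof.
move=> [s1 s2] us; apply: NNPP => h; apply: us; apply: s2 => c Pc.
by apply: NNPP => uc; apply: h; exists c; split.
Qed.

Lemma lpre_act c : lpre (fun x y => cle (act x c) (act y c)).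
Proof.
split; first by move=> x y; apply: cle_total.
split; first by move=> x y z; apply: cle_trans.
by move=> f x y; rewrite !actM; apply: act_mono.
Qed.

Lemma ker_act c x : ker (fun x y => cle (act x c) (act y c)) x <-> act x c = c.
Proof.
rewrite /ker act1; split=> [[h1 h2]|->]; first exact: cle_anti.
by split; apply: cle_refl.
Qed.

Lemma fixd_act c : fixd (fun x => act x c = c).
Proof.
exists (fun x y => cle (act x c) (act y c)); split; first exact: lpre_act.
split; first by have [x xc] := nofix c; exists x; rewrite ker_act.
by move=> x; rewrite ker_act.
Qed.

Lemma fixes_fixd N c : fixes N c -> fixd N.
Proof. by move=> Nc; apply: fixdS (fixd_act c). Qed.

(** The supremum of a bounded orbit would be a fixed point of [H]. *)
Lemma orbit_unbounded H c u : is_subgroup H -> ~ fixd H ->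
  exists h, H h /\ clt u (act h c).
Proof.
move=> [H1 [HM HV]] nH; apply: NNPP => hn; apply: nH.
have [||s sP] := @cle_lub _ _ (fun d => exists2 h, H h & d = act h c).
- by exists c, 1; rewrite ?act1.
- exists u => _ [h Hh ->]; apply: NNPP => uh; apply: hn; by exists h.
apply: (@fixes_fixd _ s) => h Hh.
apply: (supc_fix sP) => _ [k Hk ->].
  by exists (h * k); rewrite ?actM //; apply: HM.
by exists (h^-1 * k); rewrite ?actM //; apply: HM => //; apply: HV.
Qed.

Lemma orbit_unboundedV H c u : is_subgroup H -> ~ fixd H ->
  exists h, H h /\ clt (act h c) u.
Proof.
move=> sH nH; have [h [Hh uh]] := orbit_unbounded u c sH nH.
have [_ [_ HV]] := sH.
by exists h^-1; split; [apply: HV|rewrite -(act_clt h) actVK].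
Qed.

End ChainTheory.

Lemma ex_least (Q : nat -> Prop) n : Q n -> exists m, Q m /\ forall k, Q k -> (m <= k)%N.
Proof.
have [m] := ubnP n; elim: m n => // m IH n nm Qn.
case: (classic (exists2 k, Q k & (k < n)%N)) => [[k Qk kn]|h].
  by apply: (IH k) => //; apply: leq_trans kn _; rewrite -ltnS.
exists n; split=> // k Qk; rewrite leqNgt; apply/negP => kn; apply: h.
by exists k.
Qed.

(** * Commutators of maps that commute with a translation *)

Section CommutatorBound.

(** In the cyclic case [M] is the action of a central element; for commuting copies it is a
    pointwise maximum of finitely many group elements. Therefore it is only a monotone map, not an
    element of [F]. *)
Variables (F : groupType) (C : chain F) (P : C -> Prop) (M : C -> C) (x y : F).
Hypotheses (PM : forall c, P c -> P (M c)) (Px : forall c, P c -> P (act x c))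
  (Py : forall c, P c -> P (act y c)).
Hypothesis Mmono : forall c d, clt c d -> clt (M c) (M d).
Hypotheses (Mx : forall c, P c -> M (act x c) = act x (M c))
  (My : forall c, P c -> M (act y c) = act y (M c)).
Hypothesis Mge : forall c, P c -> cle c (M c).
Hypothesis Mcof : forall c u, P c -> exists n, clt u (iter n M c).

Let iterP n c : P c -> P (iter n M c).
Proof. by move=> Pc; elim: n => // n IH; apply: PM. Qed.

Let iter_clt n c d : clt c d -> clt (iter n M c) (iter n M d).
Proof. by move=> cd; elim: n => // n IH; apply: Mmono. Qed.

Let iter_cle n c d : cle c d -> cle (iter n M c) (iter n M d).
Proof.
move=> cd; case: (classic (c = d)) => [->|n_]; first exact: cle_refl.
by apply/cltW/iter_clt/cle_clt.
Qed.

Let iterx n c : P c -> iter n M (act x c) = act x (iter n M c).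
Proof. by move=> Pc; elim: n => //= n ->; rewrite Mx //; apply: iterP. Qed.

Let itery n c : P c -> iter n M (act y c) = act y (iter n M c).
Proof. by move=> Pc; elim: n => //= n ->; rewrite My //; apply: iterP. Qed.

Let iter_le m n c : P c -> (m <= n)%N -> cle (iter m M c) (iter n M c).
Proof.
move=> Pc /subnK <-; elim: (n - m)%N => [|k IH]; first exact: cle_refl.
by apply: cle_trans IH _; apply: Mge; apply: iterP.
Qed.

Let floor c d : P c -> P d -> exists q0, forall q, (q0 <= q)%N ->
  exists k, cle (iter k M c) (iter q M d) /\ clt (iter q M d) (iter k.+1 M c).
Proof.
(* From the [q0]-th on, the iterates of [d] lie above [c], so the least iterate of [c] exceeding one
   of them has a positive index [k.+1]. *)
move=> Pc Pd; have [q0 hq0] := Mcof c Pd; exists q0 => q qq.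
have [n hn] := Mcof (iter q M d) Pc.
have [[|k] [hk kmin]] := @ex_least (fun n => clt (iter q M d) (iter n M c)) n hn.
  case: hk; apply: cle_trans (cltW hq0) _; exact: iter_le.
exists k; split=> //; apply: NNPP => h.
by have := kmin _ h; rewrite ltnn.
Qed.

(* Both words lie in the same interval between the (p1+p2)-th and the
   (p1+p2+2)-nd iterate of [M] at [c], after applying a large power of [M]. *)
Lemma commutator_bound c : P c ->
  clt (act y (act x c)) (M (M (act x (act y c)))).
Proof.
move=> Pc; have Pxc := Px Pc; have Pyc := Py Pc.
have [q1 hq1] := floor Pc Pxc; have [q2 hq2] := floor Pc Pyc.
pose q := maxn q1 q2.
have [p1 [lo1 up1]] := hq1 q (leq_maxl _ _).
have [p2 [lo2 up2]] := hq2 q (leq_maxr _ _).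
have comm m n d : iter m M (iter n M d) = iter n M (iter m M d).
  by rewrite -!iterD addnC.
have up : clt (iter (q + q) M (act y (act x c))) (iter (p1.+1 + p2.+1) M c).
  rewrite iterD (itery q Pxc).
  apply: (@clt_cle_trans _ _ (iter p1.+1 M (iter q M (act y c)))).
    by rewrite comm (itery p1.+1 Pc); apply: iter_clt; apply/act_clt.
  by rewrite iterD; apply/iter_cle/cltW.
have lo : cle (iter (p2 + p1) M c) (iter (q + q) M (act x (act y c))).
  rewrite 2!iterD (iterx q Pyc).
  apply: (@cle_trans _ _ _ (iter p2 M (iter q M (act x c)))); first exact: iter_cle.
  by rewrite comm (iterx p2 Pc); apply/iter_cle/act_cle.
have {}lo : cle (iter (p1.+1 + p2.+1) M c) (iter (q + q) M (M (M (act x (act y c))))).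
  rewrite -[M (M _)]/(iter 2 M _) comm.
  have -> : (p1.+1 + p2.+1 = 2 + (p2 + p1))%N by rewrite addSn addnS add2n addnC.
  by rewrite iterD; apply: iter_cle.
move=> h; apply: up; apply: cle_trans lo _; exact: iter_cle.
Qed.

End CommutatorBound.

(** * The target statement and the normal subgroups that can be divided out *)

Section Conclusions.

Variable F : groupType.
Hypothesis fgF : finitely_generated F.

Definition normalised (G N : F -> Prop) := forall n g, N n -> G g -> N (n ^ g).

(* The conclusion of the theorem in a form that passes to ultraproducts: the centraliser condition
   only mentions one [a] at a time. If [A <= ker le] then [G] itself takes the place of [A]. *)
Definition concl (G : F -> Prop) : Prop :=
  exists (le : F -> F -> Prop) (A : F -> Prop),
    lpre le /\ (exists x, ~ ker le x) /\
    (forall b g, G b -> G g -> ker le b -> ker le (b ^ g)) /\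
    is_subgroup A /\ (forall a, A a -> G a) /\ normalised G A /\
    (forall g, G g -> ker le g -> A g) /\
    (forall a a', A a -> A a' -> ker le [~ a, a']) /\
    (forall a g, A a -> ~ ker le a -> G g -> ker le [~ g, a] -> A g) /\
    (forall g h, G g -> G h -> A [~ g, h]) /\
    (forall g n, G g -> (0 < n)%N -> A (g ^+ n) -> A g).

(* Abstracts the two cases in which passing to [G / N] loses nothing: [N] fixes a point, or
   modulo such a normal subgroup [N] is generated by a central translation. *)
Definition good (G N : F -> Prop) : Prop :=
  exists N0 : F -> Prop,
    is_subgroup N0 /\ (forall n, N0 n -> N n) /\ normalised G N0 /\ fixd N0 /\
    (forall g n, G g -> N n -> N0 [~ g, n]) /\
    (forall x y, G x -> G y -> N [~ x, y] -> N0 [~ x, y]).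

Lemma goodS (G G' N : F -> Prop) : (forall g, G' g -> G g) -> good G N -> good G' N.
Proof.
move=> GG [N0 [sN [N0N [nN [fN [cN dN]]]]]].
exists N0; do 2 split=> //; split; first by move=> n g Nn /GG; apply: nN.
split=> //; split=> [g n /GG Gg|x y /GG Gx /GG Gy]; [exact: cN|exact: dN].
Qed.

Lemma fixd_good (G N : F -> Prop) :
  is_subgroup N -> normalised G N -> fixd N -> good G N.
Proof.
move=> sN nN fN; exists N; do 5 split=> //.
move=> g n Gg Nn; have [_ [NM NV]] := sN.
by rewrite commgEr; apply: NM => //; rewrite conjVg; apply/NV/nN.
Qed.

Lemma subgroupJ (G : F -> Prop) x g : is_subgroup G -> G x -> G g -> G (x ^ g).
Proof. by move=> [_ [GM GV]] Gx Gg; rewrite conjgE; apply: (GM); [apply: GV|apply: (GM)]. Qed.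

Lemma subgroupR (G : F -> Prop) x g : is_subgroup G -> G x -> G g -> G [~ x, g].
Proof.
move=> sG Gx Gg; have [_ [GM GV]] := sG.
by apply: GM; [apply: GV|apply: subgroupJ].
Qed.

Lemma subgroupX (G : F -> Prop) x n : is_subgroup G -> G x -> G (x ^+ n).
Proof.
by move=> [G1 [GM GV]] Gx; elim: n => [|n IH]; rewrite ?expg0 // expgS; apply: GM.
Qed.

(** All commutators of [G] lie in [N0], so [A = G] meets every clause. *)
Lemma good_concl (G : F -> Prop) : is_subgroup G -> good G G -> concl G.
Proof.
move=> sG [N0 [_ [_ [_ [[le [ple [nt kN]]] [cG _]]]]]].
have kc g h : G g -> G h -> ker le [~ g, h] by move=> Gg Gh; apply/kN/cG.
exists le, G; do 2 split=> //; split.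
  move=> b g Gb Gg kb; have [_ [kM _]] := ker_subgroup ple.
  by rewrite -[b ^ g](mulVKg b) -commgEl; apply: kM => //; apply: kc.
do 2 split=> //; split; first by move=> a g Ga Gg; apply: subgroupJ.
do 3 split=> //; split=> // g h Gg Gh; exact: subgroupR.
Qed.

End Conclusions.

(** * Archimedean orders and Hoelder's theorem *)

Section Archimedean.

Variable F : groupType.
Hypothesis fgF : finitely_generated F.

(** Powers of [l] have to be cofinal in all of [F], not only in [L], because in the dense case every
    element of [F] receives a real coordinate. For [L <= G], invariance under conjugation makes the
    order two-sided on [L]. *)
Definition archimedean (G L : F -> Prop) (le : F -> F -> Prop) : Prop :=
  lpre le /\ (exists x, ~ ker le x) /\
  (forall l g, L l -> G g -> le 1 l -> le 1 (l ^ g)) /\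
  (forall l, L l -> ~ le l 1 -> forall x, exists n, le x (l ^+ n) /\ le (l ^- n) x) /\
  (exists2 z, L z & ~ le z 1).

Variables (G L N0 : F -> Prop) (C : chain F) (c0 : C).
Hypotheses (sG : is_subgroup G) (sL : is_subgroup L) (sN : is_subgroup N0).
Hypothesis LG : forall l, L l -> G l.
Hypotheses (nL : normalised G L) (nN : normalised G N0).
Hypothesis fix0 : fixes N0 c0.
Hypothesis common : forall s : seq F,
  (forall x, x \in s -> L x /\ exists c : C, fixes N0 c /\ act x c = c) ->
  exists c : C, fixes N0 c /\ forall x, x \in s -> act x c = c.
Hypothesis nfL : ~ fixd L.

Let P (c : C) := fixes N0 c.

Lemma fixes_act g c : G g -> fixes N0 c -> fixes N0 (act g c : C).
Proof.
by move=> Gg Pc n Nn; rewrite -actM conjgC actM (Pc (n ^ g)) //; apply: nN.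
Qed.

Let GV g : G g -> G g^-1. Proof. by have [_ [_ h]] := sG; apply: h. Qed.
Let LV g : L g -> L g^-1. Proof. by have [_ [_ h]] := sL; apply: h. Qed.
Let LM g h : L g -> L h -> L (g * h). Proof. by have [_ [H _]] := sL; apply: H. Qed.

(** Otherwise the orbit of [c] has a supremum fixed by [N0] and by [l]. The set [Q] contains all
    points of Fix(N0) below the orbit, which makes it stable under [l^-1] too. *)
Lemma free_unbounded l (c u : C) : G l -> (forall d : C, fixes N0 d -> act l d <> d) ->
  fixes N0 c -> clt c (act l c) -> exists n, clt u (act (l ^+ n) c).
Proof.
move=> Gl free Pc cl; apply: NNPP => h.
have b n : cle (act (l ^+ n) c) u by apply: NNPP => hn; apply: h; exists n.
pose Q d := P d /\ exists n, cle d (act (l ^+ n) c).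
have [||s sQ] := @cle_lub _ C Q.
- by exists c; split=> //; exists 0%N; rewrite expg0 act1; apply: cle_refl.
- by exists u => d [_ [n dn]]; apply: cle_trans dn (b n).
have Ps : P s by apply: (supc_fixes sN sQ) => d [].
apply: (free s Ps); apply: (supc_fix sQ) => d [Pd [n dn]].
  split; first exact: fixes_act.
  by exists n.+1; rewrite expgS actM; apply: act_mono.
split; first by apply: fixes_act => //; apply: GV.
exists n; apply: cle_trans (act_mono l^-1 dn) _.
rewrite -(act_cle l) actVK -actM -expgS expgSr actM; apply/act_mono/cltW => //.
Qed.

Let L0 l := L l /\ exists c, P c /\ act l c = c.
Let pos l := forall c, P c -> clt c (act l c).

(** An intermediate value argument without continuity: if [l] moves [d] up and some [c >= d] down,
    the orbit of [d] is trapped below [c], against [free_unbounded]; if [c <= d], the same holds for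
    [l^-1]. *)
Let sign l : L l -> ~ L0 l -> pos l \/ pos l^-1.
Proof.
move=> Ll nl.
have fr (d : C) : fixes N0 d -> act l d <> d by move=> Pd E; apply: nl; split=> //; exists d.
have frV (d : C) : fixes N0 d -> act l^-1 d <> d.
  by move=> Pd E; apply: (fr d Pd); have := act_fixV E; rewrite invgK.
case: (classic (pos l)) => [|np]; first by left.
case: (classic (pos l^-1)) => [|npV]; first by right.
have [c hc] := not_all_ex_not _ _ np; have [Pc lc] := imply_to_and _ _ hc.
have [d hd] := not_all_ex_not _ _ npV; have [Pd ld] := imply_to_and _ _ hd.
have {}lc : cle (act l c) c by apply: NNPP.
have {}ld : cle (act l^-1 d) d by apply: NNPP.
have down (x : F) (e : C) n : cle (act x e) e -> cle (act (x ^+ n) e) e.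
  move=> xe; elim: n => [|n IH]; first by rewrite expg0 act1; apply: cle_refl.
  by rewrite expgS actM; apply: cle_trans (act_mono x IH) xe.
case: (cle_total d c) => dc.
  have [|n] := free_unbounded c (LG Ll) fr Pd.
    by rewrite -(act_clt l^-1) actK; apply: cle_clt ld (frV _ Pd).
  by case; apply: cle_trans (act_mono _ dc) (down _ _ n lc).
have [|n] := free_unbounded d (LG (LV Ll)) frV Pc.
  by rewrite -(act_clt l) actVK; apply: cle_clt lc (fr _ Pc).
by case; apply: cle_trans (act_mono _ dc) (down _ _ n ld).
Qed.

(** Otherwise every element of [L] has a fixed point, by [common] so has every finite subset, and
    compactness contradicts [nfL]. *)
Let pos_free : exists2 z, L z & pos z.
Proof.
apply: NNPP => nz; apply: nfL.
suff: fixd (fun x => N0 x \/ L x) by apply: fixdS => x; right.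
apply: (fixd_compact fgF) => s sL'.
have [|c [Pc sc]] := @common s.
  move=> x xs; have Lx := sL' x xs; split=> //; apply: NNPP => nx.
  have nL0 : ~ L0 x by case=> _ /nx.
  by case: (sign Lx nL0) => p; apply: nz; [exists x|exists x^-1 => //; apply: LV].
by apply: (@fixes_fixd _ C _ c) => x [/Pc|/sc].
Qed.

(** By [common], [z^-1 * s] has no fixed point, because a common one with [s] would be fixed by [z].
    So it moves all points the same way, and at a fixed point of [s] this is down. *)
Let L0_bound z s c : L z -> pos z -> L0 s -> P c -> clt (act s c) (act z c).
Proof.
move=> Lz pz [Ls [d [Pd sd]]] Pc.
have Lzs : L (z^-1 * s) by apply: LM => //; apply: LV.
have nL0 : ~ L0 (z^-1 * s).
  move=> [_ fx]; have [|e [Pe he]] := @common [:: s; z^-1 * s].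
    move=> x; rewrite !inE => /orP[]/eqP->; split=> //; by exists d.
  have E1 : act s e = e by apply: he; rewrite !inE eqxx.
  have E2 : act (z^-1 * s) e = e by apply: he; rewrite !inE eqxx orbT.
  have := pz e Pe; rewrite -{2}E2 actM actVK E1; apply; exact: cle_refl.
case: (sign Lzs nL0) => p.
  have := p d Pd; rewrite actM sd => h; have := pz _ Pd.
  by rewrite -(act_clt z) actVK in h; case; apply: cltW.
by have := p c Pc; rewrite invgM invgK actM -(act_clt s) actVK.
Qed.

(* The elements of [L] with a fixed point move every point less than [z] does, so their orbits are
   bounded and have suprema, which they all fix; the order is read off at such a point. *)
Lemma archimedean_order : exists le, archimedean G L le.
Proof.
have [z Lz pz] := pos_free.
have L0M x y : L0 x -> L0 y -> L0 (x * y).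
  move=> [Lx ex] [Ly ey]; have [|c [Pc hc]] := @common [:: x; y].
    by move=> w; rewrite !inE => /orP[]/eqP->.
  split; first exact: LM.
  by exists c; split=> //; rewrite actM !hc ?inE ?eqxx ?orbT.
have L0V x : L0 x -> L0 x^-1.
  move=> [Lx [c [Pc xc]]]; split; first exact: LV.
  by exists c; split=> //; apply: act_fixV.
have L01 : L0 1 by split; [case: sL|exists c0; rewrite act1].
have [||s sP] := @cle_lub _ C (fun d => exists2 h, L0 h & d = act h c0).
- by exists c0, 1; rewrite ?act1.
- by exists (act z c0) => _ [h Lh ->]; apply/cltW/L0_bound.
have Ps : P s.
  apply: (supc_fixes sN sP) => _ [h [Lh _] ->]; apply: fixes_act fix0; exact: LG.
have L0s h : L0 h -> act h s = s.
  move=> Lh; apply: (supc_fix sP) => _ [k Lk ->]; rewrite -actM.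
    by exists (h * k) => //; apply: L0M.
  by exists (h^-1 * k) => //; apply: L0M => //; apply: L0V.
exists (fun x y => cle (act x s) (act y s)); split; first exact: lpre_act.
split; first by have [x nx] := nofix s; exists x; rewrite ker_act.
split.
  move=> l g Ll Gg; rewrite !act1 => sl.
  case: (classic (L0 l)) => [L0l|nl].
    rewrite L0s; first exact: cle_refl.
    have [_ [c [Pc lc]]] := L0l; split; first exact: nL.
    exists (act g^-1 c); split; first by apply: fixes_act => //; apply: GV.
    by rewrite conjgE !actM actVK lc.
  case: (sign Ll nl) => p; last by have := p s Ps; rewrite -(act_clt l) actVK.
  apply: cltW; rewrite conjgE !actM -(act_clt g) actVK; apply: p.
  exact: fixes_act.
split; last by exists z => //; rewrite act1; apply: pz.
move=> l Ll; rewrite act1 => sl x.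
have fr (d : C) : fixes N0 d -> act l d <> d.
  move=> Pd ld; apply: sl; rewrite L0s; first exact: cle_refl.
  by split=> //; exists d.
have [n hn] := free_unbounded (act x s) (LG Ll) fr Ps sl.
(* For the lower bound on [x], start from a point of the orbit of [s] below [act x s] and push it
   above [s] by a power of [l]. *)
have [h [Lh hs]] := orbit_unboundedV s (act x s) sL nfL.
have Phs : P (act h s) by apply: fixes_act => //; apply: LG.
have lhs : clt (act h s) (act l (act h s)).
  have nl : ~ L0 l by move=> [_ [d [/fr]]].
  case: (sign Ll nl) => p; first exact: p.
  by have := p s Ps; rewrite -(act_clt l) actVK => /cltW /sl.
have [m hm] := free_unbounded s (LG Ll) fr Phs lhs.
have up k (c : C) : P c -> clt c (act l c) -> forall j, cle (act (l ^+ k) c) (act (l ^+ (j + k)) c).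
  move=> _ cl; elim=> [|j IH]; first exact: cle_refl.
  rewrite addSn expgSr actM; apply: cle_trans IH _; apply/act_mono/cltW => //.
exists (m + n)%N; split.
  by apply: cle_trans (cltW hn) _; apply: up.
rewrite -(act_cle (l ^+ (m + n))) actVK.
apply: cle_trans (cltW hm) _; rewrite addnC; apply: cle_trans (up m _ Phs lhs n) _.
exact/act_mono/cltW.
Qed.

End Archimedean.

Section IntegerPowers.

Variable F : groupType.
Implicit Types (x y g : F) (m n : Z).

Definition zexp x m : F :=
  match m with
  | Z0 => 1
  | Zpos p => x ^+ Pos.to_nat p
  | Zneg p => x ^- Pos.to_nat p
  end.

Lemma zexp_nat x (n : nat) : zexp x (Z.of_nat n) = x ^+ n.
Proof. by case: n => //= n; rewrite SuccNat2Pos.id_succ. Qed.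

Lemma zexp_opp x m : zexp x (- m) = (zexp x m)^-1.
Proof. by case: m => [|p|p] /=; rewrite ?invg1 ?invgK. Qed.

Lemma Z_nat_cases m : exists n : nat, m = Z.of_nat n \/ m = (- Z.of_nat n)%Z.
Proof. by exists (Z.abs_nat m); lia. Qed.

Lemma zexp_succ x m : zexp x (Z.succ m) = zexp x m * x.
Proof.
have [[|n] [->|->]] := Z_nat_cases m.
- by rewrite /= mul1g.
- by rewrite /= mul1g.
- by rewrite -Nat2Z.inj_succ !zexp_nat expgSr.
have -> : Z.succ (- Z.of_nat n.+1) = (- Z.of_nat n)%Z by lia.
by rewrite !zexp_opp !zexp_nat expgS invgM mulgVK.
Qed.

Lemma zexp_pred x m : zexp x (Z.pred m) = zexp x m * x^-1.
Proof. by rewrite -{2}[m]Z.succ_pred zexp_succ mulgK. Qed.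

Lemma zexpD x m n : zexp x (m + n) = zexp x m * zexp x n.
Proof.
elim/Z.peano_ind: n => [|n IH|n IH].
- by rewrite Z.add_0_r mulg1.
- by rewrite Z.add_succ_r !zexp_succ IH mulgA.
- by rewrite Z.add_pred_r !zexp_pred IH mulgA.
Qed.

Lemma zexpJ x g m : zexp (x ^ g) m = zexp x m ^ g.
Proof. by case: m => [|p|p] /=; rewrite ?conj1g ?conjVg ?conjXg. Qed.

Lemma zexpM x m (n : nat) : zexp x (m * Z.of_nat n) = zexp x m ^+ n.
Proof.
elim: n => [|n IH]; first by rewrite Z.mul_0_r expg0.
by rewrite Nat2Z.inj_succ Z.mul_succ_r zexpD IH expgSr.
Qed.

Lemma subgroupZ (L : F -> Prop) x m : is_subgroup L -> L x -> L (zexp x m).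
Proof.
move=> sL Lx; have [L1 [_ LV]] := sL.
by case: m => [|p|p] //=; [|apply: LV]; apply: subgroupX.
Qed.

End IntegerPowers.

Lemma Z_switch (Q : Z -> Prop) a b : (a <= b)%Z -> Q a -> ~ Q b ->
  exists m, Q m /\ ~ Q (m + 1)%Z.
Proof.
move=> ab Qa nQb; apply: NNPP => h; apply: nQb.
have all n : Q (a + Z.of_nat n)%Z.
  elim: n => [|n IH]; first by rewrite Z.add_0_r.
  apply: NNPP => nQ; apply: h; exists (a + Z.of_nat n)%Z; split=> // Qn; apply: nQ.
  by have -> : (a + Z.of_nat n.+1 = a + Z.of_nat n + 1)%Z by lia.
by have := all (Z.to_nat (b - a)); have -> : (a + Z.of_nat (Z.to_nat (b - a)) = b)%Z by lia.
Qed.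

Section ArchimedeanReals.

Local Open Scope R_scope.

Lemma INR_archimed_le (x K : R) : (forall n : nat, (0 < n)%N -> INR n * x <= K) -> x <= 0.
Proof.
move=> H; apply: Rnot_lt_le => x0.
have [n hn] := INR_unbounded (Rmax K 0 / x).
have n0 : (0 < n)%N.
  case: n hn => //= hn; exfalso; move: hn; apply/Rle_not_lt.
  by apply: Rmult_le_pos; [apply: Rmax_r|apply/Rlt_le/Rinv_0_lt_compat].
have := H n n0; apply: Rlt_not_le; apply: (Rle_lt_trans _ (Rmax K 0)); first exact: Rmax_l.
have -> : Rmax K 0 = Rmax K 0 / x * x by field; lra.
exact: Rmult_lt_compat_r.
Qed.

Lemma INR_archimed_eq (x y K : R) :
  (forall n : nat, (0 < n)%N -> Rabs (INR n * x - INR n * y) <= K) -> x = y.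
Proof.
move=> H; apply: Rle_antisym; apply: Rminus_le; apply: (@INR_archimed_le _ K) => n n0.
  by rewrite Rmult_minus_distr_l; apply: Rle_trans (Rle_abs _) (H n n0).
by rewrite Rmult_minus_distr_l; apply: Rle_trans (Rle_abs _) _; rewrite Rabs_minus_sym; apply: H.
Qed.

Lemma INR_gt0 n : (0 < n)%N -> 0 < INR n.
Proof. by move=> /ltP/lt_0_INR. Qed.

End ArchimedeanReals.

Section RealCharacters.

Variables (F : groupType) (L : F -> Prop) (tau : F -> R).
Hypothesis sL : is_subgroup L.
Hypothesis tauM : forall a b, L a -> L b -> tau (a * b) = (tau a + tau b)%R.

Lemma real_char1 : tau 1 = 0%R.
Proof. by have := tauM (proj1 sL) (proj1 sL); rewrite mulg1; lra. Qed.

Lemma real_charV a : L a -> tau a^-1 = (- tau a)%R.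
Proof.
move=> La; have [_ [_ LV]] := sL.
by have := tauM La (LV a La); rewrite mulgV real_char1; lra.
Qed.

Lemma real_charZ a m : L a -> tau (zexp a m) = (IZR m * tau a)%R.
Proof.
move=> La; have [_ [_ LV]] := sL.
elim/Z.peano_ind: m => [|m IH|m IH]; first by rewrite /= real_char1; lra.
  rewrite zexp_succ tauM ?IH ?succ_IZR; [|exact: subgroupZ|by []].
  by ring.
rewrite zexp_pred tauM ?IH ?real_charV -?Z.sub_1_r ?minus_IZR; [|by []|exact: subgroupZ|exact: LV].
by ring.
Qed.

End RealCharacters.

Section Slopes.

Variables (F : groupType) (G L : F -> Prop) (le : F -> F -> Prop).
Hypotheses (sG : is_subgroup G) (sL : is_subgroup L).
Hypotheses (LG : forall l, L l -> G l) (nL : normalised G L).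
Hypothesis ple : lpre le.
Hypothesis leJ : forall l g, L l -> G g -> le 1 l -> le 1 (l ^ g).
Hypothesis arch : forall l, L l -> ~ le l 1 -> forall x, exists n, le x (l ^+ n) /\ le (l ^- n) x.

Let LV g : L g -> L g^-1. Proof. by have [_ [_ h]] := sL; apply: h. Qed.
Let LM g h : L g -> L h -> L (g * h). Proof. by have [_ [H _]] := sL; apply: H. Qed.
Let LX g n : L g -> L (g ^+ n). Proof. exact: subgroupX. Qed.
Let LZ g n : L g -> L (zexp g n). Proof. exact: subgroupZ. Qed.

Let le_refl x : le x x. Proof. by case: (proj1 ple x x). Qed.
Let le_trans y x z : le x y -> le y z -> le x z. Proof. exact: (proj1 (proj2 ple)). Qed.
Let le_mul f x y : le x y -> le (f * x) (f * y). Proof. exact: (proj2 (proj2 ple)). Qed.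
Let le_total x y : le x y \/ le y x. Proof. exact: (proj1 ple). Qed.
Let le_mulI f x y : le (f * x) (f * y) -> le x y.
Proof. by move=> /(le_mul f^-1); rewrite !mulKg. Qed.

Let leWJ a b g : L a -> L b -> G g -> le a b -> le (a ^ g) (b ^ g).
Proof.
move=> La Lb Gg ab; apply: (@le_mulI (a ^ g)^-1).
rewrite mulVg -conjVg -conjMg; apply: leJ => //; first by apply: LM => //; apply: LV.
by apply: (@le_mulI a); rewrite mulg1 mulVKg.
Qed.

Let le_mulr a b l : L a -> L b -> L l -> le a b -> le (a * l) (b * l).
Proof.
move=> La Lb Ll ab; apply: (@le_mulI l^-1).
by rewrite -!conjgE; apply: leWJ => //; apply: LG.
Qed.

Let le_mul2 a b c d : L a -> L b -> L c -> L d -> le a b -> le c d -> le (a * c) (b * d).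
Proof.
by move=> La Lb Lc Ld ab cd; apply: (@le_trans (b * c)); [apply: le_mulr|apply: le_mul].
Qed.

Let le_pow a b n : L a -> L b -> le a b -> le (a ^+ n) (b ^+ n).
Proof.
move=> La Lb ab; elim: n => [|n IH]; first by rewrite !expg0.
by rewrite !expgS; apply: le_mul2 => //; apply: LX.
Qed.

(* Hoelder's trick: [(a b)^n] is squeezed between [a^n b^n] and [b^n a^n]. *)
Let pow_between x y w n : L x -> L y -> L w -> le (y * x) w -> le w (x * y) ->
  le (y ^+ n * x ^+ n) (w ^+ n) /\ le (w ^+ n) (x ^+ n * y ^+ n).
Proof.
move=> Lx Ly Lw yw wx.
have cm j : le (y ^+ j * x) (x * y ^+ j).
  elim: j => [|j IH]; first by rewrite !expg0 mulg1 mul1g.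
  rewrite expgS -mulgA; apply: (@le_trans (y * (x * y ^+ j))); first exact: le_mul.
  rewrite !mulgA; apply: le_mulr; [exact: LM|exact: LM|exact: LX|].
  exact: le_trans wx.
elim: n => [|n [IH1 IH2]]; first by rewrite !expg0 mulg1.
split.
  apply: (@le_trans (y * x * (y ^+ n * x ^+ n))).
    rewrite !expgS -!mulgA; apply: le_mul; rewrite !mulgA.
    by apply: le_mulr (cm n) => //; do ?[apply: LM => //|apply: LX].
  by rewrite expgS; apply: le_mul2 => //; do ?[apply: LM => //|apply: LX].
apply: (@le_trans (x ^+ n * y ^+ n * (x * y))).
  by rewrite expgSr; apply: le_mul2 => //; do ?[apply: LM => //|apply: LX].
rewrite !expgSr -!mulgA; apply: le_mul; rewrite !mulgA.
by apply: le_mulr (cm n) => //; do ?[apply: LM => //|apply: LX].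
Qed.

Variable z : F.
Hypotheses (Lz : L z) (z1 : ~ le z 1).

Let z_pos : le 1 z. Proof. by case: (le_total 1 z). Qed.

Let zexp_le m n : le (zexp z m) (zexp z n) <-> (m <= n)%Z.
Proof.
have up k : le 1 (z ^+ k).
  elim: k => [|k IH]; first by rewrite expg0.
  by rewrite expgS -[1]mul1g; apply: le_mul2 => //; [case: sL|case: sL|apply: LX].
split=> h.
  apply: NNPP => nm; apply: z1; have [k Ek] : exists k : nat, (m - n = Z.of_nat k.+1)%Z.
    by exists (Z.to_nat (m - n - 1)); lia.
  have {h} : le (zexp z (n + Z.of_nat k.+1)) (zexp z n).
    by have -> : (n + Z.of_nat k.+1 = m)%Z by lia.
  rewrite zexpD -{2}[zexp z n]mulg1 => /le_mulI; rewrite zexp_nat => h.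
  apply: le_trans h; rewrite expgS -{1}[z]mulg1; exact: le_mul.
have -> : n = (m + Z.of_nat (Z.to_nat (n - m)))%Z by lia.
by rewrite zexpD zexp_nat -{1}[zexp z m]mulg1; apply: le_mul.
Qed.

Let zfloor l : L l -> exists m, le (zexp z m) l /\ le l (zexp z (m + 1)).
Proof.
move=> Ll; have [n [n1 n2]] := arch Lz z1 l.
have [|||m [m1 m2]] := @Z_switch (fun m => le (zexp z m) l) (- Z.of_nat n) (Z.of_nat n + 1).
- lia.
- by rewrite zexp_opp zexp_nat.
- move=> h; have : le (zexp z (Z.of_nat n + 1)) (zexp z (Z.of_nat n)).
    by apply: le_trans h _; rewrite zexp_nat.
  by rewrite zexp_le; lia.
by exists m; split=> //; case: (le_total l (zexp z (m + 1))).
Qed.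

(** Hoelder's real number of [l] in units of [z], as the cut given by the fractions [m / n] with
    [z^m <= l^n]. *)
Definition slope (l : F) (r : R) : Prop := forall (m : Z) (n : nat), (0 < n)%N ->
  (le (zexp z m) (l ^+ n) -> (IZR m <= INR n * r)%R) /\
  (le (l ^+ n) (zexp z m) -> (INR n * r <= IZR m)%R).

Let slope_exists l : L l -> exists r, slope l r.
Proof.
move=> Ll; have [E [E1 E2]] := zfloor Ll.
pose S x := exists m n, (0 < n)%N /\ le (zexp z m) (l ^+ n) /\ x = (IZR m / INR n)%R.
have upS m n x : (0 < n)%N -> le (l ^+ n) (zexp z m) -> S x -> (x <= IZR m / INR n)%R.
  move=> n0 lm [m' [n' [n'0 [m'l ->]]]].
  have h : (m' * Z.of_nat n <= m * Z.of_nat n')%Z.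
    rewrite -zexp_le !zexpM; apply: (@le_trans (l ^+ (n * n'))).
      rewrite mulnC expgnA; apply: le_pow => //; [exact: LZ|exact: LX].
    rewrite expgnA; apply: le_pow => //; [exact: LX|exact: LZ].
  have i0 := INR_gt0 n0; have i0' := INR_gt0 n'0.
  apply: (Rmult_le_reg_r (INR n * INR n')); first exact: Rmult_lt_0_compat.
  have -> : (IZR m' / INR n' * (INR n * INR n') = IZR m' * INR n)%R by field; lra.
  have -> : (IZR m / INR n * (INR n * INR n') = IZR m * INR n')%R by field; lra.
  by rewrite !INR_IZR_INZ -!mult_IZR; apply: IZR_le.
have [||r [r1 r2]] := completeness S.
- exists (IZR (E + 1) / INR 1)%R => x; apply: upS => //.
- by exists (IZR E / INR 1)%R, E, 1%N.
exists r => m n n0; have i0 := INR_gt0 n0; split=> h.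
  have /r1 : S (IZR m / INR n)%R by exists m, n.
  move=> /(Rmult_le_compat_l (INR n) _ _ (Rlt_le _ _ i0)).
  by have -> : (INR n * (IZR m / INR n) = IZR m)%R by field; lra.
have : (r <= IZR m / INR n)%R by apply: r2 => x; apply: upS.
move=> /(Rmult_le_compat_l (INR n) _ _ (Rlt_le _ _ i0)).
by have -> : (INR n * (IZR m / INR n) = IZR m)%R by field; lra.
Qed.

Let slope_floor l r n : L l -> slope l r -> (0 < n)%N -> exists m,
  le (zexp z m) (l ^+ n) /\ le (l ^+ n) (zexp z (m + 1)) /\
  (IZR m <= INR n * r <= IZR m + 1)%R.
Proof.
move=> Ll sl n0; have [m [m1 m2]] := zfloor (LX n Ll).
exists m; do 3 split=> //; first by apply: (proj1 (sl m n n0)).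
by rewrite -plus_IZR; apply: (proj2 (sl (m + 1)%Z n n0)).
Qed.

Let slope_mul a b r s t : L a -> L b -> slope a r -> slope b s -> slope (a * b) t ->
  t = (r + s)%R.
Proof.
(* For each [n], both [n t] and [n (r + s)] lie between [ma + mb] and [ma + mb + 2]. *)
move=> La Lb sa sb sab; apply: (@INR_archimed_eq _ _ 2) => n n0.
have [ma [a1 [a2 ha]]] := slope_floor La sa n0.
have [mb [b1 [b2 hb]]] := slope_floor Lb sb n0.
have lo : le (zexp z (ma + mb)) ((a * b) ^+ n).
  have p1 : le (zexp z (ma + mb)) (a ^+ n * b ^+ n).
    by rewrite zexpD; apply: le_mul2 => //; do ?[apply: LX => //|apply: LZ].
  have p2 : le (zexp z (ma + mb)) (b ^+ n * a ^+ n).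
    by rewrite Z.add_comm zexpD; apply: le_mul2 => //; do ?[apply: LX => //|apply: LZ].
  case: (le_total (b * a) (a * b)) => h.
    apply: le_trans p2 _; apply: (proj1 (pow_between n La Lb (LM La Lb) h _)); exact: le_refl.
  apply: le_trans p1 _; apply: (proj1 (pow_between n Lb La (LM La Lb) _ h)); exact: le_refl.
have up : le ((a * b) ^+ n) (zexp z (ma + mb + 2)).
  have p1 : le (a ^+ n * b ^+ n) (zexp z (ma + mb + 2)).
    have -> : (ma + mb + 2 = (ma + 1) + (mb + 1))%Z by lia.
    by rewrite zexpD; apply: le_mul2 => //; do ?[apply: LX => //|apply: LZ].
  have p2 : le (b ^+ n * a ^+ n) (zexp z (ma + mb + 2)).
    have -> : (ma + mb + 2 = (mb + 1) + (ma + 1))%Z by lia.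
    by rewrite zexpD; apply: le_mul2 => //; do ?[apply: LX => //|apply: LZ].
  case: (le_total (b * a) (a * b)) => h.
    apply: le_trans p1; apply: (proj2 (pow_between n La Lb (LM La Lb) h _)); exact: le_refl.
  apply: le_trans p2; apply: (proj2 (pow_between n Lb La (LM La Lb) _ h)); exact: le_refl.
have := proj1 (sab _ _ n0) lo; have := proj2 (sab _ _ n0) up.
rewrite !plus_IZR Rmult_plus_distr_l => h1 h2.
by apply: Rabs_le; lra.
Qed.

(** Conjugation by [g] induces an order automorphism of a group of reals, hence multiplication by a
    positive scalar; it is read off at the unit [z]. *)
Lemma hoelder : exists (tau : F -> R) (mu : F -> R),
  (forall a b, L a -> L b -> tau (a * b) = (tau a + tau b)%R) /\
  (forall a b, L a -> L b -> le a b -> (tau a <= tau b)%R) /\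
  (forall a, L a -> ~ le a 1 -> (0 < tau a)%R) /\
  tau z = 1%R /\
  (forall g, G g -> (0 < mu g)%R) /\
  (forall g l, G g -> L l -> tau (l ^ g) = (mu g * tau l)%R).
Proof.
have H l : exists r, L l -> slope l r.
  case: (classic (L l)) => [/slope_exists [r sr]|nl]; first by exists r.
  by exists 0%R.
have [tau stau] := boolp.choice H.
have tauM a b : L a -> L b -> tau (a * b) = (tau a + tau b)%R.
  by move=> La Lb; apply: (@slope_mul a b) => //; apply: stau => //; apply: LM.
have tauZ a m : L a -> tau (zexp a m) = (IZR m * tau a)%R by apply: (real_charZ sL tauM).
have tauX a n : L a -> tau (a ^+ n) = (INR n * tau a)%R.
  by move=> La; rewrite -zexp_nat tauZ // INR_IZR_INZ.
have tau_mono a b : L a -> L b -> le a b -> (tau a <= tau b)%R.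
  move=> La Lb ab; apply: Rminus_le; apply: (@INR_archimed_le _ 1) => n n0.
  have [m [m1 [m2 [m3 m4]]]] := slope_floor La (stau a La) n0.
  have := proj1 (stau b Lb m n n0) (le_trans m1 (le_pow n La Lb ab)).
  by rewrite Rmult_minus_distr_l; lra.
have tau_pos a : L a -> ~ le a 1 -> (0 < tau a)%R.
  move=> La a1; have [n [n1 _]] := arch La a1 z.
  have n0 : (0 < n)%N.
    by case: n n1 => // n1; case: z1; rewrite -(expg0 a).
  have := proj1 (stau a La 1%Z n n0); rewrite [zexp z 1]expg1 => /(_ n1) h.
  apply: Rnot_le_lt => ta; have := INR_gt0 n0 => i0.
  by have := Rmult_le_compat_l _ _ _ (Rlt_le _ _ i0) ta; lra.
have tauz : tau z = 1%R.
  have [h _] := stau z Lz 1%Z 1%N isT; have [_ h'] := stau z Lz 1%Z 1%N isT.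
  rewrite /= !expg1 in h h'; have := h (le_refl _); have := h' (le_refl _); lra.
have muP g : G g -> (0 < tau (z ^ g)%g)%R.
  move=> Gg; apply: tau_pos; first exact: nL.
  move=> h; apply: z1; have [G1 [_ GV]] := sG.
  have := leWJ (nL Lz Gg) (proj1 sL) (GV _ Gg) h.
  by rewrite conj1g conjgK.
exists tau, (fun g => tau (z ^ g)); do 5 split=> //.
(* [l^n] lies between consecutive powers of [z], so its conjugate lies between those of [z ^ g]: the
   error is at most one new unit, uniformly in [n]. *)
move=> g l Gg Ll; apply: (@INR_archimed_eq _ _ (tau (z ^ g))) => n n0.
have [m [m1 [m2 m3]]] := slope_floor Ll (stau l Ll) n0.
have Lzg := nL Lz Gg; have Llg := nL Ll Gg.
have := leWJ (LZ _ Lz) (LX _ Ll) Gg m1; have := leWJ (LX _ Ll) (LZ _ Lz) Gg m2.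
rewrite -!zexpJ conjXg => /(tau_mono _ _ (LX _ Llg) (LZ _ Lzg)) h1.
move=> /(tau_mono _ _ (LZ _ Lzg) (LX _ Llg)); move: h1.
rewrite !tauZ // tauX // plus_IZR => h1 h2; have p := muP g Gg.
have h3 := Rmult_le_compat_r _ _ _ (Rlt_le _ _ p) (proj1 m3).
have h4 := Rmult_le_compat_r _ _ _ (Rlt_le _ _ p) (proj2 m3).
by apply: Rabs_le; lra.
Qed.

End Slopes.

(** * The dichotomy: affine action or central translation *)

Section Affine.

Variable F : groupType.
Hypothesis fgF : finitely_generated F.
Variables (G L : F -> Prop) (le : F -> F -> Prop).
Hypotheses (sG : is_subgroup G) (sL : is_subgroup L).
Hypothesis nL : normalised G L.
Hypothesis ple : lpre le.
Variables (tau mu : F -> R) (z : F).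
Hypothesis Lz : L z.
Hypothesis arch_z : forall x, exists n, le x (z ^+ n) /\ le (z ^- n) x.
Hypothesis tauM : forall a b, L a -> L b -> tau (a * b) = (tau a + tau b)%R.
Hypothesis tau_mono : forall a b, L a -> L b -> le a b -> (tau a <= tau b)%R.
Hypothesis tauz : tau z = 1%R.
Hypothesis mu_gt0 : forall g, G g -> (0 < mu g)%R.
Hypothesis tauJ : forall g l, G g -> L l -> tau (l ^ g) = (mu g * tau l)%R.
Hypothesis dense : forall e, (0 < e)%R -> exists2 l, L l & (0 < tau l < e)%R.

Let LV g : L g -> L g^-1. Proof. by have [_ [_ h]] := sL; apply: h. Qed.
Let LM g h : L g -> L h -> L (g * h). Proof. by have [_ [H _]] := sL; apply: H. Qed.
Let GV g : G g -> G g^-1. Proof. by have [_ [_ h]] := sG; apply: h. Qed.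
Let GM g h : G g -> G h -> G (g * h). Proof. by have [_ [H _]] := sG; apply: H. Qed.
Let le_refl x : le x x. Proof. by case: (proj1 ple x x). Qed.
Let le_trans y x w : le x y -> le y w -> le x w. Proof. exact: (proj1 (proj2 ple)). Qed.
Let le_mul f x y : le x y -> le (f * x) (f * y). Proof. exact: (proj2 (proj2 ple)). Qed.
Let le_total x y : le x y \/ le y x. Proof. exact: (proj1 ple). Qed.

Let tauV a : L a -> tau a^-1 = (- tau a)%R. Proof. exact: real_charV. Qed.
Let tauZ a m : L a -> tau (zexp a m) = (IZR m * tau a)%R. Proof. exact: real_charZ. Qed.

Let between a b : (a < b)%R -> exists2 l, L l & (a < tau l < b)%R.
Proof.
move=> ab; have [t Lt [t0 tb]] := dense (proj2 (Rlt_0_minus _ _) ab).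
exists (zexp t (up (a / tau t))); first exact: subgroupZ.
rewrite tauZ //; have [u1 u2] := archimed (a / tau t).
have E : (a / tau t * tau t = a)%R by field; lra.
have := Rmult_lt_compat_r _ _ _ t0 u1; rewrite E => h1.
have := Rmult_le_compat_r _ _ _ (Rlt_le _ _ t0) u2.
by rewrite Rmult_minus_distr_r E; lra.
Qed.

(** The real coordinate of an arbitrary element of [F], as the cut it makes in [L]; density of [tau]
    on [L] makes it unique. *)
Definition position (x : F) (r : R) : Prop :=
  (forall l, L l -> le l x -> (tau l <= r)%R) /\
  (forall l, L l -> le x l -> (r <= tau l)%R).

Let position_mono x y r s : position x r -> position y s -> le x y -> (r <= s)%R.
Proof.
move=> [x1 x2] [y1 y2] xy; apply: Rnot_lt_le => /between [l Ll lb].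
case: (le_total l x) => h; last by have := x2 l Ll h; lra.
by have := y1 l Ll (le_trans h xy); lra.
Qed.

Let position_uniq x r s : position x r -> position x s -> r = s.
Proof. by move=> xr xs; apply: Rle_antisym; apply: (@position_mono x x). Qed.

Let position_exists x : exists r, position x r.
Proof.
have [n [n1 n2]] := arch_z x; have Ln : L (z ^+ n) by apply: subgroupX.
have [||r [r1 r2]] := completeness (fun r => exists l, L l /\ le l x /\ r = tau l).
- by exists (tau (z ^+ n)) => _ [l [Ll [lx ->]]]; apply: tau_mono (le_trans lx n1).
- by exists (tau (z ^- n)), (z ^- n); split=> //; apply: LV.
exists r; split=> l Ll lx; first by apply: r1; exists l.
by apply: r2 => _ [k [Lk [kx ->]]]; apply: tau_mono (le_trans kx lx).
Qed.

(* Up to semiconjugacy [G] acts on the line by affine maps. The stabilisers of the points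
   [0, 1, 2, ...] need not be normal, but their ultraproduct contains only the maps acting as the
   identity, because any other affine map fixes at most one point. *)
Lemma affine_concl : concl G.
Proof.
have [phi phiP] := boolp.choice position_exists.
have phi_le x y : le x y -> (phi x <= phi y)%R.
  exact: position_mono.
have phiL l : L l -> phi l = tau l.
  move=> Ll; apply: (position_uniq (phiP l)).
  by split=> k Lk; [apply: tau_mono Lk Ll|apply: tau_mono Ll Lk].
have phi1 : phi 1 = 0%R by rewrite phiL ?(real_char1 sL tauM) //; case: sL.
have phi_mulL l x : L l -> phi (l * x) = (tau l + phi x)%R.
  move=> Ll; apply: (position_uniq (phiP _)); have [x1 x2] := phiP x.
  split=> k Lk /(le_mul l^-1); rewrite mulKg => h.
    by have := x1 _ (LM (LV Ll) Lk) h; rewrite tauM ?tauV //; [lra|apply: LV].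
  by have := x2 _ (LM (LV Ll) Lk) h; rewrite tauM ?tauV //; [lra|apply: LV].
(* The slope of left multiplication by [g], because [g * l = l ^ g^-1 * g]. *)
pose nu g := mu g^-1.
have nu_gt0 g : G g -> (0 < nu g)%R by move=> Gg; apply: mu_gt0; apply: GV.
have muE g : G g -> mu g = tau (z ^ g) by move=> Gg; rewrite tauJ // tauz Rmult_1_r.
have nuM g h : G g -> G h -> nu (g * h) = (nu g * nu h)%R.
  move=> Gg Gh; rewrite /nu invgM muE; last by apply: GM; apply: GV.
  have Gh' := GV Gh; have Gg' := GV Gg.
  by rewrite conjgM tauJ //; [rewrite -muE|apply: nL].
have nu1 : nu 1 = 1%R.
  by rewrite /nu invg1 muE ?conjg1 //; case: sG.
have nuV g : G g -> (nu g^-1 * nu g)%R = 1%R.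
  by move=> Gg; rewrite -nuM ?mulVg ?nu1 //; apply: GV.
(* For [x] in [L] this is the behaviour of [tau] under conjugation; any other [x] is squeezed
   between elements of [L] by density. *)
have phi_mul g x : G g -> phi (g * x) = (nu g * phi x + phi g)%R.
  move=> Gg; have n0 := nu_gt0 g Gg.
  have phigl l : L l -> phi (g * l) = (nu g * tau l + phi g)%R.
    move=> Ll; rewrite -[g * l](mulgVK g) -/(g * l / g) -{1}[g]invgK.
    have -> : g^-1^-1 * l / g = l ^ g^-1 by rewrite conjgE mulgA.
    by rewrite phi_mulL ?tauJ //; [apply: GV|apply: nL => //; apply: GV].
  have [x1 x2] := phiP x; have E y : ((y - phi g) / nu g * nu g = y - phi g)%R by field; lra.
  apply: Rle_antisym; apply: Rnot_lt_le => h.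
    have [|l Ll [l1 l2]] := @between (phi x) ((phi (g * x) - phi g) / nu g).
      by apply: (Rmult_lt_reg_r (nu g)) => //; rewrite E; lra.
    have xl : le x l by case: (le_total l x) => // lx; have := x1 l Ll lx; lra.
    have := phi_le _ _ (le_mul g xl); rewrite (phigl l Ll).
    by have := Rmult_lt_compat_r _ _ _ n0 l2; rewrite E; lra.
  have [|l Ll [l1 l2]] := @between ((phi (g * x) - phi g) / nu g) (phi x).
    by apply: (Rmult_lt_reg_r (nu g)) => //; rewrite E; lra.
  have lx : le l x by case: (le_total l x) => // xl; have := x2 l Ll xl; lra.
  have := phi_le _ _ (le_mul g lx); rewrite (phigl l Ll).
  by have := Rmult_lt_compat_r _ _ _ n0 l1; rewrite E; lra.
have phiV g : G g -> phi g^-1 = (- (nu g^-1 * phi g))%R.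
  move=> Gg; have := phi_mul g^-1 g (GV Gg); rewrite mulVg phi1; lra.
(* [len n] compares the translates by [x] and [y] of the initial segment of [F] where [phi < n]. An
   element of [G] in its kernel fixes the point [n] of the line. *)
pose len n (x y : F) := forall u, (phi (x^-1 * u)%g < INR n)%R -> (phi (y^-1 * u)%g < INR n)%R.
have plen n : lpre (len n).
  split.
    move=> x y; case: (classic (len n x y)) => [|nxy]; first by left.
    have [u hu] := not_all_ex_not _ _ nxy; have [h1 h2] := imply_to_and _ _ hu.
    right=> v hv; case: (le_total v u) => vu.
      exact: Rle_lt_trans (phi_le _ _ (le_mul x^-1 vu)) h1.
    by case: h2; apply: Rle_lt_trans (phi_le _ _ (le_mul y^-1 vu)) hv.
  split; first by move=> x y w xy yw u /xy /yw.
  by move=> f x y xy u; rewrite !invgM -!mulgA; apply: xy.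
have ntlen n : exists x, ~ ker (len n) x.
  exists z => -[h _]; have [|l Ll [l1 l2]] := @between (INR n) (INR n + 1); first lra.
  have := h l; rewrite invg1 mul1g phi_mulL ?phiL ?tauV ?tauz //; [lra|exact: LV].
have kerlen n g : G g -> ker (len n) g ->
    (nu g^-1 * INR n + phi g^-1)%R = INR n.
  move=> Gg [k1 k2]; have n0 := nu_gt0 _ (GV Gg).
  have E y : ((y - phi g^-1) / nu g^-1 * nu g^-1 = y - phi g^-1)%R by field; lra.
  have ph l : L l -> phi (g^-1 * l) = (nu g^-1 * tau l + phi g^-1)%R.
    by move=> Ll; rewrite (phi_mul _ _ (GV Gg)) (phiL l Ll).
  apply: Rle_antisym; apply: Rnot_lt_le => h.
    have [|l Ll [l1 l2]] := @between ((INR n - phi g^-1) / nu g^-1) (INR n).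
      by apply: (Rmult_lt_reg_r (nu g^-1)) => //; rewrite E; lra.
    have := k2 l; rewrite invg1 mul1g (ph l Ll) (phiL l Ll) => /(_ l2).
    by have := Rmult_lt_compat_r _ _ _ n0 l1; rewrite E; lra.
  have [|l Ll [l1 l2]] := @between (INR n) ((INR n - phi g^-1) / nu g^-1).
    by apply: (Rmult_lt_reg_r (nu g^-1)) => //; rewrite E; lra.
  have := Rmult_lt_compat_r _ _ _ n0 l2; rewrite E => h'.
  have := k1 l; rewrite invg1 mul1g (ph l Ll) (phiL l Ll) => k3.
  by have := k3 ltac:(lra); lra.
have [||U [uU UD]] := @ultra_exists nat nat (fun k n => (k <= n)%N) 0%N.
- by move=> k; exists k.
- by move=> k k'; exists (maxn k k') => i; rewrite geq_max => /andP.
pose lei x y := U (fun n => len n x y).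
have kerG g : G g -> ker lei g <-> nu g = 1%R /\ phi g = 0%R.
  move=> Gg; have [Uand [Umono _]] := uU.
  rewrite /lei ker_lim //; split=> [kU|[n1 p0]].
    have [n hn] := ultra_inhabited uU kU.
    have [m [hm nm]] := ultra_inhabited uU (Uand _ _ kU (UD n.+1)).
    have e1 := kerlen n g Gg hn; have e2 := kerlen m g Gg hm.
    have mn : (INR n < INR m)%R by apply: lt_INR; apply/ltP.
    have a1 : nu g^-1 = 1%R.
      apply: (Rmult_eq_reg_r (INR m - INR n)); last lra.
      by rewrite Rmult_minus_distr_l; lra.
    have := nuV g Gg; rewrite a1 Rmult_1_l => n1; split=> //.
    by have := phiV g Gg; rewrite a1; move: e1; rewrite a1; lra.
  apply: Umono (UD 0%N) => n _.
  have n1V : nu g^-1 = 1%R by have := nuV g Gg; rewrite n1; lra.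
  have E u : phi (g^-1 * u) = phi u.
    by rewrite phi_mul ?phiV ?n1V ?p0 //; [lra|apply: GV].
  by split=> u; rewrite invg1 mul1g E.
(* [A] consists of the elements acting as translations. An affine map commuting with a nonzero
   translation has slope 1, and [G] modulo [A] embeds by [nu] in the multiplicative group of
   positive reals. *)
exists lei, (fun g => G g /\ nu g = 1%R).
split; first exact: lim_lpre.
split; first exact: lim_nontrivial.
have nuJ g h : G g -> G h -> nu (g ^ h) = nu g.
  move=> Gg Gh; have Gh' := GV Gh.
  by rewrite conjgE !nuM //; [rewrite -Rmult_assoc Rmult_comm -Rmult_assoc [(nu h * _)%R]Rmult_comm nuV //; lra|apply: GM].
have nuR g h : G g -> G h -> nu [~ g, h] = 1%R.
  move=> Gg Gh; rewrite commgEl nuM ?nuJ ?nuV //; first exact: GV.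
  exact: subgroupJ.
split.
  move=> b g Gb Gg; rewrite !kerG //; last exact: subgroupJ.
  move=> [n1 p0]; rewrite nuJ //; split=> //; have Gg' := GV Gg.
  rewrite conjgE (phi_mul g^-1) // (phi_mul b) // p0 phiV // n1; ring.
split.
  split; first by split=> //; case: sG.
  split=> [x y [Gx x1] [Gy y1]|x [Gx x1]].
    by split; [apply: GM|rewrite nuM // x1 y1; lra].
  by split; [apply: GV|have := nuV x Gx; rewrite x1; lra].
split; first by move=> a [].
split.
  by move=> a g [Ga a1] Gg; split; [apply: subgroupJ|rewrite nuJ].
split; first by move=> g Gg /(kerG g Gg) [].
split.
  move=> a a' [Ga a1] [Ga' a1']; have GR := subgroupR sG Ga Ga'.
  rewrite kerG //; split; first exact: nuR.
  have := congr1 phi (commgC a a').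
  by rewrite (phi_mul a) // (phi_mul _ _ (GM Ga' Ga)) (phi_mul a') // nuM // a1 a1'; lra.
split.
  move=> a g [Ga a1] na Gg; have GR := subgroupR sG Gg Ga.
  rewrite kerG // => -[_ r0]; split=> //.
  have p0 : phi a <> 0%R by move=> p; apply: na; rewrite kerG.
  have := congr1 phi (commgC g a).
  rewrite (phi_mul g) // (phi_mul _ _ (GM Ga Gg)) (phi_mul a) // r0 a1 => h.
  apply: (Rmult_eq_reg_r (phi a)) => //; lra.
split.
  by move=> g h Gg Gh; split; [apply: subgroupR|apply: nuR].
move=> g [//|n] Gg _ [_ gn]; split=> //.
have n0 := nu_gt0 g Gg.
have nuX k : nu (g ^+ k) = (nu g ^ k)%R.
  elim: k => [|k IH]; first by rewrite expg0.
  by rewrite expgS nuM ?IH //; apply: subgroupX.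
move: gn; rewrite nuX => gn.
case: (Rtotal_order (nu g) 1) => [h|[//|h]].
  by have := pow_lt_1_compat (nu g) n.+1 (conj (Rlt_le _ _ n0) h) (Nat.lt_0_succ n); lra.
by have := Rlt_pow_R1 (nu g) n.+1 h (Nat.lt_0_succ n); lra.
Qed.

End Affine.

Section Cyclic.

Variable F : groupType.
Hypothesis fgF : finitely_generated F.
Variables (G L : F -> Prop) (le : F -> F -> Prop).
Hypotheses (sG : is_subgroup G) (sL : is_subgroup L).
Hypotheses (LG : forall l, L l -> G l) (nL : normalised G L).
Hypotheses (ple : lpre le) (nt : exists x, ~ ker le x) (nfL : ~ fixd L).
Variables (tau mu : F -> R) (z : F).
Hypothesis tauM : forall a b, L a -> L b -> tau (a * b) = (tau a + tau b)%R.
Hypothesis tau_mono : forall a b, L a -> L b -> le a b -> (tau a <= tau b)%R.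
Hypothesis tau_pos : forall a, L a -> ~ le a 1 -> (0 < tau a)%R.
Hypothesis mu_gt0 : forall g, G g -> (0 < mu g)%R.
Hypothesis tauJ : forall g l, G g -> L l -> tau (l ^ g) = (mu g * tau l)%R.
Hypotheses (Lz : L z) (tauz : (0 < tau z)%R).
Hypothesis zmin : forall l, L l -> (0 < tau l)%R -> (tau z <= tau l)%R.

Let LV g : L g -> L g^-1. Proof. by have [_ [_ h]] := sL; apply: h. Qed.
Let LM g h : L g -> L h -> L (g * h). Proof. by have [_ [H _]] := sL; apply: H. Qed.
Let GV g : G g -> G g^-1. Proof. by have [_ [_ h]] := sG; apply: h. Qed.
Let GM g h : G g -> G h -> G (g * h). Proof. by have [_ [H _]] := sG; apply: H. Qed.

Let tauV a : L a -> tau a^-1 = (- tau a)%R. Proof. exact: real_charV. Qed.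
Let tauZ a m : L a -> tau (zexp a m) = (IZR m * tau a)%R. Proof. exact: real_charZ. Qed.

Definition tau_kernel l := L l /\ tau l = 0%R.
Let N0 := tau_kernel.

(** [tau z] is the least positive value, so neither [g] nor [g^-1] can shrink it. *)
Let mu1 g : G g -> mu g = 1%R.
Proof.
have ge1 h : G h -> (1 <= mu h)%R.
  move=> Gh; have Lzh := nL Lz Gh; have p := mu_gt0 Gh.
  have := zmin Lzh; rewrite tauJ // => /(_ (Rmult_lt_0_compat _ _ p tauz)) h'.
  by apply: (Rmult_le_reg_r (tau z)) => //; lra.
move=> Gg; have h1 := ge1 _ Gg; have h2 := ge1 _ (GV Gg).
have : tau ((z ^ g) ^ g^-1) = tau z by rewrite conjgK.
rewrite (tauJ (GV Gg) (nL Lz Gg)) tauJ // => h.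
have h3 : (mu g^-1 * mu g = 1)%R by apply: (Rmult_eq_reg_r (tau z)); lra.
have := Rmult_le_compat_r (mu g) _ _ ltac:(lra) h2; lra.
Qed.

Let tauR g l : G g -> L l -> tau [~ g, l] = 0%R.
Proof.
move=> Gg Ll; have Ll' := LV Ll.
by rewrite commgEr tauM ?tauJ ?tauV ?mu1 //; [lra|apply: nL].
Qed.

Let tau_multiple l : L l -> exists m : Z, tau l = (IZR m * tau z)%R.
Proof.
move=> Ll; have [u1 u2] := archimed (tau l / tau z).
pose m := (up (tau l / tau z) - 1)%Z.
have E : (tau l / tau z * tau z = tau l)%R by field; lra.
have := Rmult_lt_compat_r _ _ _ tauz u1; rewrite E => h1.
have := Rmult_le_compat_r _ _ _ (Rlt_le _ _ tauz) u2.
rewrite Rmult_minus_distr_r E => h2.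
exists m; have Lm : L (l * zexp z (- m)) by apply: LM => //; apply: subgroupZ.
have tm : tau (l * zexp z (- m)) = (tau l - (IZR (up (tau l / tau z)) - 1) * tau z)%R.
  rewrite tauM ?tauZ //; last exact: subgroupZ.
  by rewrite opp_IZR minus_IZR; ring.
rewrite minus_IZR; case: (Rle_lt_dec (tau (l * zexp z (- m))) 0) => h; first by lra.
by have := zmin Lm h; lra.
Qed.

Let sN : is_subgroup N0.
Proof.
split; first by split; [case: sL|apply: (real_char1 sL)].
split=> [x y [Lx x0] [Ly y0]|x [Lx x0]]; first by split; [apply: LM|rewrite tauM // x0 y0; lra].
by split; [apply: LV|rewrite tauV // x0; lra].
Qed.

Let nN : normalised G N0.
Proof. by move=> l g [Ll l0] Gg; split; [apply: nL|rewrite tauJ // l0; lra]. Qed.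

Section Chain.

Variables (C : chain F) (c0 : C).
Hypothesis fix0 : fixes N0 c0.

(** If [w] fixes [d], so does a positive power of each [l] in [L], being a power of [w] modulo [N0];
    then [l] itself fixes [d], as stabilisers are closed under roots. This contradicts [nfL]. *)
Lemma translation_free w (d : C) : L w -> tau w <> 0%R -> fixes N0 d -> act w d <> d.
Proof.
move=> Lw w0 Nd wd; apply: nfL; apply: (@fixes_fixd _ _ _ d) => l Ll.
have [a ha] := tau_multiple Ll; have [b hb] := tau_multiple Lw.
have b0 : b <> 0%Z by move=> b0; apply: w0; rewrite hb b0; lra.
have [k [v [k0 [Lv [vd tv]]]]] : exists (k : nat) v, (0 < k)%N /\ L v /\
    act v d = d /\ tau v = (INR k * tau z)%R.
  have [n [bn|bn]] := Z_nat_cases b.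
    exists n, w; split; first by case: n bn => // bn; rewrite bn in b0.
    by do 2 split=> //; rewrite hb bn INR_IZR_INZ.
  exists n, w^-1; split; first by case: n bn => // bn; rewrite bn in b0.
  split; first exact: LV.
  split; first exact: act_fixV.
  by rewrite tauV // hb bn opp_IZR INR_IZR_INZ; ring.
have fixZ x m : act x d = d -> act (zexp x m) d = d.
  move=> xd; have [n [->|->]] := Z_nat_cases m; first by rewrite zexp_nat act_fixX.
  by rewrite zexp_opp zexp_nat; apply: act_fixV; rewrite act_fixX.
have Nlv : N0 (zexp v (- a) * l ^+ k).
  have Lk : L (l ^+ k) by apply: subgroupX.
  split; first by apply: LM => //; apply: subgroupZ.
  rewrite -zexp_nat tauM ?tauZ //; do ?[exact: subgroupZ].
  by rewrite tv ha opp_IZR INR_IZR_INZ; ring.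
have lk : act (l ^+ k) d = d.
  have := Nd _ Nlv; rewrite actM => /(congr1 (act (zexp v a))).
  by rewrite zexp_opp actVK fixZ.
by apply/ker_act/(ker_rootclosed (lpre_act d) k0)/ker_act.
Qed.

(* If [x y = y x w] with [w] central, then [x y^3 = y^3 x w^3], whereas a commutator moves points
   by less than [w^2]. *)
Lemma commutator_not_translation x y : G x -> G y -> L [~ x, y] -> clt c0 (act [~ x, y] c0) -> False.
Proof.
move=> Gx Gy; move Ew: [~ x, y] => w Lw up.
have w0 : tau w <> 0%R.
  by move=> t0; apply: (clt_neq up); rewrite (fix0 (n := w)).
pose P (c : C) := exists2 g, G g & c = act g c0.
have PN c : P c -> fixes N0 c.
  by move=> [g Gg ->]; apply: (fixes_act (G := G)).
have PG g c : G g -> P c -> P (act g c).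
  by move=> Gg [h Gh ->]; exists (g * h); [apply: GM|rewrite actM].
have wc g c : G g -> P c -> act w (act g c) = act g (act w c).
  move=> Gg Pc; have Nr : N0 [~ w, g] by rewrite -invgR; apply: (proj2 (proj2 sN)); split;
    [rewrite commgEr; apply: LM => //; apply: nL => //; apply: LV|apply: tauR].
  by rewrite -!actM commgC actM (PN c Pc _ Nr) actM.
have Pup c : P c -> clt c (act w c).
  move=> [g Gg ->]; rewrite wc //; first by apply/act_clt.
  by exists 1; rewrite ?act1 //; case: sG.
have fr (d : C) : fixes N0 d -> act w d <> d by apply: translation_free.
have iterE n (c : C) : iter n (act w) c = act (w ^+ n) c.
  by elim: n => [|n IH]; [rewrite expg0 act1|rewrite iterS IH expgS actM].
have cof c u : P c -> exists n, clt u (iter n (act w) c).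
  move=> Pc; have [n hn] := free_unbounded sG sN nN u (LG Lw) fr (PN _ Pc) (Pup _ Pc).
  by exists n; rewrite iterE.
have Gw := LG Lw.
have Gy3 : G (y ^+ 3) by apply: subgroupX.
have Pc0 : P c0 by exists 1; rewrite ?act1 //; case: sG.
have := @commutator_bound F C P (act w) (y ^+ 3) x (fun c => PG w c Gw) (fun c => PG _ c Gy3)
  (fun c => PG x c Gx) (fun c d => proj2 (act_clt w c d)) (fun c => wc _ c Gy3) (fun c => wc _ c Gx)
  (fun c Pc => cltW (Pup c Pc)) cof c0 Pc0.
have xy c : P c -> act x (act y c) = act w (act y (act x c)).
  by move=> Pc; rewrite -[LHS]actM commgC Ew !actM wc ?wc //; apply: PG.
have -> : act x (act (y ^+ 3) c0) = act w (act w (act w (act (y ^+ 3) (act x c0)))).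
  have P1 : P (act y c0) by apply: PG. have P2 := PG y _ Gy P1.
  have P3 : P (act x c0) by apply: PG. have P4 := PG y _ Gy P3. have P5 := PG y _ Gy P4.
  have yw d : P d -> act y (act w d) = act w (act y d) by move=> Pd; rewrite wc.
  rewrite !expgS expg0 mulg1 !actM xy; last exact: PG.
  rewrite xy // xy // (yw (act y (act x c0))) // (yw (act w _)) ?(yw (act y (act y _))) //.
  exact: PG.
apply; apply/act_mono/act_mono/cltW/Pup; apply: (PG) => //; exact: (PG).
Qed.

End Chain.
(** The witness is the kernel of [tau]. A commutator in [L] outside it would move [c0], and after
    inverting it if necessary it moves [c0] up, which [commutator_not_translation] excludes. *)
Lemma cyclic_good : good G L.
Proof.
have fN : fixd N0.
  exists le; do 2 split=> //; move=> l [Ll l0].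
  have le1 a : L a -> tau a = 0%R -> le a 1.
    by move=> La a0; apply: NNPP => /(tau_pos La); lra.
  split; first exact: le1.
  have := proj2 (proj2 ple) l _ _ (le1 _ (LV Ll) _); rewrite mulgV mulg1; apply.
  by rewrite tauV // l0; lra.
exists N0; split; first exact: sN.
split; first by move=> n [].
split; first exact: nN.
split=> //; split=> [g n Gg Ln|x y Gx Gy Lxy].
  split; last exact: tauR.
  by rewrite commgEr; apply: (LM) => //; rewrite conjVg; apply: (LV); apply: nL.
split=> //; apply: NNPP => t0.
have [C [c0 fix0]] := fixd_chain fN.
have c0n : act [~ x, y] c0 <> c0.
  exact: translation_free.
case: (neq_clt c0n) => h; last exact: (commutator_not_translation fix0 Gx Gy Lxy h).
apply: (commutator_not_translation fix0 Gy Gx); rewrite -invgR; first exact: LV.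
by rewrite -(act_clt [~ x, y]) actVK.
Qed.

End Cyclic.

Section Dichotomy.

Variable F : groupType.
Hypothesis fgF : finitely_generated F.
Variables (G : F -> Prop).
Hypothesis sG : is_subgroup G.

Lemma archimedean_dichotomy (L : F -> Prop) le : is_subgroup L -> (forall l, L l -> G l) ->
  normalised G L -> ~ fixd L -> archimedean G L le -> good G L \/ concl G.
Proof.
move=> sL LG nL nfL [ple [nt [leJ [arch [z Lz z1]]]]].
have [tau [mu [tauM [tau_mono [tau_pos [tauz [mu0 tauJ]]]]]]] :=
  hoelder sG sL LG nL ple leJ arch Lz z1.
case: (classic (forall e, (0 < e)%R -> exists2 l, L l & (0 < tau l < e)%R)) => [dense|nd].
  right;  apply: (@affine_concl F fgF G L le sG sL nL ple tau mu z) => //; exact: arch.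
left; have [e he] := not_all_ex_not _ _ nd; have [e0 ne] := imply_to_and _ _ he.
have LV g : L g -> L g^-1 by have [_ [_ h]] := sL; apply: h.
have LM g h : L g -> L h -> L (g * h) by have [_ [H _]] := sL; apply: H.
have tauV := real_charV sL tauM.
(* Positive values of [tau] are at least [e] apart, so their infimum is attained. *)
have [||r [r1 r2]] := completeness (fun r => exists l, L l /\ (0 < tau l)%R /\ r = (- tau l)%R).
- by exists 0%R => _ [l [Ll [l0 ->]]]; lra.
- by exists (- tau z)%R, z; rewrite tauz; do 2 split=> //; lra.
have [w [Lw [w0 wr]]] : exists w, L w /\ (0 < tau w)%R /\ (tau w < - r + e)%R.
  apply: NNPP => h; have := r2 (r - e)%R.
  suff: is_upper_bound (fun r => exists l, L l /\ (0 < tau l)%R /\ r = (- tau l)%R) (r - e)%R.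
    by move=> ub /(_ ub); lra.
  move=> _ [l [Ll [l0 ->]]]; apply: Rnot_lt_le => hl; apply: h.
  by exists l; do 2 split=> //; lra.
apply: (@cyclic_good F G L le sG sL LG nL ple nt nfL tau mu w) => //.
move=> l Ll l0; apply: Rnot_lt_le => lw; apply: ne.
have h : (- tau l <= r)%R by apply: r1; exists l.
exists (w * l^-1); first by apply: LM => //; apply: LV.
by rewrite tauM ?tauV //; [lra|apply: LV].
Qed.

Definition common_fixed (C : chain F) (L N0 : F -> Prop) : Prop :=
  forall s : seq F,
  (forall x, x \in s -> L x /\ exists c : C, fixes N0 c /\ act x c = c) ->
  exists c : C, fixes N0 c /\ forall x, x \in s -> act x c = c.

Lemma common_fixed_dichotomy (L N0 : F -> Prop) (C : chain F) (c0 : C) :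
  is_subgroup L -> is_subgroup N0 -> (forall l, L l -> G l) ->
  normalised G L -> normalised G N0 -> fixes N0 c0 -> common_fixed C L N0 ->
  good G L \/ concl G.
Proof.
move=> sL sN LG nL nN f0 cf.
case: (classic (fixd L)) => [fL|nfL]; first by left; apply: fixd_good.
have [le ale] := archimedean_order fgF sG sL sN LG nL nN f0 cf nfL.
exact: archimedean_dichotomy ale.
Qed.

(** Commuting maps have common fixed points when [L] is not fixed: given a fixed point [c] of [s],
    an element of [L] moves a fixed point of [x] below [c], where it is still fixed by [x]. The
    supremum of such points is fixed by [x], and by [s] because [s] fixes [c] and commutes with
    [x]. *)
Lemma abelian_dichotomy (L N0 : F -> Prop) :
  is_subgroup L -> is_subgroup N0 -> (forall l, L l -> G l) ->
  normalised G L -> normalised G N0 -> fixd N0 ->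
  (forall x y, L x -> L y -> N0 [~ x, y]) -> good G L \/ concl G.
Proof.
move=> sL sN LG nL nN fN ab.
case: (classic (fixd L)) => [fL|nfL]; first by left; apply: fixd_good.
have [C [c0 f0]] := fixd_chain fN.
apply: (common_fixed_dichotomy (N0 := N0) (c0 := c0)) => //.
have comm x y (c : C) : L x -> L y -> fixes N0 c -> act x (act y c) = act y (act x c).
  by move=> Lx Ly Pc; rewrite -actM commgC actM (Pc _ (ab x y Lx Ly)) actM.
have PL x (c : C) : L x -> fixes N0 c -> fixes N0 (act x c : C).
  by move=> Lx; apply: (fixes_act nN); apply: LG.
have [L1 [LM LV]] := sL.
elim=> [|x s IH] hs; first by exists c0.
have [|c [Pc sc]] := IH; first by move=> y ys; apply: hs; rewrite inE ys orbT.
have [Lx [d [Pd xd]]] : L x /\ exists d : C, fixes N0 d /\ act x d = d by apply: hs; rewrite inE eqxx.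
pose Q (e : C) := fixes N0 e /\ act x e = e /\ cle e c.
have [||e sQ] := @cle_lub _ C Q.
- have [h [Lh hd]] := orbit_unboundedV d c sL nfL.
  exists (act h d); split; first exact: PL.
  by split; [rewrite comm ?xd|apply: cltW].
- by exists c => e [_ []].
exists e; split; first by apply: (supc_fixes sN sQ) => ? [].
have sQV y : y \in s -> forall f, Q f -> Q (act y f) /\ Q (act y^-1 f).
  move=> ys f [Pf [xf fc]].
  have [Ly _] : L y /\ exists d : C, fixes N0 d /\ act y d = d by apply: hs; rewrite inE ys orbT.
  have yc := sc y ys.
  split; (split; first by apply: (PL) => //; apply: (LV)).
    by rewrite comm // xf -yc; split=> //; apply: act_mono.
  have ycV := act_fixV yc; have LyV := LV y Ly.
  by rewrite comm // xf -[X in cle _ X]ycV; split=> //; apply: act_mono.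
move=> y; rewrite inE => /orP[/eqP->|ys].
  apply: (supc_fix sQ) => f Qf; have [Pf [xf _]] := Qf; first by rewrite xf.
  by rewrite act_fixV.
by apply: (supc_fix sQ) => f /(sQV y ys) [].
Qed.

End Dichotomy.

(** * Commuting conjugates *)

Section ThreeCopies.

Variables (F : groupType) (G N0 : F -> Prop) (C : chain F) (c0 : C).
Hypotheses (sG : is_subgroup G) (sN : is_subgroup N0) (nN : normalised G N0).
Hypothesis fix0 : fixes N0 c0.
Variables (s ws : seq F) (g1 g2 g3 : F).
Hypothesis sG' : forall x, x \in s -> G x.
Hypothesis wss : forall w, w \in ws -> w \in s.
Hypothesis ws1 : 1 \in ws.
Hypothesis wsV : forall w, w \in ws -> w^-1 \in ws.
Hypothesis wsR : forall w, w \in ws -> exists a b, w = [~ a, b] /\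
  a \in s /\ b \in s /\ a^-1 \in s /\ b^-1 \in s.
Hypothesis nfix : ~ fixd (fun x => N0 x \/ x \in ws).
Hypotheses (G1 : G g1) (G2 : G g2) (G3 : G g3).

Let commuting g h := forall x y, x \in s -> y \in s -> N0 [~ x ^ g, y ^ h].
Hypotheses (cm12 : commuting g1 g2) (cm13 : commuting g1 g3) (cm23 : commuting g2 g3).

Let P (c : C) := fixes N0 c.

Let PG g c : G g -> P c -> P (act g c). Proof. exact: fixes_act. Qed.

Let commutingC g h : commuting g h -> commuting h g.
Proof.
move=> cm x y xs ys; rewrite -invgR.
by have [_ [_ NV]] := sN; apply: NV; apply: cm.
Qed.

Let commute_act g h x y c : commuting g h -> x \in s -> y \in s -> P c ->
  act (x ^ g) (act (y ^ h) c) = act (y ^ h) (act (x ^ g) c).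
Proof. by move=> cm xs ys Pc; rewrite -actM commgC actM (Pc _ (cm x y xs ys)) actM. Qed.

Lemma max_act (l : seq F) (c : C) : l != [::] ->
  exists m, (exists2 w, w \in l & m = act w c) /\ forall w, w \in l -> cle (act w c) m.
Proof.
elim: l => // x l IH _; case: l IH => [_|y l /(_ isT) [m [[w wl mE] mx]]].
  exists (act x c); split; first by exists x; rewrite ?inE.
  by move=> w; rewrite inE => /eqP->; apply: cle_refl.
case: (cle_total m (act x c)) => h.
  exists (act x c); split; first by exists x; rewrite ?inE ?eqxx.
  move=> v; rewrite inE => /orP[/eqP->|/mx vm]; first exact: cle_refl.
  exact: cle_trans h.
exists m; split; first by exists w; rewrite // inE wl orbT.
by move=> v; rewrite inE => /orP[/eqP->|/mx vm].
Qed.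

Let Mspec (p : F * C) : exists m,
  (exists2 w, w \in ws & m = act (w ^ p.1) p.2) /\
  forall w, w \in ws -> cle (act (w ^ p.1) p.2) m.
Proof.
case: p => g c; have [|m [[_ /mapP[w wl ->] mE] mx]] := @max_act [seq w ^ g | w <- ws] c.
  by case: (ws) ws1.
exists m; split; first by exists w.
by move=> v vl; apply: mx; apply/mapP; exists v.
Qed.

(* Let [M_i c] be the largest image of [c] under the [i]-th copy of [ws]. A product of commutators
   from two commuting copies is a single commutator commuting with the third, so
   [M_1 M_2 < M_3^2], and cyclically; the product of the three inequalities is absurd. *)
Lemma three_commuting_copies : False.
Proof.
have [M0 HM] := boolp.choice Mspec; pose M g c := M0 (g, c).
have Mw g c : exists2 w, w \in ws & M g c = act (w ^ g) c by case: (HM (g, c)).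
have Mmax g c w : w \in ws -> cle (act (w ^ g) c) (M g c) by case: (HM (g, c)) => _ /(_ w).
have Gw g w : G g -> w \in s -> G (w ^ g) by move=> Gg /sG' Gw; apply: subgroupJ.
have PM g c : G g -> P c -> P (M g c).
  by move=> Gg Pc; have [w /wss wl ->] := Mw g c; apply: PG => //; apply: Gw.
have Mge g c : cle c (M g c) by have := Mmax g c _ ws1; rewrite conj1g act1.
have Mmono g c d : clt c d -> clt (M g c) (M g d).
  move=> cd; have [w wl ->] := Mw g c.
  by apply: clt_cle_trans (Mmax g d w wl); apply/act_clt.
have Mmono' g c d : cle c d -> cle (M g c) (M g d).
  move=> cd; case: (classic (c = d)) => [->|n_]; first exact: cle_refl.
  by apply/cltW/Mmono/cle_clt.
have Mcof g c u : G g -> P c -> exists n, clt u (iter n (M g) c).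
  move=> Gg Pc; apply: NNPP => h; apply: nfix.
  have b n : cle (iter n (M g) c) u by apply: NNPP => hn; apply: h; exists n.
  pose Q d := P d /\ exists n, cle d (iter n (M g) c).
  have [||e eQ] := @cle_lub _ C Q.
  - by exists c; split=> //; exists 0%N; apply: cle_refl.
  - by exists u => d [_ [n dn]]; apply: cle_trans dn (b n).
  have Pe : P e by apply: (supc_fixes sN eQ) => d [].
  have Qw w d : w \in ws -> Q d -> Q (act (w ^ g) d).
    move=> wl [Pd [n dn]]; split; first by apply: PG => //; apply: Gw => //; apply: wss.
    exists n.+1; rewrite iterS; apply: cle_trans (act_mono _ dn) _; exact: Mmax.
  (* [e] is fixed by the copy of [ws] conjugated by [g], hence [act g e] is fixed by [ws] itself. *)
  apply: (@fixes_fixd _ C _ (act g e)) => x [Nx|xw]; first exact: (PG Gg Pe).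
  rewrite -actM conjgC actM; congr act.
  apply: (supc_fix eQ) => d; first exact: Qw.
  by rewrite -conjVg; apply: Qw; apply: wsV.
have Mact g h x c : commuting g h -> G g -> G h -> x \in s -> P c ->
    M g (act (x ^ h) c) = act (x ^ h) (M g c).
  move=> cm Gg Gh xs Pc; apply: cle_anti.
    have [w wl ->] := Mw g (act (x ^ h) c).
    rewrite (commute_act cm (wss wl) xs Pc); apply: act_mono; exact: Mmax.
  have [w wl ->] := Mw g c.
  by rewrite -(commute_act cm (wss wl) xs Pc); apply: Mmax.
have MM g h c : commuting g h -> G g -> G h -> P c -> M g (M h c) = M h (M g c).
  move=> cm Gg Gh Pc; apply: cle_anti.
    have [w wl ->] := Mw h c; rewrite Mact //; last exact: wss.
    exact: Mmax.
  have [w wl ->] := Mw g c; rewrite Mact //; [exact: Mmax|exact: commutingC|exact: wss].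
have bound g h k c : commuting g h -> commuting g k -> commuting h k ->
    G g -> G h -> G k -> P c -> clt (M g (M h c)) (M k (M k c)).
  move=> gh gk hk Gg Gh Gk Pc; have hg := commutingC gh.
  have kg := commutingC gk; have kh := commutingC hk.
  have [w2 w2l ->] := Mw h c; have [w1 w1l ->] := Mw g (act (w2 ^ h) c).
  have [a1 [b1 [-> [a1s [b1s [a1s' b1s']]]]]] := wsR w1l.
  have [a2 [b2 [-> [a2s [b2s [a2s' b2s']]]]]] := wsR w2l.
  have Pg x d : x \in s -> P d -> P (act (x ^ g) d) by move=> xs; apply/PG/Gw.
  have Ph x d : x \in s -> P d -> P (act (x ^ h) d) by move=> xs; apply/PG/Gw.
  pose d := act (a1 ^ g) (act (b1 ^ g) (act (a2 ^ h) (act (b2 ^ h) c))).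
  have Pd : P d by rewrite /d; do ?[apply: (Pg) => //|apply: (Ph) => //].
  (* Chosen so that [Y X d] is the product of the two commutators at [c], while [X Y d = c], because
     factors from different copies commute. *)
  pose X := b1^-1 ^ g * b2^-1 ^ h; pose Y := a1^-1 ^ g * a2^-1 ^ h.
  have GX : G X by case: (sG) => _ [GM _]; apply: GM; apply: Gw.
  have GY : G Y by case: (sG) => _ [GM _]; apply: GM; apply: Gw.
  have actX e : act X e = act (b1^-1 ^ g) (act (b2^-1 ^ h) e) := actM _ _ e.
  have actY e : act Y e = act (a1^-1 ^ g) (act (a2^-1 ^ h) e) := actM _ _ e.
  have actR k' a b (e : C) : act ([~ a, b] ^ k') e =
      act (a^-1 ^ k') (act (b^-1 ^ k') (act (a ^ k') (act (b ^ k') e))).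
    by rewrite commgEl (conjgE a b) !conjMg (actM (a^-1 ^ k')) (actM (b^-1 ^ k')) (actM (a ^ k')).
  have MX e : P e -> M k (act X e) = act X (M k e).
    move=> Pe; rewrite actX Mact //; last exact: Ph.
    by rewrite Mact // -actX.
  have MY e : P e -> M k (act Y e) = act Y (M k e).
    move=> Pe; rewrite actY Mact //; last exact: Ph.
    by rewrite Mact // -actY.
  have := @commutator_bound F C P (M k) X Y (fun e => PM k e Gk) (fun e => PG GX)
    (fun e => PG GY) (Mmono k) MX MY (fun e _ => Mge k e) (fun e u => Mcof k e u Gk) d Pd.
  have sw x y e : x \in s -> y \in s -> P e ->
     act (x ^ h) (act (y ^ g) e) = act (y ^ g) (act (x ^ h) e).
    by move=> xs ys Pe; apply: commute_act.
  have -> : act Y (act X d) = act ([~ a1, b1] ^ g) (act ([~ a2, b2] ^ h) c).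
    rewrite actX actY !actR /d.
    by rewrite !sw //; do ?[apply: (Pg) => //|apply: (Ph) => //].
  have -> : act X (act Y d) = c.
    rewrite actX actY /d !sw //; do ?[apply: (Pg) => //|apply: (Ph) => //].
    by rewrite !conjVg !actK.
  by [].
pose a := M g1; pose b := M g2; pose d := M g3.
have Pa c : P c -> P (a c) by apply: PM.
have Pb c : P c -> P (b c) by apply: PM.
have Pd c : P c -> P (d c) by apply: PM.
have ab c : P c -> b (a c) = a (b c) by move=> Pc; apply: MM => //; apply: commutingC.
have ad c : P c -> d (a c) = a (d c) by move=> Pc; apply: MM => //; apply: commutingC.
have bd c : P c -> d (b c) = b (d c) by move=> Pc; apply: MM => //; apply: commutingC.
have h1 c : P c -> clt (a (b c)) (d (d c)) by move=> Pc; apply: bound.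
have h2 c : P c -> clt (b (d c)) (a (a c)).
  by move=> Pc; apply: bound => //; apply: commutingC.
have h3 c : P c -> clt (a (d c)) (b (b c)).
  by move=> Pc; apply: bound => //; apply: commutingC.
have am c e : cle c e -> cle (a c) (a e) by apply: Mmono'.
have dm c e : cle c e -> cle (d c) (d e) by apply: Mmono'.
have Pc1 := Pd _ fix0; have Pc2 := Pa _ Pc1; have Pc3 := Pd _ Pc2; have Pc4 := Pb _ Pc3.
(* At the point [b d a d c0] the bound [h1] says [a b b d a d c0 < d d b d a d c0]; by [h2] and [h3]
   the right side is at most [d d a a b b c0], which equals the left side. *)
have := h1 _ Pc4; apply.
apply: (@cle_trans _ C _ (d (d (a (a (a (d c0))))))).
  by apply/dm/dm/cltW/h2.
apply: (@cle_trans _ C _ (d (d (a (a (b (b c0))))))).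
  by apply/dm/dm/am/am/cltW/h3.
have -> : d (d (a (a (b (b c0))))) = a (b (b (d (a (d c0))))).
  have P0 : P c0 := fix0.
  rewrite ad; last by do ?[apply: (Pa) => //|apply: (Pb) => //|apply: (Pd) => //].
  rewrite !(ad, bd, ab) //; by do ?[apply: (Pa) => //|apply: (Pb) => //|apply: (Pd) => //].
exact: cle_refl.
Qed.

End ThreeCopies.

Section Steps.

Variable F : groupType.
Hypothesis fgF : finitely_generated F.
Variable G : F -> Prop.
Hypothesis sG : is_subgroup G.

Lemma abelian_step (L N : F -> Prop) : is_subgroup L -> (forall l, L l -> G l) ->
  normalised G L -> good G N -> (forall x y, L x -> L y -> N [~ x, y]) ->
  good G L \/ concl G.
Proof.
move=> sL LG nL [N0 [sN [NN [nN [fN [cN rN]]]]]] ab.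
apply: (abelian_dichotomy fgF sG sL sN) => // x y Lx Ly.
by apply: rN; [apply: LG|apply: LG|apply: ab].
Qed.

Definition three_copies (L N : F -> Prop) : Prop :=
  forall s : seq F, (forall x, x \in s -> L x) ->
  exists g h, G g /\ G h /\ forall x y, x \in s -> y \in s ->
    N [~ x, y ^ g] /\ N [~ x, y ^ h] /\ N [~ x ^ g, y ^ h].

(** By compactness it is enough to fix each finite set of commutators of [L], and an unfixed one
    would contradict [three_commuting_copies]. Then [L] is abelian modulo the fixed subgroup
    generated by [N0] and the commutators. *)
Lemma copies_step (L N : F -> Prop) : is_subgroup L -> (forall l, L l -> G l) ->
  normalised G L -> good G N -> three_copies L N -> good G L \/ concl G.
Proof.
move=> sL LG nL [N0 [sN [NN [nN [fN [cN rN]]]]]] copies.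
have [L1 [LM LV]] := sL.
pose K x := exists a b, L a /\ L b /\ x = [~ a, b].
have fK : fixd (fun x => N0 x \/ K x).
  apply: (fixd_compact fgF) => s Ks; apply: NNPP => nf.
  have H x : exists p : F * F, K x -> L p.1 /\ L p.2 /\ x = [~ p.1, p.2].
    case: (classic (K x)) => [[a [b [La [Lb E]]]]|nK]; first by exists (a, b).
    by exists (1, 1).
  have [p pP] := boolp.choice H.
  pose ws := 1 :: s ++ [seq x^-1 | x <- s].
  pose A := [seq (p x).1 | x <- s] ++ [seq (p x).2 | x <- s].
  pose S := ws ++ A ++ [seq x^-1 | x <- A].
  have AS x : x \in s -> (p x).1 \in A /\ (p x).2 \in A.
    by move=> xs; rewrite !mem_cat; split; apply/orP; [left|right]; apply/mapP; exists x.
  have AL x : x \in A -> L x.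
    rewrite mem_cat => /orP[] /mapP[y /Ks /pP [h1 [h2 _]] ->] //.
  have wsL w : w \in ws -> L w.
    have sL' x : x \in s -> L x.
      by move=> /Ks [a [b [La [Lb ->]]]]; apply: subgroupR.
    rewrite inE mem_cat => /orP[/eqP->//|/orP[/sL'//|/mapP[x /sL' Lx ->]]].
    exact: LV.
  have SL x : x \in S -> L x.
    rewrite !mem_cat => /orP[/wsL//|/orP[|/mapP[y /AL Ly ->]]]; last exact: LV.
    by rewrite -mem_cat; apply: AL.
  have AinS a : a \in A -> a \in S /\ a^-1 \in S.
    move=> aA; split; rewrite (mem_cat _ ws) (mem_cat _ A); first by rewrite aA orbT.
    by apply/orP; right; apply/orP; right; apply/mapP; exists a.
  have oneS : 1 \in S by rewrite mem_cat inE eqxx.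
  have [g [h [Gg [Gh cm]]]] := copies S SL.
  have [C [c0 f0]] := fixd_chain fN.
  have GJ x k : x \in S -> G k -> G (x ^ k) by move=> /SL /LG Gx; apply: subgroupJ.
  have G1 : G 1 by case: sG.
  apply: (@three_commuting_copies F G N0 C c0 sG sN nN f0 S ws 1 g h) => //.
  - by move=> x /SL /LG.
  - by move=> w wl; rewrite mem_cat wl.
  - by rewrite inE eqxx.
  - move=> w; rewrite !inE !mem_cat => /orP[/eqP->|/orP[ws'|/mapP[x xs ->]]].
    + by rewrite invg1 eqxx.
    + by apply/orP; right; apply/orP; right; apply/mapP; exists w.
    + by rewrite invgK xs orbT.
  - move=> w; rewrite inE mem_cat => /orP[/eqP->|/orP[xs|/mapP[x xs ->]]].
    + by exists 1, 1; rewrite commg1 invg1 oneS.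
    + have [_ [_ E]] := pP _ (Ks _ xs); have [h1 h2] := AS _ xs.
      by exists (p w).1, (p w).2; have [? ?] := AinS _ h1; have [? ?] := AinS _ h2.
    + have [_ [_ E]] := pP _ (Ks _ xs); have [h1 h2] := AS _ xs.
      exists (p x).2, (p x).1; rewrite -invgR -E.
      by have [? ?] := AinS _ h1; have [? ?] := AinS _ h2.
  - apply: contra_not nf; apply: fixdS => x [Nx|xs]; first by left.
    by right; rewrite inE mem_cat xs orbT.
  - move=> x y xs ys; have [h1 _] := cm x y xs ys; rewrite conjg1.
    by apply: rN => //; [apply/LG/SL|apply: GJ].
  - move=> x y xs ys; have [_ [h1 _]] := cm x y xs ys; rewrite conjg1.
    by apply: rN => //; [apply/LG/SL|apply: GJ].
  - move=> x y xs ys; have [_ [_ h1]] := cm x y xs ys.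
    by apply: rN => //; apply: GJ.
pose D := gen_by (fun x => N0 x \/ K x).
have sD : is_subgroup D.
  by split; [apply: gen_one|split; [apply: gen_mul|apply: gen_inv]].
have fD : fixd D.
  have [le [ple [nt kK]]] := fK; exists le; do 2 split=> //.
  have [k1 [kM kV]] := ker_subgroup ple.
  by move=> x; elim=> {x} [x|//|x y _ kx _ ky|x _ kx]; [apply: kK|apply: kM|apply: kV].
have nD : normalised G D.
  move=> x g; elim=> {x} [x [Nx|[a [b [La [Lb ->]]]]]||x y _ Dx _ Dy|x _ Dx] Gg.
  - by apply: gen_base; left; apply: nN.
  - apply: gen_base; right; exists (a ^ g), (b ^ g); rewrite conjRg.
    by split; [apply: nL|split; [apply: nL|]].
  - by rewrite conj1g; apply: gen_one.
  - by rewrite conjMg; apply: gen_mul; [apply: Dx|apply: Dy].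
  - by rewrite conjVg; apply: gen_inv; apply: Dx.
apply: (abelian_dichotomy fgF sG sL sD) => // x y Lx Ly.
by apply: gen_base; right; exists x, y.
Qed.

(* The intersections over [G] of the conjugates of the two subgroups provided by [concl L]
   are normal in [G] and cut [L] into two abelian layers. *)
Lemma concl_dichotomy (L : F -> Prop) : is_subgroup L -> (forall l, L l -> G l) ->
  normalised G L -> concl L -> good G L \/ concl G.
Proof.
move=> sL LG nL [le [A [ple [nt [nB [sA [AL [nA [BA [RA [_ [LR _]]]]]]]]]]]].
have [L1 [LM LV]] := sL; have [A1 [AM AV]] := sA; have [G1 [GM GV]] := sG.
have [k1 [kM kV]] := ker_subgroup ple.
pose K f := L f /\ forall g, G g -> ker le (f ^ g).
pose D f := L f /\ forall g, G g -> A (f ^ g).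
have sK : is_subgroup K.
  split; first by split=> // g _; rewrite conj1g.
  split=> [x y [Lx hx] [Ly hy]|x [Lx hx]].
    by split=> [|g Gg]; [apply: LM|rewrite conjMg; apply: (kM); [apply: hx|apply: hy]].
  by split=> [|g Gg]; [apply: LV|rewrite conjVg; apply: (kV); apply: hx].
have sD : is_subgroup D.
  split; first by split=> // g _; rewrite conj1g.
  split=> [x y [Lx hx] [Ly hy]|x [Lx hx]].
    by split=> [|g Gg]; [apply: LM|rewrite conjMg; apply: (AM); [apply: hx|apply: hy]].
  by split=> [|g Gg]; [apply: LV|rewrite conjVg; apply: (AV); apply: hx].
have nK : normalised G K.
  move=> x g [Lx hx] Gg; split; first exact: nL.
  by move=> h Gh; rewrite -conjgM; apply: hx; apply: GM.
have nD : normalised G D.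
  move=> x g [Lx hx] Gg; split; first exact: nL.
  by move=> h Gh; rewrite -conjgM; apply: hx; apply: GM.
have fK : fixd K.
  exists le; do 2 split=> //; by move=> x [_ hx]; rewrite -[x]conjg1; apply: hx.
have DL f : D f -> L f by case.
have gK : good G K by apply: fixd_good.
case: (@abelian_step D K sD (fun f Df => LG f (DL f Df)) nD gK); [|move=> gD|by right].
  move=> x y [Lx hx] [Ly hy]; split; first exact: subgroupR.
  by move=> g Gg; rewrite conjRg; apply: RA; [apply: hx|apply: hy].
apply: (abelian_step sL LG nL gD) => x y Lx Ly; split; first exact: subgroupR.
by move=> g Gg; rewrite conjRg; apply: LR; apply: nL.
Qed.

End Steps.

Section NoFreeSemigroup.

Variable F : groupType.
Hypothesis fgF : finitely_generated F.
Variables (G N : F -> Prop).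
Hypotheses (sG : is_subgroup G) (sN : is_subgroup N).

Definition no_free_pairs (N : F -> Prop) : Prop :=
  forall a b, G a -> G b -> exists w1 w2 : seq bool, w1 <> w2 /\
    N ((word_eval a b w1)^-1 * word_eval a b w2).

Lemma word_eval_cat (H : groupType) (a b : H) w1 w2 :
  word_eval a b (w1 ++ w2) = word_eval a b w1 * word_eval a b w2.
Proof. by elim: w1 => [|c w1 IH] /=; rewrite ?mul1g // IH mulgA. Qed.

Lemma word_evalP (a b : F) w : G a -> G b -> G (word_eval a b w).
Proof.
have [G1 [GM GV]] := sG.
by move=> Ga Gb; elim: w => // c w IH /=; apply: (GM) => //; case: c.
Qed.

(* If [w1 = w2] modulo a central subgroup, then [w1 u w2 = w2 u w1] exactly; these
   two words can coincide for at most one of the two letters [u]. *)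
Lemma no_free_pairs_central (N0 : F -> Prop) : is_subgroup N0 ->
  (forall g n, G g -> N n -> N0 [~ g, n]) -> no_free_pairs N -> no_free_pairs N0.
Proof.
move=> sN0 cN nf a b Ga Gb; have [w1 [w2 [nw h]]] := nf a b Ga Gb.
have N0V : forall x, N0 x -> N0 x^-1 by case: sN0 => _ [].
have key u : N0 ((word_eval a b (w1 ++ u :: w2))^-1 * word_eval a b (w2 ++ u :: w1)).
  set W1 := word_eval a b w1 in h; set W2 := word_eval a b w2 in h.
  have E c w : word_eval a b (c :: w) = word_eval a b [:: c] * word_eval a b w.
    by rewrite /= mulg1.
  rewrite !word_eval_cat (E u w1) (E u w2) -/W1 -/W2; set U := word_eval a b [:: u].
  have GUW : G (U * W1) by case: (sG) => _ [GM _]; apply: (GM); apply: word_evalP.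
  have := cN _ _ GUW h; rewrite -invgR => /N0V; rewrite invgK.
  suff -> : (W1 * (U * W2))^-1 * (W2 * (U * W1)) = [~ W1^-1 * W2, U * W1] by [].
  by rewrite commgEl conjgE !gnorm.
case: (eqVneq (w1 ++ true :: w2) (w2 ++ true :: w1)) => e1; last first.
  by exists (w1 ++ true :: w2), (w2 ++ true :: w1); split=> //; apply/eqP.
case: (eqVneq (w1 ++ false :: w2) (w2 ++ false :: w1)) => e2; last first.
  by exists (w1 ++ false :: w2), (w2 ++ false :: w1); split=> //; apply/eqP.
case: nw; wlog: w1 w2 e1 e2 {h key} / (size w1 <= size w2)%N.
  by move=> W; case/orP: (leq_total (size w1) (size w2)) => /W; [apply|move=> hs; symmetry; apply: hs].
move=> le12; have p1 : w1 = take (size w1) w2.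
  have := congr1 (take (size w1)) e1; rewrite take_size_cat // takel_cat //.
have [v E] : exists v, w2 = w1 ++ v.
  by exists (drop (size w1) w2); rewrite {1}p1 cat_take_drop.
move: e1 e2; rewrite E -!catA => /eqP; rewrite eqseq_cat // eqxx /= => /eqP e1.
move=> /eqP; rewrite eqseq_cat // eqxx /= => /eqP.
(* A nonempty [v] would have to begin with both letters. *)
by case: v e1 {E} => [|x v] /=; [rewrite cats0|move=> [<- _] []].
Qed.

End NoFreeSemigroup.

(** * Groups without free subsemigroups *)

Section PingPong.

Variables (F : groupType) (G N0 : F -> Prop) (C : chain F) (c0 : C).
Hypotheses (sG : is_subgroup G) (sN : is_subgroup N0) (nN : normalised G N0).
Hypotheses (fix0 : fixes N0 c0) (nfG : ~ fixd G) (nofree : no_free_pairs G N0).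

Let P (c : C) := fixes N0 c.
Let PG g c : G g -> P c -> P (act g c). Proof. exact: fixes_act. Qed.
Let GV g : G g -> G g^-1. Proof. by have [_ [_ h]] := sG; apply: h. Qed.
Let GM g h : G g -> G h -> G (g * h). Proof. by have [_ [H _]] := sG; apply: H. Qed.
Let GX g n : G g -> G (g ^+ n). Proof. exact: subgroupX. Qed.

(** [a] and [b] map the interval from [u] to [v] into itself with disjoint images, and no nonempty
    word fixes both ends. So a word is determined by its values at [u] and [v], which are points
    fixed by [N0]. *)
Lemma ping_pong a b (u v : C) : G a -> G b -> P u -> P v ->
  cle u v -> cle u (act a u) -> clt (act a v) (act b u) -> cle (act b v) v -> False.
Proof.
move=> Ga Gb Pu Pv uv ua ab bv.
have au_av := act_mono a uv; have bu_bv := act_mono b uv.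
have ub : clt u (act b u) by apply: cle_clt_trans ua _; apply: cle_clt_trans au_av ab.
have av : clt (act a v) v by apply: clt_cle_trans ab _; apply: cle_trans bu_bv bv.
pose W w := word_eval a b w.
have inside w : cle u (act (W w) u) /\ cle (act (W w) v) v.
  elim: w => [|c w [IH1 IH2]]; first by rewrite /W /= !act1; split; apply: cle_refl.
  rewrite /W /= !actM; case: c; split.
  - exact: cle_trans ua (act_mono _ IH1).
  - exact: cle_trans (act_mono _ IH2) (cltW av).
  - exact: cle_trans (cltW ub) (act_mono _ IH1).
  - exact: cle_trans (act_mono _ IH2) bv.
have uvW w : cle (act (W w) u) (act (W w) v) by apply: act_mono.
have moved c w : act (W (c :: w)) u = u -> act (W (c :: w)) v = v -> False.
  have [h1 h2] := inside w; rewrite /W /= !actM; case: c => hu hv.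
    by apply: av; rewrite -{1}hv; apply: act_mono.
  by apply: ub; rewrite -{2}hu; apply: act_mono.
have actI g (c d : C) : act g c = act g d -> c = d.
  by move=> /(congr1 (act g^-1)); rewrite !actK.
have apart w w' : act a (act (W w) v) = act b (act (W w') v) -> False.
  move=> E; have [_ h2] := inside w; have [h1 _] := inside w'; apply: ab.
  apply: cle_trans (act_mono b h1) _; apply: cle_trans (act_mono b (uvW w')) _.
  by rewrite -E; apply: act_mono.
have inj w1 w2 : act (W w1) u = act (W w2) u -> act (W w1) v = act (W w2) v -> w1 = w2.
  elim: w1 w2 => [|c w1 IH] [|d w2] //.
  - by rewrite {1 3}/W /= !act1 => /esym h /esym h'; case: (moved _ _ h h').
  - by rewrite {2 4}/W /= !act1 => h h'; case: (moved _ _ h h').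
  rewrite /W /= !actM; case: c; case: d => eu ev.
  - by congr cons; apply: IH; [apply: actI eu|apply: actI ev].
  - by case: (apart _ _ ev).
  - by case: (apart _ _ (esym ev)).
  - by congr cons; apply: IH; [apply: actI eu|apply: actI ev].
have [w1 [w2 [nw Nw]]] := nofree Ga Gb; apply: nw.
have same c : P c -> act (W w1) c = act (W w2) c.
  by move=> Pc; rewrite -[in LHS](Pc _ Nw) -actM mulVKg.
by apply: inj; apply: same.
Qed.

(** The infimum of the orbit of [v] is fixed by [f], so by [top] it is at most [c], below [w]. *)
Let contract f (v c w : C) : G f -> P v -> P c -> cle c v -> act f c = c ->
  cle (act f v) v -> (forall d, P d -> act f d = d -> cle d c) -> clt c w ->
  exists n, clt (act (f ^+ n) v) w.
Proof.
move=> Gf Pv Pc cv fc fv top cw.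
have [||e eQ] := @cle_glb _ C (fun d => P d /\ exists n, cle (act (f ^+ n) v) d).
- by exists v; split=> //; exists 0%N; rewrite expg0 act1; apply: cle_refl.
- exists c => d [_ [n hn]]; apply: cle_trans hn; rewrite -(act_fixX n fc).
  exact: act_mono.
have Pe : P e by apply: (infc_fixes sN eQ) => d [].
have fe : act f e = e.
  apply: (infc_fix eQ) => d [Pd [n hn]]; (split; first by apply: PG => //; apply: GV).
    by exists n.+1; rewrite expgS actM; apply: act_mono.
  exists n; rewrite -(act_cle f) actVK -actM -expgS; apply: cle_trans hn.
  by rewrite expgSr actM; apply: act_mono.
have [d [[_ [n hn]] dw]] := infc_approx eQ (cle_clt_trans (top e Pe fe) cw).
by exists n; apply: cle_clt_trans hn dw.
Qed.

(** Otherwise [f] has a last fixed point [c], and [f] or its inverse contracts points above [c]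
    towards [c]. With [k] moving [c] up and [v] a point of the orbit above [act k c], suitable
    [f' ^+ n] and [k * f' ^+ m] play ping-pong between [c] and [v]. *)
Lemma fixed_unbounded f (e u : C) : G f -> P e -> act f e = e ->
  exists e' : C, P e' /\ act f e' = e' /\ cle u e'.
Proof.
move=> Gf Pe fe; apply: NNPP => h.
have [||c cX] := @cle_lub _ C (fun d => P d /\ act f d = d).
- by exists e.
- exists u => d [Pd fd]; case: (cle_total d u) => // ud; case: h; by exists d.
have Pc : P c by apply: (supc_fixes sN cX) => d [].
have fc : act f c = c.
  by apply: (supc_fix cX) => d [Pd fd]; rewrite ?act_fixV ?fd.
have top d : P d -> act f d = d -> cle d c by move=> Pd fd; apply: (proj1 cX).
have [k [Gk ck]] := orbit_unbounded c c sG nfG.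
have [k' [Gk' hv]] := orbit_unbounded c (act k c) sG nfG.
set v := act k' c in hv; have Pv : P v by apply: PG.
have cv : clt c v by apply: cle_clt_trans (cltW ck) hv.
have [f' [Gf' [fc' [fv' top']]]] : exists f', G f' /\ act f' c = c /\ cle (act f' v) v /\
    forall d, P d -> act f' d = d -> cle d c.
  case: (cle_total (act f v) v) => fv; first by exists f.
  exists f^-1; split; first exact: GV.
  split; first exact: act_fixV.
  split; first by rewrite -(act_cle f) actVK.
  by move=> d Pd fd; apply: top => //; have := act_fixV fd; rewrite invgK.
have [n hn] := contract Gf' Pv Pc (cltW cv) fc' fv' top' ck.
have kv : clt c (act k^-1 v) by rewrite -(act_clt k) actVK.
have [m hm] := contract Gf' Pv Pc (cltW cv) fc' fv' top' kv.
apply: (@ping_pong (f' ^+ n) (k * f' ^+ m) c v) => //.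
- exact: GX.
- by apply: GM => //; apply: GX.
- exact: cltW.
- by rewrite act_fixX //; apply: cle_refl.
- by rewrite actM (act_fixX m fc').
- by rewrite actM -(act_cle k^-1) actK; apply: cltW.
Qed.

(** From a fixed point [c] of [s], climb by [f] or its inverse to the fixed point [d] of [f] that is
    the supremum of the images of [c]; the climb is bounded by [fixed_unbounded]. If [s] does not
    fix [d], a ping-pong pair appears. *)
Lemma no_free_common_fixed : common_fixed C G N0.
Proof.
elim=> [|f s IH] hs; first by exists c0.
have [|c [Pc sc]] := IH; first by move=> y ys; apply: hs; rewrite inE ys orbT.
have [Gf [e [Pe fe]]] : G f /\ exists d : C, fixes N0 d /\ act f d = d by apply: hs; rewrite inE eqxx.
have [e' [Pe' [fe' ce']]] := fixed_unbounded c Gf Pe fe.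
have [k [Gk [ke [kc kf]]]] : exists k, G k /\ act k e' = e' /\ cle c (act k c) /\
    forall d : C, act k d = d -> act f d = d.
  case: (cle_total c (act f c)) => cf; first by exists f.
  exists f^-1; split; first exact: GV.
  split; first exact: act_fixV.
  split; first by rewrite -(act_cle f) actVK.
  by move=> d /act_fixV; rewrite invgK.
have up n : cle (act (k ^+ n) c) (act (k ^+ n.+1) c).
  by rewrite expgSr actM; apply: act_mono.
pose Q (d : C) := P d /\ exists n, cle d (act (k ^+ n) c).
have [||d dQ] := @cle_lub _ C Q.
- by exists c; split=> //; exists 0%N; rewrite expg0 act1; apply: cle_refl.
- exists e' => x [_ [n hn]]; apply: cle_trans hn _; rewrite -(act_fixX n ke).
  exact: act_mono.
have Pd : P d by apply: (supc_fixes sN dQ) => x [].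
have kd : act k d = d.
  apply: (supc_fix dQ) => x [Px [n hn]]; (split; first by apply: PG => //; apply: GV).
    by exists n.+1; rewrite expgS actM; apply: act_mono.
  exists n; rewrite -(act_cle k) actVK -actM -expgS; exact: cle_trans hn (up n).
exists d; split=> // x; rewrite inE => /orP[/eqP->|]; first exact: kf.
case: (classic (forall y, y \in s -> act y d = d)) => [h|nh]; first exact: h.
exfalso.
have sG' y : y \in s -> G y.
  by move=> ys; have [] : G y /\ exists d : C, fixes N0 d /\ act y d = d by apply: hs; rewrite inE ys orbT.
have cd : cle c d.
  by apply: (proj1 dQ); split=> //; exists 0%N; rewrite expg0 act1; apply: cle_refl.
(* [c'] is the last common fixed point of [s] up to [d]. The infimum of the orbit of [d] under the
   group [H] generated by [s] is then at most [c'], so some [y] in [H] takes [d] below [act k c'];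
   [y] fixes [c'] and [k] fixes [d]. *)
pose X (x : C) := P x /\ (forall y, y \in s -> act y x = x) /\ cle x d.
have [||c' cX] := @cle_lub _ C X.
- by exists c.
- by exists d => z [_ []].
have Pc' : P c' by apply: (supc_fixes sN cX) => z [].
have sc' y : y \in s -> act y c' = c'.
  by move=> ys; apply: (supc_fix cX) => z Xz; have [_ [/(_ y ys) yz _]] := Xz; rewrite ?(act_fixV yz) ?yz.
have c'd : cle c' d by apply: (proj2 cX) => z [_ []].
have cc' : cle c c' by apply: (proj1 cX).
have c'lt : clt c' d by apply: cle_clt => // E; apply: nh => y ys; rewrite -E sc'.
have kc' : clt c' (act k c').
  move=> kc'; apply: c'lt; apply: (proj2 dQ) => z [_ [n hn]]; apply: cle_trans hn _.
  elim: n => [|n IHn]; first by rewrite expg0 act1.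
  by rewrite expgS actM; apply: cle_trans (act_mono k IHn) kc'.
pose H := gen_by (fun y => y \in s).
have sH : is_subgroup H.
  by split; [apply: gen_one|split; [apply: gen_mul|apply: gen_inv]].
have HG y : H y -> G y.
  elim=> {y} [y /sG'||y z _ Gy _ Gz|y _ Gy] //; first by case: sG.
  - exact: GM.
  - exact: GV.
have Hc' y : H y -> act y c' = c'.
  elim=> {y} [y /sc'||y z _ yc _ zc|y _ yc] //; first exact: act1.
    by rewrite actM zc.
  exact: act_fixV.
have [||i iY] := @cle_glb _ C (fun z => exists2 y, H y & z = act y d).
- by exists d, 1; rewrite ?act1 //; apply: gen_one.
- by exists c' => _ [y Hy ->]; rewrite -(Hc' y Hy); apply: act_mono.
have Pi : P i by apply: (infc_fixes sN iY) => _ [y Hy ->]; apply: PG => //; apply: HG.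
have ii y : y \in s -> act y i = i.
  move=> ys; have Hy : H y by apply: gen_base.
  apply: (infc_fix iY) => _ [z Hz ->]; rewrite -actM.
    by exists (y * z) => //; apply: gen_mul.
  by exists (y^-1 * z) => //; apply: gen_mul => //; apply: gen_inv.
have id : cle i d by apply: (proj1 iY); exists 1; rewrite ?act1 //; apply: gen_one.
have ic' : cle i c' by apply: (proj1 cX).
have [_ [[y Hy ->] yd]] := infc_approx iY (cle_clt_trans ic' kc').
apply: (@ping_pong y k c' d) => //; first exact: HG.
- by rewrite Hc' //; apply: cle_refl.
- by rewrite kd; apply: cle_refl.
Qed.

End PingPong.

Section NoFreeConclusion.

Variable F : groupType.
Hypothesis fgF : finitely_generated F.

Lemma no_free_concl (G N : F -> Prop) : is_subgroup G -> good G N -> no_free_pairs G N -> concl G.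
Proof.
move=> sG [N0 [sN [NN [nN [fN [cN rN]]]]]] nf.
have nf0 := no_free_pairs_central sG sN cN nf.
have nG : normalised G G by move=> x g; apply: subgroupJ.
case: (classic (fixd G)) => [fG|nfG]; first by apply: good_concl => //; apply: fixd_good.
have [C [c0 f0]] := fixd_chain fN.
have cf := no_free_common_fixed sG sN nN f0 nfG nf0.
by case: (common_fixed_dichotomy fgF sG sG sN (fun g h => h) nG nN f0 cf) => // /good_concl; apply.
Qed.

End NoFreeConclusion.

(** * Closure properties of the class *)

Section DirectedUnion.

Variable F : groupType.
Hypothesis fgF : finitely_generated F.

Lemma concl_union (I : Type) (i0 : I) (H : I -> F -> Prop) (G : F -> Prop) :
  (forall i, concl (H i)) ->
  (forall i j, exists k, (forall f, H i f -> H k f) /\ (forall f, H j f -> H k f)) ->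
  (forall f, G f <-> exists i, H i f) -> concl G.
Proof.
move=> cH dir GH.
have cH' i : exists p : (F -> F -> Prop) * (F -> Prop), let le := p.1 in let A := p.2 in
    lpre le /\ (exists x, ~ ker le x) /\
    (forall b g, H i b -> H i g -> ker le b -> ker le (b ^ g)) /\
    is_subgroup A /\ (forall a, A a -> H i a) /\ normalised (H i) A /\
    (forall g, H i g -> ker le g -> A g) /\
    (forall a a', A a -> A a' -> ker le [~ a, a']) /\
    (forall a g, A a -> ~ ker le a -> H i g -> ker le [~ g, a] -> A g) /\
    (forall g h, H i g -> H i h -> A [~ g, h]) /\
    (forall g n, H i g -> (0 < n)%N -> A (g ^+ n) -> A g).
  by have [le [A h]] := cH i; exists (le, A).
have [p pP] := boolp.choice cH'; pose le i := (p i).1; pose A i := (p i).2.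
have ple i : lpre (le i) by case: (pP i).
have ntle i : exists x, ~ ker (le i) x by case: (pP i) => _ [].
have nB i : forall b g, H i b -> H i g -> ker (le i) b -> ker (le i) (b ^ g).
  by case: (pP i) => _ [_ []].
have sA i : is_subgroup (A i) by case: (pP i) => _ [_ [_ []]].
have AH i : forall a, A i a -> H i a by case: (pP i) => _ [_ [_ [_ []]]].
have nA i : normalised (H i) (A i) by case: (pP i) => _ [_ [_ [_ [_ []]]]].
have BA i : forall g, H i g -> ker (le i) g -> A i g.
  by case: (pP i) => _ [_ [_ [_ [_ [_ []]]]]].
have RA i : forall a a', A i a -> A i a' -> ker (le i) [~ a, a'].
  by case: (pP i) => _ [_ [_ [_ [_ [_ [_ []]]]]]].
have CA i : forall a g, A i a -> ~ ker (le i) a -> H i g -> ker (le i) [~ g, a] -> A i g.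
  by case: (pP i) => _ [_ [_ [_ [_ [_ [_ [_ []]]]]]]].
have RG i : forall g h, H i g -> H i h -> A i [~ g, h].
  by case: (pP i) => _ [_ [_ [_ [_ [_ [_ [_ [_ []]]]]]]]].
have TG i : forall g n, H i g -> (0 < n)%N -> A i (g ^+ n) -> A i g.
  by case: (pP i) => _ [_ [_ [_ [_ [_ [_ [_ [_ []]]]]]]]].
have [||U [uU UD]] := @ultra_exists I I (fun i k => forall f, H i f -> H k f) i0.
- by move=> i; exists i.
- move=> i j; have [k [h1 h2]] := dir i j; exists k => l hl.
  by split=> f hf; apply: hl; [apply: h1|apply: h2].
have [Uand [Umono [nU0 Uor]]] := uU.
have GU f : G f -> U (fun i => H i f).
  by move=> /GH [i hi]; apply: Umono (UD i) => k; apply.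
pose lei x y := U (fun i => le i x y).
pose Ai x := U (fun i => A i x).
have kerE x : ker lei x <-> U (fun i => ker (le i) x) by apply: ker_lim.
exists lei, Ai.
split; first exact: lim_lpre.
split; first exact: lim_nontrivial.
split.
  move=> b g /GU Gb /GU Gg /kerE kb; apply/kerE.
  by apply: Umono (Uand _ _ Gb (Uand _ _ Gg kb)) => i [? [? ?]]; apply: nB.
split.
  split; first by apply: Umono (UD i0) => i _; case: (sA i).
  split=> [x y Ax Ay|x Ax].
    by apply: Umono (Uand _ _ Ax Ay) => i [? ?]; have [_ [AM _]] := sA i; apply: AM.
  by apply: Umono Ax => i ?; have [_ [_ AV]] := sA i; apply: AV.
split.
  by move=> a Aa; have [i /AH hi] := ultra_inhabited uU Aa; apply/GH; exists i.
split.
  by move=> a g Aa /GU Gg; apply: Umono (Uand _ _ Aa Gg) => i [? ?]; apply: nA.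
split.
  by move=> g /GU Gg /kerE kg; apply: Umono (Uand _ _ Gg kg) => i [? ?]; apply: BA.
split.
  by move=> a a' Aa Aa'; apply/kerE; apply: Umono (Uand _ _ Aa Aa') => i [? ?]; apply: RA.
split.
  move=> a g Aa na /GU Gg /kerE kg.
  have na' : U (fun i => ~ ker (le i) a).
    by case: (Uor (fun i => ker (le i) a)) => // ka; case: na; apply/kerE.
  apply: Umono (Uand _ _ (Uand _ _ Aa na') (Uand _ _ Gg kg)) => i [[? ?] [? ?]].
  exact: (CA i a).
split.
  by move=> g h /GU Gg /GU Gh; apply: Umono (Uand _ _ Gg Gh) => i [? ?]; apply: RG.
by move=> g n /GU Gg n0 An; apply: Umono (Uand _ _ Gg An) => i [? ?]; apply: (TG i g n).
Qed.

End DirectedUnion.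

Section Subquotients.

Variable F : groupType.
Hypothesis fgF : finitely_generated F.

(* A subquotient of [F] isomorphic to a subgroup of [Q], presented by the graph
   [R <= F * Q] of the quotient map; the kernel is [fun f => R f 1]. *)
Definition subgroup_rel (Q : groupType) (R : F -> Q -> Prop) : Prop :=
  R 1 1 /\ (forall f q f' q', R f q -> R f' q' -> R (f * f') (q * q')) /\
  (forall f q, R f q -> R f^-1 q^-1).

Definition dom (Q : Type) (R : F -> Q -> Prop) (f : F) : Prop := exists q, R f q.

Definition tame (Q : groupType) : Prop := forall R : F -> Q -> Prop, subgroup_rel R ->
  good (dom R) (fun f => R f 1) -> concl (dom R).

Lemma dom_subgroup (Q : groupType) (R : F -> Q -> Prop) : subgroup_rel R -> is_subgroup (dom R).
Proof.
move=> [R1 [RM RV]]; split; first by exists 1.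
split=> [x y [q Rq] [q' Rq']|x [q Rq]]; first by exists (q * q'); apply: RM.
by exists q^-1; apply: RV.
Qed.

Lemma subgroup_relJ (Q : groupType) (R : F -> Q -> Prop) f q f' q' :
  subgroup_rel R -> R f q -> R f' q' -> R (f ^ f') (q ^ q').
Proof.
by move=> [R1 [RM RV]] Rf Rf'; rewrite !conjgE; apply: (RM); [apply: RV|apply: (RM)].
Qed.

Lemma subgroup_relR (Q : groupType) (R : F -> Q -> Prop) f q f' q' :
  subgroup_rel R -> R f q -> R f' q' -> R [~ f, f'] [~ q, q'].
Proof.
move=> sR Rf Rf'; have [R1 [RM RV]] := sR; rewrite !commgEl.
by apply: (RM); [apply: RV|apply: subgroup_relJ].
Qed.

Lemma hom1 (A B : groupType) (f : A -> B) : is_hom f -> f 1 = 1.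
Proof. by move=> fM; apply: (mulgI (f 1)); rewrite -fM !mulg1. Qed.

Lemma homV (A B : groupType) (f : A -> B) x : is_hom f -> f x^-1 = (f x)^-1.
Proof. by move=> fM; apply: (mulgI (f x)); rewrite -fM !mulgV hom1. Qed.

Lemma homR (A B : groupType) (f : A -> B) x y : is_hom f -> f [~ x, y] = [~ f x, f y].
Proof. by move=> fM; rewrite !commgEl !conjgE !fM !homV. Qed.

Lemma homX (A B : groupType) (f : A -> B) x n : is_hom f -> f (x ^+ n) = f x ^+ n.
Proof. by move=> fM; elim: n => [|n IH]; rewrite ?expg0 ?hom1 // !expgS fM IH. Qed.

Lemma tame_NS (Q : groupType) : NS Q -> tame Q.
Proof.
move=> nsQ R sR gR; have sG := dom_subgroup sR.
apply: (no_free_concl fgF sG gR) => a b [qa Ra] [qb Rb].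
have [R1 [RM RV]] := sR.
have Rw w : R (word_eval a b w) (word_eval qa qb w).
  by elim: w => // c w IH /=; apply: (RM) => //; case: c.
apply: NNPP => h; apply: nsQ; exists qa, qb => w1 w2 _ _ E.
apply: NNPP => nw; apply: h; exists w1, w2; split=> //.
by rewrite -(mulVg (word_eval qa qb w1)) {2}E; apply: RM => //; apply: RV.
Qed.

Lemma tame_sub (Q H : groupType) (i : H -> Q) : is_hom i -> injective i -> tame Q -> tame H.
Proof.
move=> iM iI tQ R [R1 [RM RV]] gR.
pose R' f q := exists2 h, R f h & i h = q.
have E : dom R' = dom R.
  apply: boolp.funext => f; apply: boolp.propext; split=> [[q [h Rh _]]|[h Rh]].
    by exists h.
  by exists (i h), h.
have E1 : (fun f => R' f 1) = (fun f => R f 1).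
  apply: boolp.funext => f; apply: boolp.propext; split=> [[h Rh]|Rf].
    by rewrite -(hom1 iM) => /iI <-.
  by exists 1 => //; apply: hom1.
rewrite -E; apply: tQ; last by rewrite E E1.
split; first by exists 1 => //; apply: hom1.
split=> [f q f' q' [h Rh <-] [h' Rh' <-]|f q [h Rh <-]].
  by exists (h * h') => //; apply: RM.
by exists h^-1; [apply: RV|rewrite homV].
Qed.

Lemma tame_quo (Q H : groupType) (p : Q -> H) : is_hom p -> is_surj p -> tame Q -> tame H.
Proof.
move=> pM pS tQ R [R1 [RM RV]] gR.
pose R' f q := R f (p q).
have E : dom R' = dom R.
  apply: boolp.funext => f; apply: boolp.propext; split=> [[q Rq]|[h Rh]].
    by exists (p q).
  by have [q E] := pS h; exists q; rewrite /R' E.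
have E1 : (fun f => R' f 1) = (fun f => R f 1) by rewrite /R' hom1.
rewrite -E; apply: tQ; last by rewrite E E1.
split; first by rewrite /R' hom1.
split=> [f q f' q'|f q]; first by rewrite /R' pM; apply: RM.
by rewrite /R' homV //; apply: RV.
Qed.

(** The preimage of K has the conclusion by [tK]. Then [concl_dichotomy] either settles the whole
    group or makes this preimage [good], and it is the kernel needed to apply [tH]. *)
Lemma tame_ext (Q K H : groupType) (i : K -> Q) (p : Q -> H) :
  is_hom i -> injective i -> is_hom p ->
  (forall g : Q, p g = 1 <-> exists k : K, i k = g) ->
  tame K -> tame H -> tame Q.
Proof.
move=> iM iI pM ex tK tH R sR gR; have [R1 [RM RV]] := sR.
pose RK f k := R f (i k); pose RH f h := exists2 q, R f q & p q = h.
have sRK : subgroup_rel RK.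
  split; first by rewrite /RK hom1.
  split=> [f q f' q'|f q]; first by rewrite /RK iM; apply: RM.
  by rewrite /RK homV //; apply: RV.
have sRH : subgroup_rel RH.
  split; first by exists 1 => //; apply: hom1.
  split=> [f q f' q' [h Rh <-] [h' Rh' <-]|f q [h Rh <-]].
    by exists (h * h') => //; apply: RM.
  by exists h^-1; [apply: RV|rewrite homV].
have E1 : (fun f => RK f 1) = (fun f => R f 1) by rewrite /RK hom1.
have sL := dom_subgroup sRK; have sG := dom_subgroup sR.
have LG f : dom RK f -> dom R f by move=> [k Rk]; exists (i k).
have cL : concl (dom RK).
  by apply: tK => //; rewrite E1; apply: goodS gR.
have nL : normalised (dom R) (dom RK).
  move=> f g [k Rk] [q Rq].
  have [k' Ek'] : exists k', i k' = i k ^ q.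
    apply/ex; rewrite conjgE !pM homV //.
    by have -> : p (i k) = 1; [apply/ex; exists k|rewrite mul1g mulVg].
  by exists k'; rewrite /RK Ek'; apply: subgroup_relJ.
have EH : dom RH = dom R.
  apply: boolp.funext => f; apply: boolp.propext; split=> [[h [q Rq _]]|[q Rq]].
    by exists q.
  by exists (p q), q.
have EH1 : (fun f => RH f 1) = dom RK.
  apply: boolp.funext => f; apply: boolp.propext; split=> [[q Rq]|[k Rk]].
    by move=> /ex [k Ek]; exists k; rewrite /RK Ek.
  by exists (i k) => //; apply/ex; exists k.
case: (concl_dichotomy fgF sG sL LG nL cL) => // gL.
by rewrite -EH; apply: tH => //; rewrite EH EH1.
Qed.

Lemma tame_union (Q : groupType) (I : Type) (H : I -> groupType) (f : forall i, H i -> Q) :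
  (forall i, is_hom (f i)) -> (forall i, injective (f i)) ->
  (forall i j, exists k, (forall h : H i, exists h' : H k, f k h' = f i h) /\
                         (forall h : H j, exists h' : H k, f k h' = f j h)) ->
  (forall g : Q, exists i (h : H i), f i h = g) ->
  (forall i, tame (H i)) -> tame Q.
Proof.
move=> fM fI dir cover tH R sR gR; have [R1 [RM RV]] := sR.
pose Ri i x h := R x (f i h).
have [i0 _] := cover 1.
apply: (@concl_union F fgF I i0 (fun i => dom (Ri i))).
- move=> i; apply: tH.
    split; first by rewrite /Ri hom1.
    split=> [x q x' q'|x q]; first by rewrite /Ri fM; apply: RM.
    by rewrite /Ri homV //; apply: RV.
  have -> : (fun x => Ri i x 1) = (fun x => R x 1) by rewrite /Ri hom1.
  by apply: goodS gR => x [h Rh]; exists (f i h).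
- move=> i j; have [k [h1 h2]] := dir i j.
  by exists k; split=> x [h Rh]; [have [h' E] := h1 h|have [h' E] := h2 h]; exists h'; rewrite /Ri E.
- move=> x; split=> [[q Rq]|[i [h Rh]]]; last by exists (f i h).
  by have [i [h E]] := cover q; exists i, h; rewrite /Ri E.
Qed.

End Subquotients.

(** * Piecewise linear homeomorphisms *)

Section PiecewiseLinear.

Local Open Scope R_scope.

Variable f : R -> R.
Hypothesis PLf : is_PL_homeo f.

Lemma PL_mono x y : x < y -> f x < f y.
Proof.
have [f0 [f1 [mono [_ [out _]]]]] := PLf => xy.
have in01 w : 0 <= w <= 1 -> 0 <= f w <= 1.
  move=> [w0 w1]; split.
    case: w0 => [w0|<-]; last by rewrite f0; lra.
    by have := mono 0 w (Rle_refl 0) w0 w1; lra.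
  case: w1 => [w1|->]; last by rewrite f1; lra.
  by have := mono w 1 w0 w1 (Rle_refl 1); lra.
case: (Rlt_le_dec x 0) => x0.
  rewrite (out x); last by left.
  case: (Rlt_le_dec y 0) => y0; first by rewrite (out y); [|left].
  case: (Rlt_le_dec 1 y) => y1; first by rewrite (out y); [|right].
  by have := in01 y (conj y0 y1); lra.
case: (Rlt_le_dec 1 x) => x1.
  by rewrite !out //; right; lra.
case: (Rlt_le_dec 1 y) => y1; last by apply: mono.
by rewrite (out y); [have := in01 x (conj x0 x1); lra|right].
Qed.

(** At the end 1 the right germ is affine as well, because outside the unit interval the function is
    the identity. *)
Lemma PL_right_affine x : 0 <= x <= 1 ->
  exists d a b, x < d /\ forall y, x <= y <= d -> f y = a * y + b.
Proof.
have [f0 [f1 [_ [_ [out [n [t [a [b [t0 [tn [_ aff]]]]]]]]]]]] := PLf.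
move=> [x0 [x1|->]]; last first.
  exists 2, 1, 0; split=> [|y [y1 y2]]; first lra.
  by case: y1 => [y1|<-]; [rewrite out; [lra|right]|lra].
have [i [ni ti]] : exists i, (i < n)%N /\ t i <= x < t i.+1.
  have : x < t n by rewrite tn.
  elim: n {tn aff} => [|n IH] tn; first by lra.
  case: (Rle_lt_dec (t n) x) => h; first by exists n; split; [exact: ltnSn|lra].
  by have [i [ni hi]] := IH h; exists i; split=> //; apply: ltnW.
exists (t i.+1), (a i), (b i); split; first lra.
by move=> y hy; apply: aff => //; lra.
Qed.

Lemma PL_left_affine x : 0 <= x <= 1 ->
  exists c a b, c < x /\ forall y, c <= y <= x -> f y = a * y + b.
Proof.
have [f0 [f1 [_ [_ [out [n [t [a [b [t0 [tn [_ aff]]]]]]]]]]]] := PLf.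
move=> [[x0|<-] x1]; last first.
  exists (-1), 1, 0; split=> [|y [y1 y2]]; first lra.
  by case: y2 => [y2|->]; [rewrite out; [lra|left]|lra].
have [i [ni ti]] : exists i, (i < n)%N /\ t i < x <= t i.+1.
  have : x <= t n by rewrite tn.
  elim: n {tn aff} => [|n IH] tn; first by lra.
  case: (Rlt_le_dec (t n) x) => h; first by exists n; split; [exact: ltnSn|lra].
  by have [i [ni hi]] := IH h; exists i; split=> //; apply: ltnW.
exists (t i), (a i), (b i); split; first lra.
by move=> y hy; apply: aff => //; lra.
Qed.

End PiecewiseLinear.

(** Localised to an invariant set [D], because supports will be controlled only on a half-line. *)
Lemma disjoint_supports_commute (D A1 A2 : R -> Prop) (f1 f2 : R -> R) :
  (forall y, D y -> D (f1 y)) -> (forall y, D y -> D (f2 y)) ->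
  (forall y, D y -> ~ A1 y -> f1 y = y) -> (forall y, D y -> ~ A2 y -> f2 y = y) ->
  (forall y, D y -> A1 y -> A1 (f1 y)) -> (forall y, D y -> A2 y -> A2 (f2 y)) ->
  (forall y, D y -> A1 y -> ~ A2 y) -> forall y, D y -> f1 (f2 y) = f2 (f1 y).
Proof.
move=> D1 D2 o1 o2 s1 s2 dis y Dy.
case: (classic (A1 y)) => h1.
  rewrite (o2 y) //; last exact: dis.
  by rewrite o2 //; [apply: D1|apply: dis; [apply: D1|apply: s1]].
rewrite (o1 y) //; case: (classic (A2 y)) => h2; last by rewrite (o2 y) // o1.
by rewrite o1 //; [apply: D2|move=> /dis; apply; [apply: D2|apply: s2]].
Qed.

Section PLGroup.

Variables (F Q : groupType).
Hypothesis fgF : finitely_generated F.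
Variable phi : Q -> R -> R.
Hypotheses (phiI : injective phi) (phiM : forall x y, phi (x * y) = (phi x \o phi y)).
Hypothesis phiPL : forall q, is_PL_homeo (phi q).

Local Open Scope R_scope.

Let mono q x y : x < y -> phi q x < phi q y. Proof. exact: PL_mono. Qed.

Let inj q x y : phi q x = phi q y -> x = y.
Proof.
by case: (Rtotal_order x y) => [/(mono q)|[//|/(mono q)]]; lra.
Qed.

Let monoE q x y : phi q x < phi q y <-> x < y.
Proof.
split=> [h|]; last exact: mono.
by case: (Rtotal_order x y) => [//|[E|/(mono q)]]; [rewrite E in h|]; lra.
Qed.

Let phi1 x : phi 1%g x = x.
Proof.
by apply: (inj (q := 1%g)); have := congr1 (fun h => h x) (phiM 1%g 1%g); rewrite mulg1.
Qed.

Let phiME p q x : phi (p * q)%g x = phi p (phi q x). Proof. by rewrite phiM. Qed.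

Let phiK q x : phi q^-1 (phi q x) = x. Proof. by rewrite -phiME mulVg phi1. Qed.

Let phiVK q x : phi q (phi q^-1 x) = x. Proof. by rewrite -phiME mulgV phi1. Qed.

Let phiV q x : phi q x = x -> phi q^-1 x = x.
Proof. by move=> E; rewrite -{1}E phiK. Qed.

Let phiJ p q x : phi (p ^ q)%g x = phi q^-1 (phi p (phi q x)).
Proof. by rewrite conjgE !phiME. Qed.

Let phiR p q x : phi p (phi q x) = phi q (phi p x) -> phi [~ p, q]%g x = x.
Proof. by move=> E; rewrite commgEl conjgE !phiME E !phiK. Qed.

Let phi_le0 q x : x <= 0 -> phi q x = x.
Proof.
have [f0 [_ [_ [_ [out _]]]]] := phiPL q.
by case=> [h|->]; [apply: out; left|].
Qed.

Let phi_ge1 q x : 1 <= x -> phi q x = x.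
Proof.
have [_ [f1 [_ [_ [out _]]]]] := phiPL q.
by case=> [h|<-]; [apply: out; right|].
Qed.

Variable R' : F -> Q -> Prop.
Hypothesis sR : subgroup_rel R'.
Variable T : seq Q.

Let Gam q := exists f, R' f q.

Hypothesis genT : forall q, Gam q -> gen_by (fun x => x \in T) q.
Hypothesis TGam : forall q, q \in T -> Gam q.

Let R1 : R' 1%g 1%g. Proof. by case: sR. Qed.
Let RM f q f' q' : R' f q -> R' f' q' -> R' (f * f')%g (q * q')%g.
Proof. by case: sR => _ [h _]; apply: h. Qed.
Let RV f q : R' f q -> R' f^-1%g q^-1%g.
Proof. by case: sR => _ [_ h]; apply: h. Qed.
Let GamV q : Gam q -> Gam q^-1%g. Proof. by move=> [f Rf]; exists f^-1%g; apply: RV. Qed.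
Let GamM p q : Gam p -> Gam q -> Gam (p * q)%g.
Proof. by move=> [f Rf] [f' Rf']; exists (f * f')%g; apply: RM. Qed.

Definition fixed_point x := 0 <= x <= 1 /\ forall q, Gam q -> phi q x = x.

Lemma fixed_pointT x : 0 <= x <= 1 -> (forall q, q \in T -> phi q x = x) -> fixed_point x.
Proof.
move=> x01 fT; split=> // q /genT; elim=> {q} [q /fT||p q _ hp _ hq|q _ hq] //.
  by rewrite phiME hq.
exact: phiV.
Qed.

Lemma fixed_point0 : fixed_point 0.
Proof. by split=> [|q _]; [lra|apply: phi_le0; lra]. Qed.

Lemma fixed_point1 : fixed_point 1.
Proof. by split=> [|q _]; [lra|apply: phi_ge1; lra]. Qed.

Definition germ_trivial q := forall x, fixed_point x ->
  exists c d, c < x < d /\ forall y, c < y < d -> phi q y = y.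

Lemma germ_trivial1 : germ_trivial 1%g.
Proof. by move=> x _; exists (x - 1), (x + 1); split=> [|y _]; [lra|apply: phi1]. Qed.

Lemma germ_trivialM p q : germ_trivial p -> germ_trivial q -> germ_trivial (p * q)%g.
Proof.
move=> kp kq x fx; have [c [d [cd hp]]] := kp x fx; have [c' [d' [cd' hq]]] := kq x fx.
exists (Rmax c c'), (Rmin d d'); split.
  by split; [apply: Rmax_lub_lt; lra|apply: Rmin_glb_lt; lra].
move=> y [y1 y2]; have := Rmax_l c c'; have := Rmax_r c c'; have := Rmin_l d d'.
by have := Rmin_r d d' => *; rewrite phiME hq ?hp //; lra.
Qed.

Lemma germ_trivialV q : germ_trivial q -> germ_trivial q^-1%g.
Proof.
move=> kq x fx; have [c [d [cd hq]]] := kq x fx.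
by exists c, d; split=> // y /hq /phiV.
Qed.

Lemma germ_trivialJ q h : Gam h -> germ_trivial q -> germ_trivial (q ^ h)%g.
Proof.
move=> Gh kq x fx; have [c [d [cd hq]]] := kq x fx; have [_ hfx] := fx.
exists (phi h^-1 c), (phi h^-1 d); split.
  by rewrite -(hfx _ (GamV Gh)); split; apply: mono; lra.
move=> y [y1 y2]; rewrite phiJ hq ?phiK //.
by rewrite -{1}[c](phiVK h) -{1}[d](phiVK h); split; apply: mono.
Qed.

(* Affine germs fixing the same point commute. *)
Lemma germ_trivialR p q : Gam p -> Gam q -> germ_trivial [~ p, q]%g.
Proof.
move=> Gp Gq x fx; have [x01 hx] := fx.
have px := hx p Gp; have qx := hx q Gq.
have [d1 [a1 [b1 [xd1 h1]]]] := PL_right_affine (phiPL p) x01.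
have [d2 [a2 [b2 [xd2 h2]]]] := PL_right_affine (phiPL q) x01.
have [c1 [a1' [b1' [xc1 h1']]]] := PL_left_affine (phiPL p) x01.
have [c2 [a2' [b2' [xc2 h2']]]] := PL_left_affine (phiPL q) x01.
pose d := Rmin (Rmin d1 d2) (Rmin (phi q^-1 d1) (phi p^-1 d2)).
pose c := Rmax (Rmax c1 c2) (Rmax (phi q^-1 c1) (phi p^-1 c2)).
exists c, d; split.
  have i1 : x < phi q^-1 d1 by rewrite -(phiV qx); apply: mono.
  have i2 : x < phi p^-1 d2 by rewrite -(phiV px); apply: mono.
  have i3 : phi q^-1 c1 < x by rewrite -(phiV qx); apply: mono.
  have i4 : phi p^-1 c2 < x by rewrite -(phiV px); apply: mono.
  by split; [do ![apply: Rmax_lub_lt => //]|do ![apply: Rmin_glb_lt => //]].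
move=> y [yc yd]; apply: phiR.
case: (Rle_lt_dec x y) => xy.
  have e1 : y < d1 by apply: Rlt_le_trans yd _; apply: Rle_trans (Rmin_l _ _) (Rmin_l _ _).
  have e2 : y < d2 by apply: Rlt_le_trans yd _; apply: Rle_trans (Rmin_l _ _) (Rmin_r _ _).
  have e3 : phi q y < d1.
    rewrite -[d1](phiVK q); apply: mono; apply: Rlt_le_trans yd _.
    exact: Rle_trans (Rmin_r _ _) (Rmin_l _ _).
  have e4 : phi p y < d2.
    rewrite -[d2](phiVK p); apply: mono; apply: Rlt_le_trans yd _.
    exact: Rle_trans (Rmin_r _ _) (Rmin_r _ _).
  have e5 : x <= phi q y by case: xy => [/(mono q)|<-]; lra.
  have e6 : x <= phi p y by case: xy => [/(mono p)|<-]; lra.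
  rewrite (h1 (phi q y) ltac:(lra)) (h2 (phi p y) ltac:(lra)).
  rewrite (h1 y ltac:(lra)) (h2 y ltac:(lra)).
  have := h1 x; have := h2 x; rewrite px qx => k2 k1.
  have {}k1 := k1 ltac:(lra); have {}k2 := k2 ltac:(lra).
  have -> : b1 = x - a1 * x by lra.
  have -> : b2 = x - a2 * x by lra.
  by ring.
have e1 : c1 < y by apply: Rle_lt_trans yc; apply: Rle_trans (Rmax_l _ _) (Rmax_l _ _).
have e2 : c2 < y by apply: Rle_lt_trans yc; apply: Rle_trans (Rmax_r _ _) (Rmax_l _ _).
have e3 : c1 < phi q y.
  rewrite -[c1](phiVK q); apply: mono; apply: Rle_lt_trans yc.
  exact: Rle_trans (Rmax_l _ _) (Rmax_r _ _).
have e4 : c2 < phi p y.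
  rewrite -[c2](phiVK p); apply: mono; apply: Rle_lt_trans yc.
  exact: Rle_trans (Rmax_r _ _) (Rmax_r _ _).
have e5 := mono q xy; have e6 := mono p xy.
rewrite (h1' (phi q y) ltac:(lra)) (h2' (phi p y) ltac:(lra)).
rewrite (h1' y ltac:(lra)) (h2' y ltac:(lra)).
have := h1' x; have := h2' x; rewrite px qx => k2 k1.
have {}k1 := k1 ltac:(lra); have {}k2 := k2 ltac:(lra).
have -> : b1' = x - a1' * x by lra.
have -> : b2' = x - a2' * x by lra.
by ring.
Qed.

(* The quotients of this descending chain are trivial across fixed intervals and act on a single
   component of the complement of the fixed points otherwise. *)
Definition layer (u : R) (f : F) := exists2 q, R' f q &
  germ_trivial q /\ forall x y, fixed_point x -> x <= u -> y <= x -> phi q y = y.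

Lemma layer_subgroup u : is_subgroup (layer u).
Proof.
split.
  by exists 1%g => //; split=> [|x y *]; [apply: germ_trivial1|apply: phi1].
split=> [f f' [q Rq [kq hq]] [q' Rq' [kq' hq']]|f [q Rq [kq hq]]].
  exists (q * q')%g; first exact: RM.
  split=> [|x y fx xu yx]; first exact: germ_trivialM.
  by rewrite phiME (hq' x y) // (hq x y).
exists q^-1%g; first exact: RV.
split=> [|x y fx xu yx]; first exact: germ_trivialV.
by apply: phiV; apply: (hq x y).
Qed.

Let le_fixed q x y : Gam q -> fixed_point x -> y <= x -> phi q y <= x.
Proof.
move=> Gq [_ hx] [yx|->]; last by rewrite hx //; lra.
by have := mono q yx; rewrite (hx q Gq); lra.
Qed.

Lemma layer_normal u : normalised (dom R') (layer u).
Proof.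
move=> f g [q Rq [kq hq]] [h Rh]; have Gh : Gam h by exists g.
exists (q ^ h)%g; first exact: subgroup_relJ.
split=> [|x y fx xu yx]; first exact: germ_trivialJ.
by rewrite phiJ (hq x) ?phiK //; apply: le_fixed.
Qed.

Lemma layer_dom u f : layer u f -> dom R' f.
Proof. by move=> [q Rq _]; exists q. Qed.

Lemma layer_eq u v f : (forall x y, fixed_point x -> x <= v -> y <= x ->
    (exists x', fixed_point x' /\ x' <= u /\ y <= x') \/ fixed_point y) ->
  layer u f -> layer v f.
Proof.
move=> H [q Rq [kq hq]]; exists q => //; split=> // x y fx xv yx.
case: (H x y fx xv yx) => [[x' [fx' [xu yx']]]|[_ fy]]; first exact: (hq x' y).
by apply: fy; exists f.
Qed.

Lemma layer_top f : layer 1 f <-> R' f 1%g.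
Proof.
split=> [[q Rq [_ hq]]|Rf]; last first.
  by exists 1%g => //; split=> [|*]; [apply: germ_trivial1|apply: phi1].
suff -> : 1%g = q by [].
apply: phiI; apply: boolp.funext => y; rewrite phi1.
case: (Rle_lt_dec y 1) => y1; last by rewrite phi_ge1 //; lra.
by rewrite (hq 1 y) //; [apply: fixed_point1|lra].
Qed.

Let sG : is_subgroup (dom R') := dom_subgroup sR.

Section Component.

Variables (e x0 v : R).
Hypotheses (fe : fixed_point e) (fx0 : fixed_point x0) (ex0 : e < x0).
Hypothesis gap : forall x, fixed_point x -> e < x -> x < x0 -> False.

Lemma fixed_sup (A : R -> Prop) c : (forall q x, Gam q -> A x -> A (phi q x)) ->
  0 <= c <= 1 -> is_lub A c -> fixed_point c.
Proof.
move=> Aq c01 [c1 c2]; split=> // q Gq.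
have low h : Gam h -> c <= phi h c.
  move=> Gh; apply: c2 => y Ay; apply: Rnot_lt_le => hy.
  have := c1 _ (Aq _ _ (GamV Gh) Ay); apply: Rlt_not_le.
  by rewrite -(monoE h) phiVK.
apply: Rle_antisym; last exact: low.
apply: Rnot_lt_le => cq; have := low _ (GamV Gq); apply: Rlt_not_le.
by rewrite -(monoE q) phiVK.
Qed.

(** Otherwise the supremum of the orbit of [a] would be a common fixed point inside the gap. *)
Lemma push_across a b : e < a -> a < b -> b < x0 -> exists2 h, Gam h & b < phi h a.
Proof.
move=> ea ab bx0; apply: NNPP => nh.
have le_b h : Gam h -> phi h a <= b by move=> Gh; apply: Rnot_lt_le => hb; apply: nh; exists h.
have [||c cP] := completeness (fun y => exists2 h, Gam h & y = phi h a).
- by exists b => _ [h Gh ->]; apply: le_b.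
- by exists (phi 1%g a), 1%g => //; exists 1%g.
have ac : a <= c by apply: (proj1 cP); exists 1%g; [exists 1%g|rewrite phi1].
have cb : c <= b by apply: (proj2 cP) => _ [h Gh ->]; apply: le_b.
have [e01 _] := fe; have [x01 _] := fx0.
apply: (@gap c); [|lra|lra].
apply: (fixed_sup _ _ cP); last lra.
by move=> q _ Gq [h Gh ->]; exists (q * h)%g; [apply: GamM|rewrite phiME].
Qed.

(** Trivial germs at [e] and [x0] keep the supports away from both ends of the component, and
    finitely many elements share a margin. *)
Lemma margin (s : seq F) : (forall f, f \in s -> layer e f) ->
  exists m, 0 < m /\ forall f, f \in s -> exists q, R' f q /\
    forall y, y <= x0 -> y < e + m \/ x0 - m < y -> phi q y = y.
Proof.
elim: s => [|f s IH] hs; first by exists 1; split; [lra|].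
have [|m [m0 hm]] := IH; first by move=> g gs; apply: hs; rewrite inE gs orbT.
have [|q Rq [kq hq]] := hs f; first by rewrite inE eqxx.
have [c [d [cd h1]]] := kq e fe; have [c' [d' [cd' h2]]] := kq x0 fx0.
pose m' := Rmin m (Rmin (d - e) (x0 - c')).
have [m1 [m2 m3]] : m' <= m /\ m' <= d - e /\ m' <= x0 - c'.
  split; first exact: Rmin_l.
  by split; apply: Rle_trans (Rmin_r _ _) _; [apply: Rmin_l|apply: Rmin_r].
exists m'; split; first by do ![apply: Rmin_glb_lt => //]; lra.
move=> g; rewrite inE => /orP[/eqP->|gs]; last first.
  have [q' [Rq' hq']] := hm g gs; exists q'; split=> // y yx hy; apply: hq' => //.
  by case: hy => hy; [left|right]; lra.
exists q; split=> // y yx [hy|hy]; last by apply: h2; lra.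
case: (Rle_lt_dec y e) => ye; last by apply: h1; lra.
by apply: (hq e y) => //; lra.
Qed.

(** Some [h] carries [a] beyond [b], so the interval from [a] to [b] and its preimages under [h] and
    [h * h] are disjoint. Below [x0] they contain the supports of the three conjugates. *)
Lemma component_copies (s : seq F) : (forall f, f \in s -> layer e f) ->
  exists g h, dom R' g /\ dom R' h /\ forall x y, x \in s -> y \in s ->
    layer x0 [~ x, y ^ g]%g /\ layer x0 [~ x, y ^ h]%g /\ layer x0 [~ x ^ g, y ^ h]%g.
Proof.
move=> /margin [m [m0 hm]].
(* The quarter gives [a < b] and puts both points inside the margins, where the elements of [s] are
   the identity; so these elements preserve the interval. *)
pose m' := Rmin m (x0 - e) / 4.
have m1 : m' <= m / 4 by apply: Rmult_le_compat_r; [lra|apply: Rmin_l].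
have m2 : m' <= (x0 - e) / 4 by apply: Rmult_le_compat_r; [lra|apply: Rmin_r].
have m3 : 0 < m' by apply: Rdiv_lt_0_compat; [apply: Rmin_glb_lt; lra|lra].
pose a := e + m'; pose b := x0 - m'.
have ea : e < a by rewrite /a; lra.
have ab : a < b by rewrite /a /b; lra.
have bx0 : b < x0 by rewrite /b; lra.
have [h [g Rg] hab] := push_across ea ab bx0; have Gh : Gam h by exists g.
exists g, (g * g)%g; split; first by exists h.
split; first by exists (h * h)%g; apply: RM.
pose A k y := a < phi k y < b.
have key x y g1 g2 k1 k2 : x \in s -> y \in s -> R' g1 k1 -> R' g2 k2 ->
    (forall z, A k1 z -> ~ A k2 z) -> layer x0 [~ x ^ g1, y ^ g2]%g.
  move=> xs ys R1' R2' dis.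
  have [qx [Rx hx]] := hm x xs; have [qy [Ry hy]] := hm y ys.
  have Rx' := subgroup_relJ sR Rx R1'; have Ry' := subgroup_relJ sR Ry R2'.
  have Gk1 : Gam k1 by exists g1. have Gk2 : Gam k2 by exists g2.
  exists [~ qx ^ k1, qy ^ k2]%g; first exact: subgroup_relR.
  split; first by apply: germ_trivialR; [exists (x ^ g1)%g|exists (y ^ g2)%g].
  move=> z w fz zx0 wz; apply: phiR.
  have off q k r : Gam k -> (forall y, y <= x0 -> y < e + m \/ x0 - m < y -> phi q y = y) ->
      r <= x0 -> ~ A k r -> phi (q ^ k)%g r = r.
    move=> Gk hq rx nA; rewrite phiJ hq ?phiK //; first exact: le_fixed.
    case: (Rlt_le_dec (phi k r) (e + m)) => r1; [by left|right].
    apply: Rnot_le_lt => r2; apply: nA; rewrite /A /a /b; lra.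
  have on q k r : (forall y, y <= x0 -> y < e + m \/ x0 - m < y -> phi q y = y) ->
      A k r -> A k (phi (q ^ k)%g r).
    move=> hq [r1 r2]; rewrite /A phiJ phiVK.
    have qa : phi q a = a by apply: hq; [lra|left; rewrite /a; lra].
    have qb : phi q b = b by apply: hq; [lra|right; rewrite /b; lra].
    by split; [rewrite -qa|rewrite -qb]; apply: mono.
  apply: (@disjoint_supports_commute (fun r => r <= x0) (A k1) (A k2) (phi (qx ^ k1)%g) (phi (qy ^ k2)%g)); last lra.
  - by move=> r rx; apply: le_fixed => //; exists (x ^ g1)%g.
  - by move=> r rx; apply: le_fixed => //; exists (y ^ g2)%g.
  - by move=> r rx; apply: off.
  - by move=> r rx; apply: off.
  - by move=> r _; apply: on.
  - by move=> r _; apply: on.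
  - by move=> r _; apply: dis.
have up r : a < r -> b < phi h r by move=> /(mono h); lra.
move=> x y xs ys; split; [|split].
- rewrite -[x]conjg1; apply: (key x y 1%g g 1%g h) => // z [z1 z2] [z3 z4].
  by rewrite phi1 in z1; have := up z z1; lra.
- rewrite -[x]conjg1; apply: (key x y 1%g _ 1%g (h * h)%g) => //; first exact: RM.
  move=> z [z1 z2] [z3 z4]; rewrite phi1 in z1; rewrite phiME in z4.
  by have h1 := up z z1; have := up (phi h z) ltac:(lra); lra.
- apply: (key x y g _ h (h * h)%g) => //; first exact: RM.
  move=> z [z1 z2] [z3 z4]; rewrite phiME in z4.
  by have := up (phi h z) z1; lra.
Qed.

End Component.

(** Generators affine between [u] and [v] have at most one common fixed point there or fix
    everything between. The two layers differ only if there is exactly one, [x0], and it exceeds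
    [u]; the component is then bounded by [x0] and the last fixed point [e] up to [u]. *)
Lemma layer_step u v : 0 <= u -> u <= v -> v <= 1 ->
  (forall q, q \in T -> exists a b, forall y, u <= y <= v -> phi q y = a * y + b) ->
  good (dom R') (layer v) -> good (dom R') (layer u) \/ concl (dom R').
Proof.
move=> u0 uv v1 aff gv.
apply: (copies_step fgF sG (layer_subgroup u) (@layer_dom u) (@layer_normal u) gv) => s hs.
(* When the layers coincide, the trivial conjugators do: the quotient is trivial. *)
have easy : (forall f, layer u f -> layer v f) -> exists g h, dom R' g /\ dom R' h /\
    forall x y, x \in s -> y \in s ->
    layer v [~ x, y ^ g]%g /\ layer v [~ x, y ^ h]%g /\ layer v [~ x ^ g, y ^ h]%g.
  move=> uvl; have G1 : dom R' 1%g by exists 1%g.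
  exists 1%g, 1%g; do 2 split=> //; move=> x y xs ys; rewrite !conjg1.
  have := subgroupR (layer_subgroup v) (uvl x (hs x xs)) (uvl y (hs y ys)).
  by [].
case: (classic (exists x0, fixed_point x0 /\ u < x0 <= v)) => [[x0 [fx0 ux0]]|nx]; last first.
  apply: easy => f; apply: layer_eq => x y fx xv yx; left; exists x; split=> //; split=> //.
  by apply: Rnot_lt_le => ux; apply: nx; exists x.
case: (classic (exists x1, fixed_point x1 /\ u <= x1 <= v /\ x1 <> x0)) => [[x1 [fx1 [ux1 n1]]]|nx].
  have all y : u <= y <= v -> fixed_point y.
    move=> uy; apply: fixed_pointT; first lra.
    move=> q qT; have [a [b hab]] := aff q qT.
    have := hab x0 ltac:(lra); rewrite (proj2 fx0) => [h0|]; last exact: TGam.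
    have := hab x1 ltac:(lra); rewrite (proj2 fx1) => [h1|]; last exact: TGam.
    have a1 : a = 1 by apply: (Rmult_eq_reg_r (x1 - x0)); lra.
    by rewrite hab //; rewrite a1 in h0 *; lra.
  apply: easy => f; apply: layer_eq => x y fx xv yx.
  case: (Rle_lt_dec y u) => yu; last by right; apply: all; lra.
  by left; exists u; split; [apply: all; lra|split; [lra|]].
have uniq x : fixed_point x -> u <= x <= v -> x = x0.
  by move=> fx ux; apply: NNPP => n; apply: nx; exists x.
have [||e eP] := completeness (fun x => fixed_point x /\ x <= u).
- by exists u => x [].
- by exists 0; split=> //; apply: fixed_point0.
have e0 : 0 <= e by apply: (proj1 eP); split=> //; apply: fixed_point0.
have eu : e <= u by apply: (proj2 eP) => x [].
have fe : fixed_point e.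
  apply: (fixed_sup _ _ eP); last lra.
  by move=> q x Gq [fx xu]; rewrite (proj2 fx q Gq).
have below x : fixed_point x -> x <= v -> x <= x0.
  by move=> fx xv; case: (Rle_lt_dec x u) => xu; [lra|rewrite (uniq x) //; lra].
have gap x : fixed_point x -> e < x -> x < x0 -> False.
  move=> fx ex xx0; case: (Rle_lt_dec x u) => xu.
    by have := proj1 eP x (conj fx xu); lra.
  by have := uniq x fx ltac:(lra); lra.
have ex0 : e < x0 by lra.
have hs' f : f \in s -> layer e f.
  move=> /hs; apply: layer_eq => x y fx xe yx; left; exists x; split=> //; split=> //; lra.
have x0v f : layer x0 f -> layer v f.
  by apply: layer_eq => x y fx xv yx; left; exists x; split=> //; split=> //; apply: below.
have [g [h [Gg [Gh cop]]]] := component_copies fe fx0 ex0 gap hs'.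
exists g, h; do 2 split=> //; move=> x y xs ys; have [h1 [h2 h3]] := cop x y xs ys.
by split; [apply: x0v|split; apply: x0v].
Qed.

Let right_affine x (l : seq Q) : 0 <= x <= 1 -> exists d, x < d /\ forall q, q \in l ->
  exists a b, forall y, x <= y <= d -> phi q y = a * y + b.
Proof.
move=> x01; elim: l => [|q l [d [xd hd]]]; first by exists (x + 1); split=> //; lra.
have [d' [a [b [xd' hq]]]] := PL_right_affine (phiPL q) x01.
have ml := Rmin_l d d'; have mr := Rmin_r d d'.
exists (Rmin d d'); split; first exact: Rmin_glb_lt.
move=> p; rewrite inE => /orP[/eqP->|/hd [a' [b' h]]].
  by exists a, b => y hy; apply: hq; lra.
by exists a', b' => y hy; apply: h; lra.
Qed.

Let left_affine x (l : seq Q) : 0 <= x <= 1 -> exists c, c < x /\ forall q, q \in l ->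
  exists a b, forall y, c <= y <= x -> phi q y = a * y + b.
Proof.
move=> x01; elim: l => [|q l [d [xd hd]]]; first by exists (x - 1); split=> //; lra.
have [d' [a [b [xd' hq]]]] := PL_left_affine (phiPL q) x01.
have ml := Rmax_l d d'; have mr := Rmax_r d d'.
exists (Rmax d d'); split; first exact: Rmax_lub_lt.
move=> p; rewrite inE => /orP[/eqP->|/hd [a' [b' h]]].
  by exists a, b => y hy; apply: hq; lra.
by exists a', b' => y hy; apply: h; lra.
Qed.

(** Real induction downwards from 1, using that the finitely many generators share affine pieces
    beside every point: at the infimum [m] of the good cut points, a piece to the right makes [m]
    good and one to the left continues below [m]. Layer 0 contains all commutators, so one abelian
    step remains. *)
Lemma PL_concl : good (dom R') (fun f => R' f 1%g) -> concl (dom R').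
Proof.
move=> g1; apply: NNPP => nc.
have step u v : 0 <= u -> u <= v -> v <= 1 ->
    (forall q, q \in T -> exists a b, forall y, u <= y <= v -> phi q y = a * y + b) ->
    good (dom R') (layer v) -> good (dom R') (layer u).
  by move=> u0 uv v1 aff gv; case: (layer_step u0 uv v1 aff gv).
have gtop : good (dom R') (layer 1).
  have -> // : layer 1 = (fun f => R' f 1%g).
  by apply: boolp.funext => f; apply: boolp.propext; apply: layer_top.
have [||r rP] := completeness (fun r => 0 <= - r <= 1 /\ good (dom R') (layer (- r))).
- by exists 0 => r [hr _]; lra.
- by exists (Ropp 1); rewrite Ropp_involutive; split=> //; lra.
pose m := - r.
have mlow u : 0 <= u <= 1 -> good (dom R') (layer u) -> m <= u.
  move=> u01 gu; have : - u <= r; last by rewrite /m; lra.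
  by apply: (proj1 rP); rewrite Ropp_involutive.
have m0 : 0 <= m.
  have : r <= 0; last by rewrite /m; lra.
  by apply: (proj2 rP) => x [hx _]; lra.
have m1 := mlow 1 ltac:(lra) gtop.
have gm : good (dom R') (layer m).
  have [d [md aff]] := right_affine T (conj m0 m1).
  have [u [u01 [gu ud]]] : exists u, 0 <= u <= 1 /\ good (dom R') (layer u) /\ u < d.
    apply: NNPP => h; have : r <= - d; last by rewrite /m in md; lra.
    apply: (proj2 rP) => x [hx gx]; apply: Rnot_lt_le => dx; apply: h.
    by exists (- x); do 2 split=> //; lra.
  have mu := mlow u u01 gu.
  apply: (step m u) => //; first lra.
  by move=> q /aff [a [b hab]]; exists a, b => y hy; apply: hab; lra.
have g0 : good (dom R') (layer 0).
  case: m0 => [m0|E]; last by rewrite E.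
  have [c [cm aff]] := left_affine T (conj (Rlt_le _ _ m0) m1).
  have ml := Rmax_l c 0; have mr := Rmax_r c 0.
  have lt : Rmax c 0 < m by apply: Rmax_lub_lt.
  have : good (dom R') (layer (Rmax c 0)).
    apply: (step _ m) => //; first lra.
    by move=> q /aff [a [b hab]]; exists a, b => y hy; apply: hab; lra.
  by move=> /mlow; lra.
have nG : normalised (dom R') (dom R') by move=> x g; apply: subgroupJ.
case: (abelian_step fgF sG sG (fun f h => h) nG g0) => // [f f' [q Rq] [q' Rq']|].
  exists [~ q, q']%g; first exact: subgroup_relR.
  split=> [|x y _ x0 yx]; last by apply: phi_le0; lra.
  by apply: germ_trivialR; [exists f|exists f'].
by move=> /good_concl h; apply: nc; apply: h.
Qed.

End PLGroup.

(** * Reduction to finitely generated piecewise linear groups, and the theorem *)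

Section TamePL.

Variables (F Q : groupType).
Hypothesis fgF : finitely_generated F.

Inductive gen_rel (S : F -> Q -> Prop) : F -> Q -> Prop :=
| gen_rel_base f q : S f q -> gen_rel S f q
| gen_rel_one : gen_rel S 1 1
| gen_rel_mul f q f' q' : gen_rel S f q -> gen_rel S f' q' -> gen_rel S (f * f') (q * q')
| gen_rel_inv f q : gen_rel S f q -> gen_rel S f^-1 q^-1.

Lemma gen_rel_mono (S S' : F -> Q -> Prop) f q :
  (forall f q, S f q -> S' f q) -> gen_rel S f q -> gen_rel S' f q.
Proof.
move=> SS; elim=> {f q} [f q h||f q f' q' _ h _ h'|f q _ h].
- by apply: gen_rel_base; apply: SS.
- exact: gen_rel_one.
- exact: gen_rel_mul.
- exact: gen_rel_inv.
Qed.

(** [PL_concl] needs finitely many generators; a general subquotient is the directed union of those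
    generated by the kernel and finitely many pairs. *)
Lemma tame_P : iso_to_P Q -> tame F Q.
Proof.
move=> [phi [phiI [phiM [phiPL _]]]] R sR gR; have [R1 [RM RV]] := sR.
pose I := {s : seq (F * Q) | forall p, p \in s -> R p.1 p.2}.
(* Including the whole kernel makes it the same for all indices, so its goodness is inherited. *)
pose S (i : I) f q := (R f 1 /\ q = 1) \/ (f, q) \in sval i.
pose Ri i := gen_rel (S i).
have RiR i f q : Ri i f q -> R f q.
  elim=> {f q} [f q [[Rf ->]//|/(svalP i)//]|//|f q f' q' _ h _ h'|f q _ h].
    exact: RM.
  exact: RV.
have nilR (p : F * Q) : p \in [::] -> R p.1 p.2 by [].
apply: (@concl_union F fgF I (exist _ _ nilR) (fun i => dom (Ri i))).
- move=> i; have sRi : subgroup_rel (Ri i).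
    by split; [apply: gen_rel_one|split; [apply: gen_rel_mul|apply: gen_rel_inv]].
  apply: (@PL_concl F Q fgF phi phiI phiM phiPL (Ri i) sRi [seq p.2 | p <- sval i]).
  + move=> q [f]; elim=> {f q} [f q [[_ ->]|fq]||f q f' q' _ h _ h'|f q _ h].
    * exact: gen_one.
    * by apply: gen_base; apply/mapP; exists (f, q).
    * exact: gen_one.
    * exact: gen_mul.
    * exact: gen_inv.
  + by move=> q /mapP[[f q'] fq ->]; exists f; apply: gen_rel_base; right.
  have -> : (fun f => Ri i f 1) = (fun f => R f 1).
    apply: boolp.funext => f; apply: boolp.propext; split; first exact: RiR.
    by move=> Rf; apply: gen_rel_base; left.
  by apply: goodS gR => f [q /RiR Rq]; exists q.
- move=> i j; have ijR p : p \in sval i ++ sval j -> R p.1 p.2.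
    by rewrite mem_cat => /orP[]; [apply: (svalP i)|apply: (svalP j)].
  exists (exist _ _ ijR); split=> f [q h]; exists q; apply: gen_rel_mono h => f' q' [h|h].
  + by left.
  + by right; rewrite mem_cat h.
  + by left.
  + by right; rewrite mem_cat h orbT.
- move=> f; split=> [[q Rq]|[i [q /RiR Rq]]]; last by exists q.
  have sR' (p : F * Q) : p \in [:: (f, q)] -> R p.1 p.2 by rewrite inE => /eqP->.
  by exists (exist _ _ sR'), q; apply: gen_rel_base; right; rewrite /= inE.
Qed.

End TamePL.

Lemma tame_inC (F Q : groupType) : finitely_generated F -> inC Q -> tame F Q.
Proof.
move=> fgF; elim=> {Q}.
- exact: (tame_NS fgF).
- by move=> G; apply: (@tame_P F G fgF).
- by move=> G H f fM fI _; apply: tame_sub.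
- by move=> G H f fM fS _; apply: tame_quo.
- move=> G K H i p iM iI pM _ ex _ tK _ tH; exact: (tame_ext fgF iM iI pM ex).
- by move=> G I H f fM fI dir cover _ tH; apply: (tame_union fgF fM fI dir cover).
Qed.

Lemma trivial_fixd (F : groupType) : left_orderable F -> (exists x : F, x <> 1) ->
  fixd (fun x : F => x = 1).
Proof.
move=> [le [lr [la [lt [ltot linv]]]]] [x x1]; exists le; do 2 split=> //.
  by exists x => -[h1 h2]; apply: x1; apply: la.
by move=> _ ->; split.
Qed.

Theorem theorem4p12 (F G : groupType) (iota : G -> F) :
  is_hom iota -> injective iota ->
  inC G -> finitely_generated F -> left_orderable F -> (exists x : F, x <> 1) ->
  exists B : F -> Prop,
    left_relatively_convex B /\ (exists x : F, ~ B x) /\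
    is_normal (fun g : G => B (iota g)) /\
    exists A : G -> Prop,
      is_normal A /\
      (forall g : G, B (iota g) -> A g) /\
      (* A/(B∩G) is abelian *)
      (forall a a' : G, A a -> A a' -> B (iota [~ a, a'])) /\
      (* A/(B∩G) is torsion free *)
      (forall (a : G) (n : nat), A a -> (0 < n)%N -> B (iota (a ^+ n)) -> B (iota a)) /\
      (* A/(B∩G) is its own centralizer in G/(B∩G) *)
      (forall g : G, (forall a : G, A a -> B (iota [~ g, a])) <-> A g) /\
      (* G/A is abelian *)
      (forall g h : G, A [~ g, h]) /\
      (* G/A is torsion free *)
      (forall (g : G) (n : nat), (0 < n)%N -> A (g ^+ n) -> A g).
Proof.
move=> iM iI cG fgF loF ntF.
pose R f g := iota g = f.
have sR : subgroup_rel R.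
  split; first exact: hom1.
  by split=> [f q f' q' <- <-|f q <-]; [apply: iM|apply: homV].
have domI g : dom R (iota g) by exists g.
(* The kernel is trivial, and a left order on the nontrivial group [F] shows that it is fixed. *)
have gR : good (dom R) (fun f => R f 1).
  apply: fixd_good.
  - split; first exact: hom1.
    by rewrite /R hom1 //; split=> [x y <- <-|x <-]; rewrite ?mulg1 ?invg1.
  - by move=> n g; rewrite /R hom1 // => <- _; rewrite conj1g.
  - by apply: fixdS (trivial_fixd loF ntF) => x <-; apply: hom1.
have [le [A [ple [nt [nB [[A1 [AM AV]] [_ [nA [BA [RA [CA [RG TG]]]]]]]]]]]] :=
  tame_inC fgF cG sR gR.
have [B1 [BM BV]] := ker_subgroup ple.
have iJ x y : iota (x ^ y) = iota x ^ iota y by rewrite !conjgE !iM homV.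
exists (ker le); split; first exact: ker_relatively_convex.
split=> //; split.
  split; last by move=> x g Bx; rewrite iJ; apply: nB.
  split; first by rewrite hom1.
  by split=> [x y Bx By|x Bx]; [rewrite iM; apply: BM|rewrite homV //; apply: BV].
have root (a : G) n : (0 < n)%N -> ker le (iota (a ^+ n)) -> ker le (iota a).
  by move=> n0; rewrite homX //; apply: ker_rootclosed.
case: (classic (exists a, A (iota a) /\ ~ ker le (iota a))) => [[a0 [Aa0 na0]]|nA0].
  exists (fun g => A (iota g)); split.
    split; last by move=> x g Ax; rewrite iJ; apply: nA.
    split; first by rewrite hom1.
    by split=> [x y Ax Ay|x Ax]; [rewrite iM; apply: AM|rewrite homV //; apply: AV].
  split; first by move=> g; apply: BA.
  split; first by move=> a a' Aa Aa'; rewrite homR //; apply: RA.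
  split; first by move=> a n _; apply: root.
  split.
    move=> g; split=> [h|Ag a Aa]; last by rewrite homR //; apply: RA.
    by apply: (CA (iota a0)) => //; rewrite -homR //; apply: h.
  split; first by move=> g h; rewrite homR //; apply: RG.
  by move=> g n n0; rewrite homX //; apply: TG.
(* The centraliser clause of [concl] is void here, but all commutators lie in the kernel, so the
   quotient of [G] is abelian and equal to its own centraliser. *)
have AB a : A (iota a) -> ker le (iota a).
  by move=> Aa; apply: NNPP => na; apply: nA0; exists a.
have RB a a' : ker le (iota [~ a, a']).
  by apply: AB; rewrite homR //; apply: RG.
exists (fun _ => True); split; first by split.
split=> //; split; first by move=> a a' _ _; apply: RB.
split; first by move=> a n _; apply: root.
by split=> // g; split=> // _ a _; apply: RB.
Qed.
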